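(* Let $M\ge1$ be an integer and $\alpha>-1$ real. For all $x,y>0$ the following hold. (a) $$M^M\,K^{(\alpha,\frac1M)}(M^Mx,M^My)=\left(\frac{x}{y}\right)^{\alpha}K_{\nu_1,\ldots,\nu_M}(x,y)$$ with parameters $\nu_j=\alpha+\frac{j-1}{M}$, $j=1,\ldots,M$. (b) $$x^{\frac1M-1}\,K^{(\alpha,M)}\left(Mx^{\frac1M},My^{\frac1M}\right)=K_{\tilde\nu_1,\ldots,\tilde\nu_M}(y,x)$$ with parameters $\tilde\nu_j=\frac{\alpha}{M}-1+\frac{j}{M}$, $j=1,\ldots,M$.
   Context: For $\alpha>-1$, $\theta>0$ and $x,y>0$, $$K^{(\alpha,\theta)}(x,y)=\theta x^\alpha\int_0^1 J_{\frac{\alpha+1}{\theta},\frac1\theta}(xu)\,J_{\alpha+1,\theta}\big((yu)^\theta\big)\,u^\alpha\,du,$$ where $J_{a,b}(x)=\sum_{j=0}^\infty\frac{(-x)^j}{j!\,\Gamma(a+jb)}$ is Wright's generalized Bessel function. (These are the hard edge scaling limits of the biorthogonal ensembles with density proportional to $\prod_{j<k}(x_k-x_j)\prod_{j<k}(x_k^\theta-x_j^\theta)\prod_j w(x_j)$ for $w(x)=x^\alpha\chi_{(0,1]}(x)$ or $w(x)=x^\alpha e^{-x}$ on $x>0$.) For real $\nu_1,\ldots,\nu_M>-1$ and $\nu_0=0$, the kernel $K_{\nu_1,\ldots,\nu_M}$ is, for $x,y>0$, $$K_{\nu_1,\ldots,\nu_M}(x,y)=\int_0^1 G^{1,0}_{0,M+1}\left(\begin{matrix}-\\-\nu_0,-\nu_1,\ldots,-\nu_M\end{matrix}\Big|\,ux\right)G^{M,0}_{0,M+1}\left(\begin{matrix}-\\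 \nu_1,\ldots,\nu_M,\nu_0\end{matrix}\Big|\,uy\right)du,$$ with the Meijer G-functions, for $z>0$, $$G^{1,0}_{0,M+1}\left(\begin{matrix}-\\-\nu_0,\ldots,-\nu_M\end{matrix}\Big|\,z\right)=\frac1{2\pi i}\int_L\frac{\Gamma(s)}{\prod_{j=1}^M\Gamma(1+\nu_j-s)}z^{-s}\,ds,$$ $$G^{M,0}_{0,M+1}\left(\begin{matrix}-\\ \nu_1,\ldots,\nu_M,\nu_0\end{matrix}\Big|\,z\right)=\frac1{2\pi i}\int_L\frac{\prod_{j=1}^M\Gamma(s+\nu_j)}{\Gamma(1-s)}z^{-s}\,ds,$$ where $L$ is a loop that starts at $-\infty$ in the lower half plane, encircles all poles of the integrand once in the positive direction, and returns to $-\infty$ in the upper half plane. *)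

(* Defs.v *)
From Stdlib Require Import Arith Reals.
From Coquelicot Require Import Coquelicot.

Open Scope R_scope.

Definition Cexp (z : C) : C :=
  (exp (Re z) * cos (Im z), exp (Re z) * sin (Im z)).

(* Principal power; only meaningful for a base [z > 0]. *)
Definition Cpow_pos (z : R) (s : C) : C := Cexp (s * RtoC (ln z))%C.

(* The product of [f j] over [1 <= j <= n]. *)
Fixpoint Cprod (f : nat -> C) (n : nat) : C :=
  match n with
  | O => RtoC 1
  | S k => (Cprod f k * f (S k))%C
  end.

Definition C_lim_seq (u : nat -> C) : C :=
  (real (Lim_seq (fun n => Re (u n))), real (Lim_seq (fun n => Im (u n)))).

(* Gauss's formula  Gamma(s) = lim n! n^s / (s (s+1) ... (s+n)),  valid for
   every complex s other than 0, -1, -2, ....  At those points the terms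
   vanish from some rank on because [/ 0 = 0], so that [CGamma s = 0] and
   [/ CGamma s = 0], the latter being the value of the entire function
   1/Gamma there. *)
Definition CGamma (s : C) : C :=
  C_lim_seq (fun n =>
    (RtoC (INR (fact n)) * Cpow_pos (INR n) s /
       (s * Cprod (fun k => s + RtoC (INR k)) n))%C).

Definition RGamma (a : R) : R := Re (CGamma (RtoC a)).

Definition wright_J (a b x : R) : R :=
  Series (fun j => (- x) ^ j / (INR (fact j) * RGamma (a + INR j * b))).

(* For alpha < 0 the integral is improper at 0, whence [RInt_gen]. *)
Definition K_wright (alpha theta x y : R) : R :=
  theta * Rpower x alpha *
  RInt_gen
    (fun u => wright_J ((alpha + 1) / theta) (/ theta) (x * u)
              * wright_J (alpha + 1) theta (Rpower (y * u) theta)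
              * Rpower u alpha)
    (at_right 0) (at_point 1).

(* The loop running along the straight lines
     -oo - i loop_low -> loop_re - i loop_low
       -> loop_re + i loop_up -> -oo + i loop_up;
   it winds once, in the positive direction, around the points of the
   half-strip on its left and does not wind around any point outside the
   closed half-strip. *)
Record loop := Loop {
  loop_re : R;
  loop_low : posreal;
  loop_up : posreal
}.

Definition encircled (L : loop) (p : C) : Prop :=
  Re p < loop_re L /\ - loop_low L < Im p < loop_up L.

Definition loop_integral (L : loop) (f : C -> C) : C :=
  (RInt_gen (V := C_R_CompleteNormedModule)
     (fun t : R => f (t, (- loop_low L)%R))
     (Rbar_locally m_infty) (at_point (loop_re L))
   + RInt (V := C_R_CompleteNormedModule)
       (fun t : R => f (loop_re L, t) * Ci) (- loop_low L)%R (loop_up L)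
   - RInt_gen (V := C_R_CompleteNormedModule)
       (fun t : R => f (t, pos (loop_up L)))
       (Rbar_locally m_infty) (at_point (loop_re L)))%C.

Definition is_pole (f : C -> C) (p : C) : Prop :=
  filterlim (fun s => Cmod (f s)) (locally' p) (Rbar_locally p_infty).

Definition encircles_poles (L : loop) (f : C -> C) : Prop :=
  forall p : C, is_pole f p -> encircled L p.

(* In the Meijer G-functions below only nu 1, ..., nu M are used, and nu_0
   is 0. *)

Definition meijer_10_integrand (M : nat) (nu : nat -> R) (z : R) (s : C) : C :=
  (CGamma s / Cprod (fun j => CGamma (1 + RtoC (nu j) - s)) M
   * Cpow_pos z (- s))%C.

Definition meijer_M0_integrand (M : nat) (nu : nat -> R) (z : R) (s : C) : C :=
  (Cprod (fun j => CGamma (s + RtoC (nu j))) M / CGamma (1 - s)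
   * Cpow_pos z (- s))%C.

Definition meijer_10 (L : loop) (M : nat) (nu : nat -> R) (z : R) : C :=
  (/ (2 * RtoC PI * Ci) * loop_integral L (meijer_10_integrand M nu z))%C.

Definition meijer_M0 (L : loop) (M : nat) (nu : nat -> R) (z : R) : C :=
  (/ (2 * RtoC PI * Ci) * loop_integral L (meijer_M0_integrand M nu z))%C.

(* The two loops are admissible integration paths for the two Meijer
   G-functions occurring in the kernel with parameters [nu]. *)
Definition admissible_loops (M : nat) (nu : nat -> R) (L1 L2 : loop) : Prop :=
  forall z : R, 0 < z ->
    encircles_poles L1 (meijer_10_integrand M nu z) /\
    encircles_poles L2 (meijer_M0_integrand M nu z).

Definition K_meijer (L1 L2 : loop) (M : nat) (nu : nat -> R) (x y : R) : C :=
  RInt_gen (V := C_R_CompleteNormedModule)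
    (fun u : R => (meijer_10 L1 M nu (u * x) * meijer_M0 L2 M nu (u * y))%C)
    (at_right 0) (at_point 1).

(* Main.v *)
(** Gauss's multiplication formula turns the product of Gamma functions in each
    Meijer G-function into a single Gamma function, with a constant that cancels
    between the two G-functions. Both loop integrals then have the form of the
    integral of [Gamma(p(s+beta)) e^(kappa s) / Gamma(a - b s)], and the sum of
    its residues at the points [-beta - n/p] is a Wright Bessel function. Part
    (a) is then an equality of integrands up to a constant; part (b) is the same
    evaluation with [(alpha+1)/M - 1] in place of [alpha], followed by the
    substitution [u = v^M].

    The residue theorem is proved without complex differentiation: on a
    rectangle, Cauchy's formula is algebra and the fundamental theorem of
    calculus for polynomials, and it passes to uniform limits of polynomials.
    These form an algebra that contains [1/Gamma] (as a locally uniform limit of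
    Gauss's products) and, away from the poles, [Gamma]. *)

Require Import Defs.
From Stdlib Require Import Arith Reals Lra Lia List.
From Stdlib Require Import FunctionalExtensionality IndefiniteDescription.
From Coquelicot Require Import Coquelicot.

(** * Complex exponential and limits *)

(** Everything is phrased with the entire function [rgamma]. Since [/ 0 = 0], the relation
    [CGamma s = / rgamma s] holds at the poles too, so the identities between integrands are
    equalities of functions without side conditions.

    [approx] passes to reciprocals only when the real part stays away from 0, because [/ g] is
    expanded in a geometric series. This shapes the treatment of poles: each rectangle holds one of
    them, the recurrence moves the argument of Gamma into the right half-plane, and Gauss's products
    are inverted factor by factor.

    The loop is unbounded, so it is exhausted by rectangles cut halfway between poles. The left side
    of the rectangles disappears in the limit: in a horizontal strip [1/Gamma] decays to the right
    faster than any exponential, and [Gamma] stays bounded to the left away from its poles. The same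
    argument yields convergence of the Wright series, and from it the continuity of [wright_J] used
    for the integrals.

    An admissible loop surrounds the points where the integrand blows up. The rightmost pole is
    shown to be such a point; the other ones lie to its left on the real axis. *)

Lemma Cmod_minus_sym (a b : C) : Cmod (a - b) = Cmod (b - a).
Proof. rewrite <- (Cmod_opp (a - b)). f_equal. ring. Qed.

Lemma im_le_Cmod (z : C) : Rabs (Im z) <= Cmod z.
Proof. eapply Rle_trans; [apply Rmax_r | apply Rmax_Cmod]. Qed.

Lemma Cmod_le_Re_Im (z : C) : Cmod z <= Rabs (Re z) + Rabs (Im z).
Proof.
  replace z with (RtoC (Re z) + RtoC (Im z) * Ci)%C at 1.
  - eapply Rle_trans; [apply Cmod_triangle|].
    rewrite Cmod_mult, Cmod_Ci, !Cmod_R. lra.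
  - destruct z as [a b]. unfold RtoC, Ci, Cmult, Cplus; simpl. f_equal; ring.
Qed.

Lemma Cmod_sub_ge (a b : C) : Cmod a - Cmod b <= Cmod (a - b).
Proof.
  replace a with ((a - b) + b)%C at 1 by ring.
  generalize (Cmod_triangle (a - b) b); lra.
Qed.

Lemma Cinv_zero : (/ RtoC 0 = RtoC 0)%C.
Proof.
  unfold Cinv, RtoC; simpl. apply injective_projections; simpl; unfold Rdiv;
  rewrite ?Ropp_0; ring.
Qed.

Lemma Cinv_invol (z : C) : (/ / z = z)%C.
Proof.
  destruct (Ceq_dec z 0) as [->|H].
  - now rewrite !Cinv_zero.
  - field. exact H.
Qed.

Lemma Cinv_mult (a b : C) : (/ (a * b) = / a * / b)%C.
Proof.
  destruct (Ceq_dec a 0) as [->|Ha]; [rewrite Cmult_0_l, Cinv_zero; ring|].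
  destruct (Ceq_dec b 0) as [->|Hb]; [rewrite Cmult_0_r, Cinv_zero; ring|].
  field. now split.
Qed.

Lemma Cinv_nonzero (a : C) : a <> 0 -> (/ a)%C <> 0.
Proof.
  intros Ha H. apply Ha. now rewrite <- (Cinv_invol a), H, Cinv_zero.
Qed.

Lemma Re_pos_nonzero (z : C) : 0 < Re z -> z <> 0.
Proof. intros H ->. simpl in H. lra. Qed.

Lemma Re_le_Cmod (z : C) : Re z <= Cmod z.
Proof. eapply Rle_trans; [apply Rle_abs | apply re_le_Cmod]. Qed.

Lemma Cexp_plus (a b : C) : Cexp (a + b) = (Cexp a * Cexp b)%C.
Proof.
  destruct a as [x y], b as [x' y']. unfold Cexp; simpl.
  rewrite exp_plus, cos_plus, sin_plus.
  unfold Cmult; simpl; f_equal; ring.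
Qed.

Lemma Cexp_RtoC (x : R) : Cexp (RtoC x) = RtoC (exp x).
Proof. unfold Cexp, RtoC; simpl. rewrite cos_0, sin_0. f_equal; ring. Qed.

Lemma Cexp_0 : Cexp 0 = 1.
Proof. rewrite Cexp_RtoC, exp_0. reflexivity. Qed.

Lemma Cmod_Cexp (z : C) : Cmod (Cexp z) = exp (Re z).
Proof.
  unfold Cexp, Cmod; simpl.
  replace (_ + _) with (Rsqr (exp (Re z)) * (Rsqr (sin (Im z)) + Rsqr (cos (Im z))))
    by (unfold Rsqr; ring).
  rewrite sin2_cos2, Rmult_1_r. apply sqrt_Rsqr, Rlt_le, exp_pos.
Qed.

Lemma Cexp_nonzero (z : C) : Cexp z <> 0.
Proof. apply Cmod_gt_0. rewrite Cmod_Cexp. apply exp_pos. Qed.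

Lemma Cexp_opp (z : C) : Cexp (- z) = (/ Cexp z)%C.
Proof.
  assert (H : (Cexp (- z) * Cexp z)%C = 1).
  { rewrite <- Cexp_plus. replace (- z + z)%C with (RtoC 0) by ring. apply Cexp_0. }
  rewrite <- (Cmult_1_l (/ Cexp z)), <- H. field. apply Cexp_nonzero.
Qed.

Lemma Cexp_pow (z : C) (n : nat) : (Cexp z ^ n)%C = Cexp (RtoC (INR n) * z).
Proof.
  induction n as [|n IH].
  - simpl. now rewrite Cmult_0_l, Cexp_0.
  - rewrite Cpow_S, IH, <- Cexp_plus. f_equal. rewrite S_INR, RtoC_plus. ring.
Qed.

Lemma exp_le_compat (x y : R) : x <= y -> exp x <= exp y.
Proof. intros [H| ->]; [left; now apply exp_increasing | lra]. Qed.

(** * Taylor remainders of the exponential *)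

Lemma exp_sub_1_abs (x : R) : Rabs (exp x - 1) <= Rabs x * exp (Rabs x).
Proof.
  assert (H1 : forall t, 1 + t <= exp t).
  { intro t. destruct (Req_dec t 0) as [->|Ht]; [rewrite exp_0; lra|].
    left; now apply exp_ineq1. }
  assert (H2 : exp x * exp (- x) = 1) by (rewrite <- exp_plus, Rplus_opp_r; apply exp_0).
  pose proof (exp_pos x). pose proof (H1 x). pose proof (H1 (- x)).
  destruct (Rle_dec 0 x) as [Hx|Hx].
  - rewrite !Rabs_right by lra. nra.
  - rewrite (Rabs_left x), Rabs_left1 by (try nra; lra).
    pose proof (H1 (-x)). nra.
Qed.

Lemma exp_sub_1_sub_abs (x : R) : Rabs (exp x - 1 - x) <= Rabs x ^ 2 * exp (Rabs x).
Proof.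
  assert (H1 : forall t, 1 + t <= exp t).
  { intro t. destruct (Req_dec t 0) as [->|Ht]; [rewrite exp_0; lra|].
    left; now apply exp_ineq1. }
  assert (H2 : exp x * exp (- x) = 1) by (rewrite <- exp_plus, Rplus_opp_r; apply exp_0).
  pose proof (exp_pos x). pose proof (H1 x). pose proof (H1 (- x)).
  rewrite (Rabs_right (_ - _ - _)) by lra.
  pose proof (exp_sub_1_abs x). pose proof (Rle_abs (exp x - 1)).
  pose proof (Rabs_pos x).
  assert (exp x - 1 - x <= x * (exp x - 1)) by nra.
  assert (x * (exp x - 1) <= Rabs x * Rabs (exp x - 1)).
  { rewrite <- Rabs_mult. apply Rle_abs. }
  nra.
Qed.

Lemma sin_abs_le (y : R) : Rabs (sin y) <= Rabs y.
Proof.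
  assert (P : forall t, 0 < t -> Rabs (sin t) <= t).
  { intros t Ht. pose proof (sin_lt_x t Ht). apply Rabs_le. split; [|lra].
    destruct (Rle_dec t 1).
    - pose proof (sin_ge_0 t). pose proof PI2_1. lra.
    - pose proof (SIN_bound t). lra. }
  destruct (Rtotal_order y 0) as [H|[->|H]].
  - rewrite (Rabs_left y), <- Rabs_Ropp, <- sin_neg by lra. apply P; lra.
  - rewrite sin_0. lra.
  - rewrite (Rabs_right y) by lra. now apply P.
Qed.

Lemma sin_sub_abs (y : R) : Rabs (sin y - y) <= y ^ 2.
Proof.
  assert (P : forall t, 0 < t -> Rabs (sin t - t) <= t ^ 2).
  { intros t Ht. pose proof (sin_lt_x t Ht). destruct (Rle_dec t 1) as [H1|H1].
    - destruct (sin_bound t 0) as [A _].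
      + lra.
      + pose proof PI2_1; lra.
      + unfold sin_approx, sin_term in A; simpl in A.
        assert (t - t ^ 3 / 6 <= sin t) by lra.
        assert (0 <= t ^ 2 * (1 - t)) by (apply Rmult_le_pos; [apply pow2_ge_0 | lra]).
        pose proof (pow2_ge_0 t).
        replace (t ^ 2 * (1 - t)) with (t ^ 2 - t ^ 3) in * by ring.
        apply Rabs_le. split; lra.
    (* Beyond 1 crude bounds suffice: up to [PI] the sine is nonnegative and [t <= t^2]; after that
       [t + 1 <= t^2]. *)
    - pose proof (SIN_bound t). pose proof PI2_3_2. apply Rabs_le. split; [|nra].
      destruct (Rle_dec t PI); [pose proof (sin_ge_0 t) | ]; nra. }
  destruct (Rtotal_order y 0) as [H|[->|H]].
  - rewrite <- Rabs_Ropp. replace (- (sin y - y)) with (sin (- y) - - y) by (rewrite sin_neg; ring).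
    replace (y ^ 2) with ((- y) ^ 2) by ring. apply P. lra.
  - rewrite sin_0, Rminus_0_r, Rabs_R0. lra.
  - now apply P.
Qed.

Lemma cos_sub_abs (y : R) : Rabs (cos y - 1) <= y ^ 2.
Proof.
  replace y with (2 * (y / 2)) at 1 by field.
  rewrite cos_2a_sin.
  pose proof (sin_abs_le (y / 2)).
  replace (1 - 2 * sin (y / 2) * sin (y / 2) - 1) with (- (2 * (sin (y / 2) * sin (y / 2)))) by ring.
  rewrite Rabs_Ropp, !Rabs_mult, (Rabs_right 2) by lra.
  assert (Rabs (y / 2) * Rabs (y / 2) = y ^ 2 / 4) by (rewrite <- Rabs_mult, Rabs_right; nra).
  pose proof (Rabs_pos (sin (y / 2))). nra.
Qed.

(** This second-order bound drives both the convergence of Gauss's products and that of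
    [(1 + w/n)^n]. Real and imaginary part are each at most [2 r^2 exp r], whence the 4. *)
Lemma Cexp_sub_1_sub (w : C) :
  Cmod (Cexp w - 1 - w) <= 4 * Cmod w ^ 2 * exp (Cmod w).
Proof.
  destruct w as [x y]. set (r := Cmod (x, y)).
  assert (Hx : Rabs x <= r) by apply (re_le_Cmod (x, y)).
  assert (Hy : Rabs y <= r) by apply (im_le_Cmod (x, y)).
  eapply Rle_trans; [apply Cmod_le_Re_Im|]. simpl.
  pose proof (Rabs_pos x) as Px. pose proof (Rabs_pos y) as Py.
  assert (E : exp (Rabs x) <= exp r) by now apply exp_le_compat.
  assert (E1 : 1 <= exp r) by (rewrite <- exp_0; apply exp_le_compat; lra).
  assert (E0 : exp x <= exp r) by (apply exp_le_compat; pose proof (Rle_abs x); lra).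
  pose proof (exp_pos x) as E2.
  assert (Y2 : y ^ 2 = Rabs y ^ 2) by (symmetry; apply pow2_abs).
  replace (exp x * cos y + - (1) + - x) with ((exp x - 1 - x) + exp x * (cos y - 1)) by ring.
  replace (exp x * sin y + - 0 + - y) with ((exp x - 1) * sin y + (sin y - y)) by ring.
  pose proof (exp_sub_1_sub_abs x) as A1. pose proof (exp_sub_1_abs x) as A2.
  pose proof (sin_sub_abs y) as A3. pose proof (cos_sub_abs y) as A4.
  rewrite Y2 in A3, A4.
  assert (B1 : Rabs (exp x - 1 - x + exp x * (cos y - 1)) <= r^2 * exp r + r^2 * exp r).
  { eapply Rle_trans; [apply Rabs_triang|]. apply Rplus_le_compat.
    - eapply Rle_trans; [apply A1|]. apply Rmult_le_compat; try nra. left; apply exp_pos.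
    - rewrite Rabs_mult, (Rabs_right (exp x)) by lra. rewrite Rmult_comm.
      apply Rmult_le_compat; try nra. apply Rabs_pos. }
  assert (S1 : Rabs (sin y) <= r) by (pose proof (sin_abs_le y); lra).
  assert (B2 : Rabs ((exp x - 1) * sin y + (sin y - y)) <= r^2 * exp r + r^2 * exp r).
  { eapply Rle_trans; [apply Rabs_triang|]. apply Rplus_le_compat.
    - rewrite Rabs_mult.
      assert (Rabs (exp x - 1) <= r * exp r).
      { eapply Rle_trans; [apply A2|]. apply Rmult_le_compat; try lra. left; apply exp_pos. }
      replace (r^2 * exp r) with ((r * exp r) * r) by ring.
      apply Rmult_le_compat; try apply Rabs_pos; lra.
    - eapply Rle_trans; [apply A3|]. nra. }
  lra.
Qed.

(** Convergence is encoded as a real null sequence, so that limit arguments become inequalities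
    between moduli; [C_lim_seq_Clim] ties it to the coordinatewise limit used in [CGamma]. *)
Definition Clim (u : nat -> C) (l : C) : Prop :=
  is_lim_seq (fun n => Cmod (u n - l)) 0.

Lemma Clim_le (u : nat -> C) (l : C) (e : nat -> R) :
  (forall n, Cmod (u n - l) <= e n) -> is_lim_seq e 0 -> Clim u l.
Proof.
  intros H He. apply is_lim_seq_le_le with (fun _ => 0) e; auto.
  - intro n; split; [apply Cmod_ge_0 | apply H].
  - apply is_lim_seq_const.
Qed.

Lemma Clim_ext (u v : nat -> C) (l : C) :
  (forall n, u n = v n) -> Clim u l -> Clim v l.
Proof. intros H. apply is_lim_seq_ext. intro n; now rewrite H. Qed.

Lemma Clim_ext_loc (u v : nat -> C) (l : C) :
  (exists N, forall n, (N <= n)%nat -> u n = v n) -> Clim u l -> Clim v l.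
Proof. intros [N H]. apply is_lim_seq_ext_loc. exists N. intros n Hn. now rewrite H. Qed.

Lemma Clim_const (a : C) : Clim (fun _ => a) a.
Proof.
  apply Clim_le with (fun _ => 0); [|apply is_lim_seq_const].
  intros _. replace (a - a)%C with (RtoC 0) by ring. rewrite Cmod_0; lra.
Qed.

Lemma Clim_plus (u v : nat -> C) (a b : C) :
  Clim u a -> Clim v b -> Clim (fun n => u n + v n)%C (a + b)%C.
Proof.
  intros Hu Hv. apply Clim_le with (fun n => Cmod (u n - a) + Cmod (v n - b)).
  - intro n. replace (_ - _)%C with ((u n - a) + (v n - b))%C by ring. apply Cmod_triangle.
  - replace (Finite 0) with (Finite (0 + 0)) by (f_equal; ring). now apply is_lim_seq_plus'.
Qed.

Lemma Clim_mult (u v : nat -> C) (a b : C) :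
  Clim u a -> Clim v b -> Clim (fun n => u n * v n)%C (a * b)%C.
Proof.
  intros Hu Hv.
  apply Clim_le with (fun n => Cmod (u n - a) * Cmod (v n - b)
      + (Cmod (u n - a) * Cmod b + Cmod a * Cmod (v n - b))).
  - intro n.
    replace (_ - _)%C with
      ((u n - a) * (v n - b) + ((u n - a) * b + a * (v n - b)))%C by ring.
    eapply Rle_trans; [apply Cmod_triangle|]. rewrite Cmod_mult.
    apply Rplus_le_compat_l.
    eapply Rle_trans; [apply Cmod_triangle|]. rewrite !Cmod_mult. lra.
  - replace (Finite 0) with (Finite (0 * 0 + (0 * Cmod b + Cmod a * 0))) by (f_equal; ring).
    apply is_lim_seq_plus'; [now apply is_lim_seq_mult'|].
    apply is_lim_seq_plus'; apply is_lim_seq_mult'; auto; apply is_lim_seq_const.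
Qed.

Lemma Clim_unique (u : nat -> C) (a b : C) : Clim u a -> Clim u b -> a = b.
Proof.
  intros Ha Hb.
  assert (H : is_lim_seq (fun _ => Cmod (a - b)) 0).
  { apply is_lim_seq_le_le with (fun _ => 0) (fun n => Cmod (u n - a) + Cmod (u n - b)).
    - intro n; split; [apply Cmod_ge_0|].
      replace (a - b)%C with ((u n - b) - (u n - a))%C by ring.
      eapply Rle_trans; [apply Cmod_triangle|]. rewrite Cmod_opp. lra.
    - apply is_lim_seq_const.
    - replace (Finite 0) with (Finite (0 + 0)) by (f_equal; ring).
      now apply is_lim_seq_plus'. }
  apply is_lim_seq_unique in H. rewrite Lim_seq_const in H. injection H as H.
  apply Cmod_eq_0 in H. replace a with ((a - b) + b)%C by ring. rewrite H. ring.
Qed.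

Lemma Clim_Re (u : nat -> C) (l : C) : Clim u l -> is_lim_seq (fun n => Re (u n)) (Re l).
Proof.
  intro H. replace (Finite (Re l)) with (Finite (0 + Re l)) by (f_equal; ring).
  apply is_lim_seq_ext with (fun n => Re (u n - l) + Re l).
  { intro n. destruct (u n), l; simpl; ring. }
  apply is_lim_seq_plus'; [|apply is_lim_seq_const].
  apply is_lim_seq_abs_0. apply is_lim_seq_le_le with (fun _ => 0) (fun n => Cmod (u n - l)); auto.
  - intro n; split; [apply Rabs_pos | apply re_le_Cmod].
  - apply is_lim_seq_const.
Qed.

Lemma Clim_Im (u : nat -> C) (l : C) : Clim u l -> is_lim_seq (fun n => Im (u n)) (Im l).
Proof.
  intro H. replace (Finite (Im l)) with (Finite (0 + Im l)) by (f_equal; ring).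
  apply is_lim_seq_ext with (fun n => Im (u n - l) + Im l).
  { intro n. destruct (u n), l; simpl; ring. }
  apply is_lim_seq_plus'; [|apply is_lim_seq_const].
  apply is_lim_seq_abs_0. apply is_lim_seq_le_le with (fun _ => 0) (fun n => Cmod (u n - l)); auto.
  - intro n; split; [apply Rabs_pos | apply im_le_Cmod].
  - apply is_lim_seq_const.
Qed.

Lemma Clim_Re_Im (u : nat -> C) (l : C) :
  is_lim_seq (fun n => Re (u n)) (Re l) -> is_lim_seq (fun n => Im (u n)) (Im l) -> Clim u l.
Proof.
  intros H1 H2. apply Clim_le with (fun n => Rabs (Re (u n) - Re l) + Rabs (Im (u n) - Im l)).
  - intro n. apply (Cmod_le_Re_Im (u n - l)).
  - replace (Finite 0) with (Finite (Rabs (Re l - Re l) + Rabs (Im l - Im l)))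
      by (f_equal; rewrite !Rminus_diag, Rabs_R0; ring).
    apply is_lim_seq_plus'; apply is_lim_seq_abs with (l := Finite (_ - _));
    apply is_lim_seq_minus'; auto; apply is_lim_seq_const.
Qed.

Lemma C_lim_seq_Clim (u : nat -> C) (l : C) : Clim u l -> C_lim_seq u = l.
Proof.
  intro H. unfold C_lim_seq.
  rewrite (is_lim_seq_unique _ _ (Clim_Re u l H)), (is_lim_seq_unique _ _ (Clim_Im u l H)).
  now destruct l.
Qed.

Lemma Clim_inv (u : nat -> C) (l : C) :
  l <> 0 -> Clim u l -> Clim (fun n => / u n)%C (/ l)%C.
Proof.
  intros Hl H. assert (Pl := proj1 (Cmod_gt_0 l) Hl).
  assert (N : exists N, forall n, (N <= n)%nat -> Cmod l / 2 < Cmod (u n)).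
  { destruct (proj2 (is_lim_seq_spec _ _) H (mkposreal (Cmod l / 2) ltac:(lra))) as [N HN].
    exists N. intros n Hn. specialize (HN n Hn). simpl in HN.
    rewrite Rminus_0_r, Rabs_right in HN by apply Rle_ge, Cmod_ge_0.
    rewrite Cmod_minus_sym in HN. pose proof (Cmod_sub_ge l (u n)). lra. }
  destruct N as [N HN].
  unfold Clim. apply is_lim_seq_le_le_loc with (fun _ => 0) (fun n => Cmod (u n - l) * (2 / Cmod l ^ 2)).
  - exists N. intros n Hn. split; [apply Cmod_ge_0|]. specialize (HN n Hn).
    assert (Hu : u n <> 0) by (apply Cmod_gt_0; lra).
    replace (/ u n - / l)%C with ((l - u n) * (/ u n * / l))%C by (field; auto).
    rewrite !Cmod_mult, !Cmod_inv, Cmod_minus_sym by auto.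
    apply Rmult_le_compat_l; [apply Cmod_ge_0|].
    replace (2 / Cmod l ^ 2) with (/ (Cmod l / 2) * / Cmod l) by (field; lra).
    apply Rmult_le_compat_r; [left; now apply Rinv_0_lt_compat|].
    apply Rinv_le_contravar; lra.
  - apply is_lim_seq_const.
  - replace (Finite 0) with (Finite (0 * (2 / Cmod l ^ 2))) by (f_equal; ring).
    apply is_lim_seq_mult'; auto. apply is_lim_seq_const.
Qed.

Lemma Clim_subseq (u : nat -> C) (phi : nat -> nat) (l : C) :
  filterlim phi eventually eventually -> Clim u l -> Clim (fun n => u (phi n)) l.
Proof. intros Hp H. apply (is_lim_seq_subseq (fun n => Cmod (u n - l))); auto. Qed.

Lemma Clim_Cmod_le (u : nat -> C) (l : C) (B : R) :
  Clim u l -> (forall n, Cmod (u n) <= B) -> Cmod l <= B.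
Proof.
  intros H HB. apply (is_lim_seq_le (fun n => Cmod l) (fun n => B + Cmod (u n - l)) (Cmod l) B).
  - intro n. pose proof (Cmod_sub_ge l (u n)). rewrite Cmod_minus_sym in H0. specialize (HB n). lra.
  - apply is_lim_seq_const.
  - replace (Finite B) with (Finite (B + 0)) by (f_equal; ring).
    apply is_lim_seq_plus'; auto. apply is_lim_seq_const.
Qed.

(** The rate survives the passage to the limit. When [D] does not depend on a parameter, the
    convergence is therefore uniform in that parameter. *)
Lemma Clim_cauchy_rate (u : nat -> C) (D : R) :
  (forall n m, (1 <= n <= m)%nat -> Cmod (u m - u n) <= D / INR n) ->
  Clim u (C_lim_seq u) /\
  (forall n, (1 <= n)%nat -> Cmod (C_lim_seq u - u n) <= D / INR n).
Proof.
  intro H.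
  assert (Hd : is_lim_seq (fun n => D / INR n) 0).
  { replace (Finite 0) with (Rbar_mult D (Finite 0)) by (simpl; f_equal; ring).
    apply is_lim_seq_scal_l. apply (is_lim_seq_inv INR p_infty); [apply is_lim_seq_INR | easy]. }
  (* [p] stands for [Re] and for [Im], which share one proof. *)
  assert (Hex : forall p : C -> R, (forall z, Rabs (p z) <= Cmod z) ->
     (forall a b, p (a - b)%C = p a - p b) -> ex_finite_lim_seq (fun n => p (u n))).
  { intros p Hp Hm. apply ex_lim_seq_cauchy_corr. intros eps.
    destruct (proj2 (is_lim_seq_spec _ _) Hd (pos_div_2 eps)) as [N HN].
    assert (Q : forall n, (max 1 N <= n)%nat -> Rabs (p (u n) - p (u (max 1 N))) < eps / 2).
    { intros n Hn. rewrite <- Hm. eapply Rle_lt_trans; [apply Hp|].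
      eapply Rle_lt_trans; [apply H; lia|].
      specialize (HN (max 1 N) ltac:(lia)). simpl in HN. rewrite Rminus_0_r in HN.
      eapply Rle_lt_trans; [apply Rle_abs|exact HN]. }
    exists (max 1 N). intros n m Hn Hm'.
    pose proof (Q n Hn) as Q1. pose proof (Q m Hm') as Q2.
    rewrite Rabs_minus_sym in Q2.
    replace (p (u n) - p (u m)) with
      ((p (u n) - p (u (max 1 N))) + (p (u (max 1 N)) - p (u m))) by ring.
    eapply Rle_lt_trans; [apply Rabs_triang|]. lra. }
  assert (L : Clim u (C_lim_seq u)).
  { apply Clim_Re_Im; simpl.
    - apply Lim_seq_correct'. apply Hex; [apply re_le_Cmod|]. now intros [] [].
    - apply Lim_seq_correct'. apply Hex; [apply im_le_Cmod|]. now intros [] []. }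
  split; [exact L|]. intros n Hn.
  apply Clim_Cmod_le with (fun m => u (m + n)%nat - u n)%C.
  - apply (Clim_plus (fun m => u (m + n)%nat) (fun _ => - u n)%C); [|apply Clim_const].
    unfold Clim. apply -> (is_lim_seq_incr_n (fun m => Cmod (u m - C_lim_seq u)) n). exact L.
  - intro m. apply H. lia.
Qed.

Lemma Clim_Cexp (u : nat -> C) (l : C) : Clim u l -> Clim (fun n => Cexp (u n)) (Cexp l).
Proof.
  intro H. assert (H0 := Clim_plus _ _ _ _ H (Clim_const (- l))).
  replace (l + - l)%C with (RtoC 0) in H0 by ring.
  pose proof (Clim_Re _ _ H) as HR. pose proof (Clim_Im _ _ H) as HI.
  assert (E : is_lim_seq (fun n => exp (Re (u n))) (exp (Re l))).
  { apply is_lim_seq_continuous; auto. apply derivable_continuous_pt, derivable_pt_exp. }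
  apply Clim_Re_Im; simpl; apply is_lim_seq_mult'; auto; apply is_lim_seq_continuous; auto.
  - apply continuity_cos.
  - apply continuity_sin.
Qed.

(** * The reciprocal Gamma function *)

(* Gauss's products for the entire function [1/Gamma]. *)
Definition rgamma_seq (n : nat) (s : C) : C :=
  (s * Cprod (fun k => s + RtoC (INR k)) n * Cexp (- (s * RtoC (ln (INR n))))
   / RtoC (INR (fact n)))%C.

(** The factor [(1 + s/(n+1)) (n/(n+1))^s] of the infinite product. *)
Definition rgamma_ratio (n : nat) (s : C) : C :=
  ((1 + s * RtoC (/ INR (S n))) * Cexp (s * RtoC (ln (INR n) - ln (INR (S n)))))%C.

Definition rgamma (s : C) : C := C_lim_seq (fun n => rgamma_seq n s).

Lemma RtoC_nonzero (x : R) : x <> 0 -> RtoC x <> 0.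
Proof. intros H E. apply H. now injection E. Qed.

Lemma rgamma_seq_S (n : nat) (s : C) :
  rgamma_seq (S n) s = (rgamma_seq n s * rgamma_ratio n s)%C.
Proof.
  unfold rgamma_seq, rgamma_ratio. change (fact (S n)) with (S n * fact n)%nat.
  rewrite mult_INR, RtoC_mult. cbn [Cprod].
  rewrite RtoC_inv by (apply not_0_INR; lia).
  replace (- (s * RtoC (ln (INR (S n)))))%C with
    (- (s * RtoC (ln (INR n))) + s * RtoC (ln (INR n) - ln (INR (S n))))%C
    by (rewrite RtoC_minus; ring).
  rewrite Cexp_plus.
  assert (H1 : RtoC (INR (S n)) <> 0) by (apply RtoC_nonzero, not_0_INR; lia).
  assert (H2 : RtoC (INR (fact n)) <> 0) by apply RtoC_nonzero, INR_fact_neq_0.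
  generalize (Cexp (- (s * RtoC (ln (INR n))))) (Cexp (s * RtoC (ln (INR n) - ln (INR (S n))))).
  intros e1 e2. field. now split.
Qed.

Lemma ln_step (n : nat) : (1 <= n)%nat ->
  / INR (S n) <= ln (INR (S n)) - ln (INR n) <= / INR n.
Proof.
  intro Hn. assert (0 < INR n) by (apply lt_0_INR; lia).
  assert (L : forall x, 0 < x -> ln x <= x - 1).
  { intros x Hx. rewrite <- (ln_exp (x - 1)). apply ln_le; auto.
    destruct (Req_dec (x - 1) 0) as [E|E].
    - rewrite E, exp_0. lra.
    - pose proof (exp_ineq1 _ E). lra. }
  rewrite S_INR. split.
  - assert (A := L (INR n / (INR n + 1)) ltac:(apply Rdiv_lt_0_compat; lra)).
    rewrite ln_div in A by lra.
    replace (INR n / (INR n + 1) - 1) with (- / (INR n + 1)) in A by (field; lra). lra.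
  - assert (A := L ((INR n + 1) / INR n) ltac:(apply Rdiv_lt_0_compat; lra)).
    rewrite ln_div in A by lra.
    replace ((INR n + 1) / INR n - 1) with (/ INR n) in A by (field; lra). lra.
Qed.

(** The first-order terms [s/(n+1)] and [s ln(n/(n+1))] cancel up to [O(1/(n(n+1)))], and what
    remains is of second order. The bound is written as a difference so that it telescopes. Rank 0
    is left out because [ln (INR 0)] and [/ INR 0] are default values. *)
Lemma rgamma_ratio_bound (r : R) : 0 <= r ->
  exists c, 0 <= c /\ forall n s, (1 <= n)%nat -> Cmod s <= r ->
    Cmod (rgamma_ratio n s - 1) <= c * (/ INR n - / INR (S n)).
Proof.
  intro Hr. exists (r + r * r + 8 * (1 + r) * r ^ 2 * exp r).
  split.
  { pose proof (exp_pos r). pose proof (pow2_ge_0 r).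
    repeat (apply Rplus_le_le_0_compat || apply Rmult_le_pos); lra. }
  intros n s Hn Hs. pose proof (ln_step n Hn) as [L1 L2].
  unfold rgamma_ratio. set (h := / INR (S n)) in *. set (k := / INR n) in *.
  set (l := ln (INR n) - ln (INR (S n))).
  assert (Pn : 1 <= INR n) by (apply (le_INR 1); lia).
  assert (Hh : 0 < h <= 1).
  { unfold h. rewrite S_INR. split; [apply Rinv_0_lt_compat; lra|].
    rewrite <- Rinv_1. apply Rinv_le_contravar; lra. }
  assert (Hk : 0 < k <= 1).
  { unfold k. split; [apply Rinv_0_lt_compat; lra|].
    rewrite <- Rinv_1. apply Rinv_le_contravar; lra. }
  assert (Hhk : k - h = h * k) by (unfold h, k; rewrite S_INR; field; lra).
  assert (Hk2 : k * k <= 2 * (h * k)).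
  { assert (k <= 2 * h); [|nra]. unfold h, k. rewrite S_INR.
    apply Rmult_le_reg_l with (INR n * (INR n + 1)); [nra|].
    replace (INR n * (INR n + 1) * / INR n) with (INR n + 1) by (field; lra).
    replace (INR n * (INR n + 1) * (2 * / (INR n + 1))) with (2 * INR n) by (field; lra). lra. }
  assert (Hl : Rabs l <= k) by (unfold l; rewrite Rabs_left1; lra).
  assert (Hlh : Rabs (h + l) <= h * k) by (unfold l; rewrite Rabs_left1; lra).
  set (w := (s * RtoC l)%C).
  (* First the almost cancelling linear terms, then a product of two small ones, then the quadratic
     remainder of the exponential. *)
  replace ((1 + s * RtoC h) * Cexp w - 1)%C with
    (s * RtoC (h + l) + (s * RtoC h) * w + (1 + s * RtoC h) * (Cexp w - 1 - w))%C
    by (unfold w; rewrite RtoC_plus; ring).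
  pose proof (Cmod_ge_0 s) as Ps. pose proof (Rabs_pos l) as Pl. pose proof (Rabs_pos (h + l)).
  assert (Hw : Cmod w <= r * k).
  { unfold w. rewrite Cmod_mult, Cmod_R. apply Rmult_le_compat; auto. }
  assert (Hsh : Cmod (s * RtoC h) <= r * h).
  { rewrite Cmod_mult, Cmod_R, Rabs_right by lra. nra. }
  eapply Rle_trans; [apply Cmod_triangle|].
  eapply Rle_trans; [apply Rplus_le_compat_r, Cmod_triangle|].
  rewrite !(Cmod_mult (_ * RtoC h)), !(Cmod_mult (_ + _)), (Cmod_mult s (RtoC (h + l))), Cmod_R.
  pose proof (Cmod_ge_0 (s * RtoC h)). pose proof (Cmod_ge_0 w).
  assert (A1 : Cmod s * Rabs (h + l) <= r * (h * k)) by (apply Rmult_le_compat; auto).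
  assert (A2 : Cmod (s * RtoC h) * Cmod w <= (r * h) * (r * k)) by (apply Rmult_le_compat; auto).
  assert (A3 : Cmod (1 + s * RtoC h) <= 1 + r).
  { eapply Rle_trans; [apply Cmod_triangle|]. rewrite Cmod_1. nra. }
  assert (A4 : Cmod (Cexp w - 1 - w) <= 8 * r ^ 2 * (h * k) * exp r).
  { eapply Rle_trans; [apply Cexp_sub_1_sub|].
    assert (exp (Cmod w) <= exp r) by (apply exp_le_compat; nra).
    assert (Cmod w ^ 2 <= (r * k) ^ 2) by (apply pow_incr; lra).
    assert ((r * k) ^ 2 <= 2 * r ^ 2 * (h * k)).
    { replace ((r * k) ^ 2) with (r ^ 2 * (k * k)) by ring.
      replace (2 * r ^ 2 * (h * k)) with (r ^ 2 * (2 * (h * k))) by ring.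
      apply Rmult_le_compat_l; [apply pow2_ge_0|exact Hk2]. }
    apply Rmult_le_compat; [|left; apply exp_pos| |]; try lra.
    pose proof (pow2_ge_0 (Cmod w)); lra. }
  assert (A5 : Cmod (1 + s * RtoC h) * Cmod (Cexp w - 1 - w)
     <= (1 + r) * (8 * r ^ 2 * (h * k) * exp r)).
  { apply Rmult_le_compat; auto; apply Cmod_ge_0. }
  rewrite Hhk. lra.
Qed.

(* Partial products of [prod (1 + e_n)] with [|e_n| <= c/(n(n+1))]. *)
Lemma product_cauchy_rate (u : nat -> C) (c B : R) :
  0 <= c -> Cmod (u 1%nat) <= B ->
  (forall n, (1 <= n)%nat ->
     Cmod (u (S n) - u n) <= Cmod (u n) * (c * (/ INR n - / INR (S n)))) ->
  forall n m, (1 <= n <= m)%nat -> Cmod (u m - u n) <= (B * exp c * c) / INR n.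
Proof.
  intros Hc HB Hu.
  assert (HB0 : 0 <= B) by (pose proof (Cmod_ge_0 (u 1%nat)); lra).
  assert (P : forall n, (1 <= n)%nat -> 0 < / INR (S n) < / INR n /\ / INR n <= 1).
  { intros n Hn. assert (1 <= INR n) by (apply (le_INR 1); lia). rewrite S_INR.
    split; [split; [apply Rinv_0_lt_compat|apply Rinv_lt_contravar]|
      rewrite <- Rinv_1; apply Rinv_le_contravar]; nra. }
  (* The exponent is the telescoped sum of the step bounds, so that [B * exp c] bounds every partial
     product. *)
  assert (Q : forall n, (1 <= n)%nat -> Cmod (u n) <= B * exp (c * (1 - / INR n))).
  { intros n Hn. induction Hn as [|n Hn IH].
    - simpl. rewrite Rinv_1, Rminus_diag, Rmult_0_r, exp_0. lra.
    - specialize (Hu n Hn). specialize (P n Hn). set (d := / INR n - / INR (S n)) in *.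
      replace (c * (1 - / INR (S n))) with (c * (1 - / INR n) + c * d) by (unfold d; ring).
      rewrite exp_plus.
      assert (E : 1 + c * d <= exp (c * d)).
      { destruct (Req_dec (c * d) 0) as [->|E]; [rewrite exp_0; lra|left; now apply exp_ineq1]. }
      assert (0 <= c * d) by (apply Rmult_le_pos; unfold d; lra).
      assert (Cmod (u (S n)) <= Cmod (u n) * (1 + c * d)).
      { replace (u (S n)) with ((u (S n) - u n) + u n)%C by ring.
        eapply Rle_trans; [apply Cmod_triangle|]. lra. }
      eapply Rle_trans; [exact H0|]. rewrite <- Rmult_assoc.
      apply Rmult_le_compat; auto; [apply Cmod_ge_0|lra]. }
  assert (Q' : forall n, (1 <= n)%nat -> Cmod (u n) <= B * exp c).
  { intros n Hn. eapply Rle_trans; [apply (Q n Hn)|]. apply Rmult_le_compat_l; auto.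
    apply exp_le_compat. specialize (P n Hn). nra. }
  assert (T : forall n m, (1 <= n <= m)%nat ->
     Cmod (u m - u n) <= B * exp c * c * (/ INR n - / INR m)).
  { intros n m [Hn Hm]. induction Hm as [|m Hm IH].
    - replace (u n - u n)%C with (RtoC 0) by ring. rewrite Cmod_0. lra.
    - replace (u (S m) - u n)%C with ((u (S m) - u m) + (u m - u n))%C by ring.
      eapply Rle_trans; [apply Cmod_triangle|].
      specialize (Hu m ltac:(lia)). specialize (Q' m ltac:(lia)). specialize (P m ltac:(lia)).
      assert (Cmod (u m) * (c * (/ INR m - / INR (S m)))
        <= B * exp c * (c * (/ INR m - / INR (S m)))).
      { apply Rmult_le_compat_r; auto. apply Rmult_le_pos; lra. }
      lra. }
  intros n m H. eapply Rle_trans; [apply T; exact H|]. unfold Rdiv.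
  apply Rmult_le_compat_l.
  - pose proof (exp_pos c). apply Rmult_le_pos; auto. apply Rmult_le_pos; lra.
  - assert (0 < / INR m) by (apply Rinv_0_lt_compat, lt_0_INR; lia). lra.
Qed.

Lemma rgamma_seq_1 (s : C) : rgamma_seq 1 s = (s * (s + 1))%C.
Proof.
  unfold rgamma_seq. simpl. rewrite ln_1, Cmult_0_r.
  replace (- RtoC 0)%C with (RtoC 0) by ring. rewrite Cexp_0.
  field.
Qed.

(** [D] depends on the radius alone: Gauss's products converge uniformly on discs. *)
Lemma rgamma_rate (r : R) : 0 <= r ->
  exists D, forall s, Cmod s <= r ->
    Clim (fun n => rgamma_seq n s) (rgamma s) /\
    forall n, (1 <= n)%nat -> Cmod (rgamma s - rgamma_seq n s) <= D / INR n.
Proof.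
  intro Hr. destruct (rgamma_ratio_bound r Hr) as [c [Hc Hq]].
  exists (r * (r + 1) * exp c * c). intros s Hs.
  apply Clim_cauchy_rate, product_cauchy_rate; auto.
  - rewrite rgamma_seq_1, Cmod_mult. apply Rmult_le_compat; auto; try apply Cmod_ge_0.
    eapply Rle_trans; [apply Cmod_triangle|]. rewrite Cmod_1. lra.
  - intros n Hn. rewrite rgamma_seq_S.
    replace (_ - _)%C with (rgamma_seq n s * (rgamma_ratio n s - 1))%C by ring.
    rewrite Cmod_mult. apply Rmult_le_compat_l; [apply Cmod_ge_0|]. now apply Hq.
Qed.

Lemma rgamma_Clim (s : C) : Clim (fun n => rgamma_seq n s) (rgamma s).
Proof. destruct (rgamma_rate (Cmod s) (Cmod_ge_0 s)) as [D H]. apply H. lra. Qed.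

Lemma Cprod_nonzero (f : nat -> C) (n : nat) :
  (forall k, (1 <= k <= n)%nat -> f k <> 0) -> Cprod f n <> 0.
Proof.
  induction n as [|n IH]; intro H; simpl.
  - apply RtoC_nonzero; lra.
  - apply Cmult_neq_0; [apply IH; intros; apply H; lia | apply H; lia].
Qed.

Lemma rgamma_seq_nonzero (n : nat) (s : C) :
  (forall k : nat, (s + RtoC (INR k))%C <> 0) -> rgamma_seq n s <> 0.
Proof.
  intro H. unfold rgamma_seq, Cdiv. apply Cmult_neq_0.
  - apply Cmult_neq_0; [|apply Cexp_nonzero]. apply Cmult_neq_0.
    + specialize (H 0%nat). simpl in H. now rewrite Cplus_0_r in H.
    + now apply Cprod_nonzero.
  - apply Cinv_nonzero, RtoC_nonzero, INR_fact_neq_0.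
Qed.

Lemma Re_pos_add_INR_nonzero (s : C) (k : nat) : 0 < Re s -> (s + RtoC (INR k))%C <> 0.
Proof. intro H. apply Re_pos_nonzero. destruct s; simpl in *. pose proof (pos_INR k). lra. Qed.

(** The reciprocals of Gauss's products satisfy the same telescoping estimate as soon as the ratios
    are bounded away from 0, which holds in the right half-plane. *)
Lemma rgamma_inv_rate (d r : R) : 0 < d ->
  exists D, forall s, d <= Re s -> Cmod s <= r ->
    rgamma s <> 0 /\
    forall n, (1 <= n)%nat -> Cmod (/ rgamma s - / rgamma_seq n s) <= D / INR n.
Proof.
  intro Hd. destruct (Rle_dec 0 r) as [Hr|Hr].
  2: { exists 0. intros s _ H. pose proof (Cmod_ge_0 s). lra. }
  destruct (rgamma_ratio_bound r Hr) as [c [Hc Hq]].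
  pose proof (exp_pos r) as Er.
  set (c' := c * exp r). assert (Hc' : 0 <= c') by (apply Rmult_le_pos; lra).
  exists (/ d * exp c' * c'). intros s Hd' Hs.
  assert (N : forall n, rgamma_seq n s <> 0).
  { intro n. apply rgamma_seq_nonzero. intro k. apply Re_pos_add_INR_nonzero; lra. }
  assert (C := product_cauchy_rate (fun n => / rgamma_seq n s)%C c' (/ d) Hc').
  destruct (Clim_cauchy_rate (fun n => / rgamma_seq n s)%C (/ d * exp c' * c')) as [L1 L2].
  - apply C; clear C.
    + rewrite Cmod_inv by auto. apply Rinv_le_contravar; auto.
      rewrite rgamma_seq_1, Cmod_mult.
      pose proof (Re_le_Cmod s). pose proof (Re_le_Cmod (s + 1)).
      assert (Re (s + 1) = Re s + 1) by (destruct s; reflexivity). nra.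
    + intros n Hn. rewrite rgamma_seq_S.
      (* As [0 < Re s], the factor [1 + s/(n+1)] has modulus at least 1, and the power of [n/(n+1)]
         has modulus at least [exp (- Re s / n)]. *)
      assert (B : exp (- r) <= Cmod (rgamma_ratio n s)).
      { unfold rgamma_ratio. rewrite Cmod_mult, Cmod_Cexp.
        replace (Re (s * RtoC (ln (INR n) - ln (INR (S n))))) with
          (Re s * (ln (INR n) - ln (INR (S n)))) by (destruct s; simpl; ring).
        pose proof (ln_step n Hn) as [L1 L2].
        assert (I1 : / INR n <= 1).
        { rewrite <- Rinv_1. apply Rinv_le_contravar; [lra|apply (le_INR 1); lia]. }
        assert (I2 : 0 < / INR (S n)) by (apply Rinv_0_lt_compat, lt_0_INR; lia).
        assert (1 <= Cmod (1 + s * RtoC (/ INR (S n)))).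
        { eapply Rle_trans; [|apply Re_le_Cmod].
          replace (Re _) with (1 + Re s * / INR (S n)) by (destruct s; simpl; ring). nra. }
        rewrite <- (Rmult_1_l (exp (- r))). apply Rmult_le_compat; try lra; [left; apply exp_pos|].
        apply exp_le_compat. pose proof (Re_le_Cmod s). nra. }
      assert (Nq : rgamma_ratio n s <> 0).
      { apply Cmod_gt_0. pose proof (exp_pos (- r)). lra. }
      replace (/ (rgamma_seq n s * rgamma_ratio n s) - / rgamma_seq n s)%C with
        (/ rgamma_seq n s * (- (rgamma_ratio n s - 1) * / rgamma_ratio n s))%C
        by (field; auto).
      rewrite !(Cmod_mult (/ _)). apply Rmult_le_compat_l; [apply Cmod_ge_0|].
      rewrite Cmod_mult, Cmod_opp, Cmod_inv by auto.
      replace (c' * (/ INR n - / INR (S n))) with (c * (/ INR n - / INR (S n)) * exp r)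
        by (unfold c'; ring).
      apply Rmult_le_compat; [apply Cmod_ge_0| |now apply Hq|].
      * left. apply Rinv_0_lt_compat. pose proof (exp_pos (- r)); lra.
      * rewrite <- (Rinv_inv (exp r)), <- exp_Ropp. apply Rinv_le_contravar; [apply exp_pos|exact B].
  (* The limits of the products and of their reciprocals multiply to 1, which excludes a zero of
     [rgamma]. *)
  - assert (E : (rgamma s * C_lim_seq (fun n => / rgamma_seq n s))%C = 1).
    { apply (Clim_unique (fun n => rgamma_seq n s * / rgamma_seq n s)%C).
      - apply Clim_mult; auto. apply rgamma_Clim.
      - apply Clim_ext with (fun _ => RtoC 1); [|apply Clim_const].
        intro n. symmetry. now apply Cinv_r. }
    assert (Z : rgamma s <> 0).
    { intro Z. rewrite Z, Cmult_0_l in E. injection E. lra. }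
    split; auto. intros n Hn.
    replace (/ rgamma s)%C with (C_lim_seq (fun n => / rgamma_seq n s)%C); [now apply L2|].
    rewrite <- (Cmult_1_l (/ rgamma s)), <- E. field. exact Z.
Qed.

Lemma rgamma_nonzero_Re_pos (s : C) : 0 < Re s -> rgamma s <> 0.
Proof. intro H. destruct (rgamma_inv_rate (Re s) (Cmod s) H) as [D HD]. apply HD; lra. Qed.

(** * Functional equation and zeros of [rgamma], and its relation to [CGamma] *)

Lemma Cprod_ext (f g : nat -> C) (n : nat) :
  (forall k, (1 <= k <= n)%nat -> f k = g k) -> Cprod f n = Cprod g n.
Proof.
  induction n as [|n IH]; intro H; simpl; auto.
  rewrite IH by (intros; apply H; lia). now rewrite H by lia.
Qed.

Lemma Cprod_S_l (f : nat -> C) (n : nat) :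
  Cprod f (S n) = (f 1%nat * Cprod (fun k => f (S k)) n)%C.
Proof.
  induction n as [|n IH]; [simpl; ring|].
  change (Cprod f (S (S n))) with (Cprod f (S n) * f (S (S n)))%C.
  rewrite IH. simpl. ring.
Qed.

(** The functional equation at finite rank: shifting [s] shifts the factors by one place, and the
    correction [1 + (s+1)/n] tends to 1. *)
Lemma rgamma_seq_shift (n : nat) (s : C) : (1 <= n)%nat ->
  (s * rgamma_seq n (s + 1) = rgamma_seq n s * (1 + (s + 1) * RtoC (/ INR n)))%C.
Proof.
  intro Hn. unfold rgamma_seq.
  assert (E : ((s + 1) * Cprod (fun k => s + 1 + RtoC (INR k)) n
             = Cprod (fun k => s + RtoC (INR k)) n * (s + RtoC (INR (S n))))%C).
  { change (Cprod (fun k => s + RtoC (INR k))%C n * (s + RtoC (INR (S n))))%C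
      with (Cprod (fun k => s + RtoC (INR k))%C (S n)).
    rewrite Cprod_S_l. f_equal. apply Cprod_ext. intros k _. rewrite S_INR, RtoC_plus. ring. }
  rewrite E. replace (- ((s + 1) * RtoC (ln (INR n))))%C with
    (- (s * RtoC (ln (INR n))) + - RtoC (ln (INR n)))%C by ring.
  rewrite Cexp_plus, (Cexp_opp (RtoC _)), Cexp_RtoC, exp_ln by (apply lt_0_INR; lia).
  assert (H1 : INR n <> 0) by (apply not_0_INR; lia).
  rewrite S_INR, RtoC_inv, RtoC_plus by auto. field.
  split; [now apply RtoC_nonzero | apply RtoC_nonzero, INR_fact_neq_0].
Qed.

Lemma is_lim_seq_inv_INR : is_lim_seq (fun n => / INR n) 0.
Proof. apply (is_lim_seq_inv INR p_infty); [apply is_lim_seq_INR | easy]. Qed.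

Lemma Clim_RtoC (u : nat -> R) (l : R) : is_lim_seq u l -> Clim (fun n => RtoC (u n)) (RtoC l).
Proof. intro H. apply Clim_Re_Im; simpl; auto. apply is_lim_seq_const. Qed.

Lemma rgamma_shift (s : C) : rgamma s = (s * rgamma (s + 1))%C.
Proof.
  apply (Clim_unique (fun n => rgamma_seq n s * (1 + (s + 1) * RtoC (/ INR n)))%C).
  - replace (rgamma s) with (rgamma s * (1 + (s + 1) * RtoC 0))%C at 1 by ring.
    apply Clim_mult; [apply rgamma_Clim|]. apply Clim_plus; [apply Clim_const|].
    apply Clim_mult; [apply Clim_const|]. apply Clim_RtoC, is_lim_seq_inv_INR.
  - apply Clim_ext_loc with (fun n => s * rgamma_seq n (s + 1))%C.
    + exists 1%nat. intros n Hn. now apply rgamma_seq_shift.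
    + apply Clim_mult; [apply Clim_const|apply rgamma_Clim].
Qed.

Lemma rgamma_1 : rgamma 1 = 1.
Proof.
  apply (Clim_unique (fun n => rgamma_seq n 1)); [apply rgamma_Clim|].
  apply Clim_ext_loc with (fun n => 1 + RtoC (/ INR n))%C.
  - exists 1%nat. intros n Hn. unfold rgamma_seq.
    assert (H1 : INR n <> 0) by (apply not_0_INR; lia).
    rewrite Cexp_opp, (Cmult_1_l (RtoC (ln _))), Cexp_RtoC, exp_ln by (apply lt_0_INR; lia).
    assert (E : forall m, Cprod (fun k => 1 + RtoC (INR k))%C m = RtoC (INR (fact (S m)))).
    { induction m as [|m IH]; [reflexivity|].
      change (fact (S (S m))) with (S (S m) * fact (S m))%nat.
      rewrite mult_INR, RtoC_mult. cbn [Cprod]. rewrite IH, !(S_INR (S m)), RtoC_plus. ring. }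
    rewrite E. change (fact (S n)) with (S n * fact n)%nat.
    rewrite mult_INR, RtoC_mult, S_INR, RtoC_plus, RtoC_inv by auto.
    field. split; [now apply RtoC_nonzero | apply RtoC_nonzero, INR_fact_neq_0].
  - assert (H : Clim (fun n => 1 + RtoC (/ INR n))%C (1 + RtoC 0)%C).
    { apply Clim_plus; [apply Clim_const|]. apply Clim_RtoC, is_lim_seq_inv_INR. }
    now rewrite Cplus_0_r in H.
Qed.

Fixpoint poch (s : C) (n : nat) : C :=
  match n with O => RtoC 1 | S k => (poch s k * (s + RtoC (INR k)))%C end.

Lemma rgamma_poch (s : C) (n : nat) : rgamma s = (poch s n * rgamma (s + RtoC (INR n)))%C.
Proof.
  induction n as [|n IH].
  - simpl. rewrite Cplus_0_r. ring.
  - rewrite IH. simpl poch. rewrite (rgamma_shift (s + RtoC (INR n))).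
    rewrite S_INR, RtoC_plus, Cplus_assoc. ring.
Qed.

(** After moving the argument into the right half-plane, where [rgamma] has no zero, only a factor
    of [poch s n] can vanish. *)
Lemma rgamma_eq_0 (s : C) : rgamma s = 0 -> exists k : nat, (s + RtoC (INR k))%C = 0.
Proof.
  intro H.
  destruct (INR_unbounded (- Re s)) as [n Hn].
  assert (P : poch s n = 0).
  { rewrite (rgamma_poch s n) in H. destruct (Ceq_dec (poch s n) 0) as [E|E]; auto.
    exfalso. revert H. apply Cmult_neq_0; auto.
    apply rgamma_nonzero_Re_pos. destruct s; simpl in *; lra. }
  clear H Hn. induction n as [|n IH]; simpl in P.
  - injection P; lra.
  - destruct (Ceq_dec (poch s n) 0) as [E|E]; auto.
    destruct (Ceq_dec (s + RtoC (INR n)) 0) as [E'|E']; [now exists n|].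
    exfalso. revert P. now apply Cmult_neq_0.
Qed.

(** Off the zeros of [rgamma] this is the limit of the reciprocals. At a zero both sides are 0: the
    right one as [/ 0], the left one because Gauss's terms eventually divide by 0. *)
Lemma CGamma_eq_inv_rgamma (s : C) : CGamma s = (/ rgamma s)%C.
Proof.
  assert (E : forall n, (RtoC (INR (fact n)) * Cpow_pos (INR n) s /
       (s * Cprod (fun k => s + RtoC (INR k)) n) = / rgamma_seq n s)%C).
  { intro n. unfold rgamma_seq, Cdiv, Cpow_pos.
    rewrite Cexp_opp, !(Cinv_mult (_ * _)), !Cinv_invol. ring. }
  apply C_lim_seq_Clim. eapply Clim_ext; [intro n; symmetry; apply E|].
  destruct (Ceq_dec (rgamma s) 0) as [Z|Z].
  - destruct (rgamma_eq_0 s Z) as [k Hk]. rewrite Z, Cinv_zero.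
    apply Clim_ext_loc with (fun _ => RtoC 0); [|apply Clim_const].
    exists k. intros n Hn.
    assert (W : (s * Cprod (fun k => s + RtoC (INR k)) n)%C = 0).
    { destruct k as [|k].
      - simpl in Hk. rewrite Cplus_0_r in Hk. rewrite Hk. ring.
      - induction Hn as [|n Hn IH].
        + cbn [Cprod]. rewrite Hk. ring.
        + cbn [Cprod]. rewrite Cmult_assoc, IH. ring. }
    unfold rgamma_seq, Cdiv. rewrite W, !Cmult_0_l, Cinv_zero. reflexivity.
  - apply Clim_inv; auto. apply rgamma_Clim.
Qed.

Lemma inv_CGamma (s : C) : (/ CGamma s)%C = rgamma s.
Proof. now rewrite CGamma_eq_inv_rgamma, Cinv_invol. Qed.

Lemma Im_Cprod_0 (f : nat -> C) (n : nat) : (forall k, Im (f k) = 0) -> Im (Cprod f n) = 0.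
Proof.
  intro H. induction n as [|n IH]; simpl; auto.
  change (snd (Cprod f n)) with (Im (Cprod f n)). change (snd (f (S n))) with (Im (f (S n))).
  rewrite IH, H. ring.
Qed.

(** Gauss's products are real at a real point, hence so is their limit. At a pole [RGamma a = 0],
    and [/ 0 = 0] is again the right value. *)
Lemma rgamma_RtoC (a : R) : rgamma (RtoC a) = RtoC (/ RGamma a).
Proof.
  assert (R0 : Im (rgamma (RtoC a)) = 0).
  { assert (H := Clim_Im _ _ (rgamma_Clim (RtoC a))).
    apply is_lim_seq_unique in H.
    rewrite (Lim_seq_ext _ (fun _ => 0)), Lim_seq_const in H; [now injection H|].
    intro n. unfold rgamma_seq.
    replace (Cprod (fun k => RtoC a + RtoC (INR k))%C n) with
      (RtoC (Re (Cprod (fun k => RtoC a + RtoC (INR k))%C n))).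
    - rewrite <- !RtoC_mult, <- RtoC_opp, Cexp_RtoC, <- RtoC_mult, <- RtoC_div; [reflexivity|].
      apply INR_fact_neq_0.
    - apply injective_projections; simpl; auto. symmetry. apply Im_Cprod_0. intro; simpl; ring. }
  unfold RGamma. rewrite CGamma_eq_inv_rgamma.
  replace (rgamma (RtoC a)) with (RtoC (Re (rgamma (RtoC a))))
    by (apply injective_projections; auto).
  set (x := Re (rgamma (RtoC a))).
  destruct (Req_dec x 0) as [E|E].
  - rewrite E, Cinv_zero. simpl. now rewrite Rinv_0.
  - rewrite <- RtoC_inv by auto. simpl. now rewrite Rinv_inv.
Qed.

(** * The multiplication formula *)

Lemma Cprod_mult (f g : nat -> C) (n : nat) :
  (Cprod (fun k => f k * g k) n = Cprod f n * Cprod g n)%C.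
Proof. induction n as [|n IH]; simpl; [ring | rewrite IH; ring]. Qed.

Lemma Cprod_const (a : C) (n : nat) : Cprod (fun _ => a) n = (a ^ n)%C.
Proof. induction n as [|n IH]; simpl; auto. rewrite IH. ring. Qed.

Lemma Cprod_inv (f : nat -> C) (n : nat) : Cprod (fun k => / f k)%C n = (/ Cprod f n)%C.
Proof.
  induction n as [|n IH]; simpl.
  - rewrite <- RtoC_inv by lra. now rewrite Rinv_1.
  - now rewrite IH, Cinv_mult.
Qed.

Lemma Clim_Cprod (u : nat -> nat -> C) (l : nat -> C) (n : nat) :
  (forall k, Clim (u k) (l k)) -> Clim (fun i => Cprod (fun k => u k i) n) (Cprod l n).
Proof.
  intro H. induction n as [|n IH]; simpl; [apply Clim_const | now apply Clim_mult].
Qed.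

Lemma poch_add (s : C) (a b : nat) : poch s (a + b) = (poch s a * poch (s + RtoC (INR a)) b)%C.
Proof.
  induction b as [|b IH].
  - rewrite Nat.add_0_r. simpl. ring.
  - rewrite Nat.add_succ_r. simpl. rewrite IH, plus_INR, RtoC_plus. ring.
Qed.

Lemma poch_Cprod (s : C) (n : nat) : poch s n = Cprod (fun j => s + RtoC (INR j - 1))%C n.
Proof.
  induction n as [|n IH]; auto. cbn [poch Cprod]. rewrite IH, S_INR.
  now replace (INR n + 1 - 1) with (INR n) by ring.
Qed.

Lemma poch_S_Cprod (s : C) (n : nat) :
  poch s (S n) = (s * Cprod (fun k => s + RtoC (INR k)) n)%C.
Proof.
  induction n as [|n IH]; [simpl; ring|].
  change (poch s (S (S n))) with (poch s (S n) * (s + RtoC (INR (S n))))%C.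
  rewrite IH. cbn [Cprod]. ring.
Qed.

(** The [M n] consecutive factors are sorted by residue class modulo [M]: [M w + M k + (j - 1) = M
    (w + (j - 1)/M + k)]. *)
Lemma poch_mult (M : nat) (w : C) (n : nat) : (1 <= M)%nat ->
  poch (RtoC (INR M) * w) (M * n)
  = (RtoC (INR M) ^ (M * n)
     * Cprod (fun j => poch (w + RtoC ((INR j - 1) / INR M)) n) M)%C.
Proof.
  intro HM. assert (HM0 : INR M <> 0) by (apply not_0_INR; lia).
  induction n as [|n IH].
  - rewrite Nat.mul_0_r. simpl. rewrite Cprod_const, Cpow_1_l. ring.
  - rewrite Nat.mul_succ_r, poch_add, IH, Cpow_add_r.
    cbn [poch]. rewrite Cprod_mult, poch_Cprod.
    rewrite <- (Cprod_const (RtoC (INR M)) M).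
    replace (Cprod (fun j => RtoC (INR M) * w + RtoC (INR (M * n)) + RtoC (INR j - 1))%C M) with
      (Cprod (fun _ => RtoC (INR M)) M *
       Cprod (fun j => w + RtoC ((INR j - 1) / INR M) + RtoC (INR n))%C M)%C; [ring|].
    rewrite <- Cprod_mult. apply Cprod_ext. intros j _.
    rewrite mult_INR, RtoC_mult, RtoC_div by auto. field. now apply RtoC_nonzero.
Qed.

(** The multiplication formula at finite rank. The order of the quantifiers matters: [c] varies with
    [n] but not with [w]. *)
Lemma rgamma_seq_mult (M n : nat) : (1 <= M)%nat -> exists c, forall w,
  Cprod (fun j => rgamma_seq n (w + RtoC ((INR j - 1) / INR M))) M
  = (c * (rgamma_seq (M * n + (M - 1)) (RtoC (INR M) * w) *
      Cexp (RtoC (INR M) * w * RtoC (ln (INR (M * n + (M - 1))) - ln (INR n)))))%C.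
Proof.
  (* A Gauss product of rank [m] has [m + 1] factors. This [m] makes that number [M (n + 1)], that
     is, [n + 1] for each of the [M] products on the left. *)
  intro HM. set (m := (M * n + (M - 1))%nat).
  exists (Cprod (fun j => Cexp (- (RtoC ((INR j - 1) / INR M) * RtoC (ln (INR n))))) M
     * RtoC (INR (fact m)) / (RtoC (INR (fact n)) ^ M * RtoC (INR M) ^ (M * S n)))%C.
  intro w.
  assert (N1 : RtoC (INR M) <> 0) by (apply RtoC_nonzero, not_0_INR; lia).
  assert (N2 : RtoC (INR (fact n)) <> 0) by apply RtoC_nonzero, INR_fact_neq_0.
  assert (N3 : RtoC (INR (fact m)) <> 0) by apply RtoC_nonzero, INR_fact_neq_0.
  unfold rgamma_seq. rewrite <- (poch_S_Cprod (RtoC (INR M) * w)).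
  replace (S m) with (M * S n)%nat by (unfold m; lia).
  rewrite poch_mult by auto. unfold Cdiv. rewrite Cprod_mult, Cprod_inv, Cprod_const, Cprod_mult.
  rewrite (Cprod_ext _ (fun j => poch (w + RtoC ((INR j - 1) / INR M)) (S n)) M)
    by (intros; symmetry; apply poch_S_Cprod).
  rewrite (Cprod_ext (fun k => Cexp _)
     (fun j => Cexp (- (w * RtoC (ln (INR n)))) *
        Cexp (- (RtoC ((INR j - 1) / INR M) * RtoC (ln (INR n)))))%C M)
    by (intros; rewrite <- Cexp_plus; f_equal; ring).
  rewrite Cprod_mult, Cprod_const, Cexp_pow.
  replace (Cexp (RtoC (INR M) * - (w * RtoC (ln (INR n)))))%C with
    (Cexp (- (RtoC (INR M) * w * RtoC (ln (INR m)))) *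
     Cexp (RtoC (INR M) * w * RtoC (ln (INR m) - ln (INR n))))%C
    by (rewrite <- Cexp_plus, RtoC_minus; f_equal; ring).
  generalize (Cexp (- (RtoC (INR M) * w * RtoC (ln (INR m)))))%C
     (Cexp (RtoC (INR M) * w * RtoC (ln (INR m) - ln (INR n))))%C
     (Cprod (fun j => Cexp (- (RtoC ((INR j - 1) / INR M) * RtoC (ln (INR n))))%C) M)
     (Cprod (fun j => poch (w + RtoC ((INR j - 1) / INR M)) (S n)) M).
  assert (N4 := Cpow_nz _ M N2). assert (N5 := Cpow_nz _ (M * S n) N1).
  revert N4 N5. generalize (RtoC (INR (fact n)) ^ M)%C (RtoC (INR M) ^ (M * S n))%C.
  intros. field. auto.
Qed.

Lemma ln_ratio_lim (M : nat) : (1 <= M)%nat ->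
  is_lim_seq (fun n => ln (INR (M * n + (M - 1))) - ln (INR n)) (ln (INR M)).
Proof.
  intro HM. assert (1 <= INR M) by (apply (le_INR 1); lia).
  apply is_lim_seq_ext_loc with (fun n => ln (INR M + (INR M - 1) * / INR n)).
  - exists 1%nat. intros n Hn. assert (1 <= INR n) by (apply (le_INR 1); lia).
    rewrite plus_INR, mult_INR, minus_INR by auto. simpl INR.
    rewrite <- ln_div by nra. f_equal. field. lra.
  - apply (is_lim_seq_continuous ln (fun n => INR M + (INR M - 1) * / INR n)).
    + apply derivable_continuous_pt. exists (/ INR M). apply derivable_pt_lim_ln. lra.
    + replace (Finite (INR M)) with (Finite (INR M + (INR M - 1) * 0)) by (f_equal; ring).
      apply is_lim_seq_plus'; [apply is_lim_seq_const|].
      apply is_lim_seq_mult'; [apply is_lim_seq_const | apply is_lim_seq_inv_INR].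
Qed.

(* Gauss's multiplication formula, with the constant left unspecified: it
   cancels in [meijer_product]. *)
Lemma rgamma_mult (M : nat) : (1 <= M)%nat -> exists A : C, A <> 0 /\ forall w,
  Cprod (fun j => rgamma (w + RtoC ((INR j - 1) / INR M))) M
  = (A * Cexp (RtoC (INR M) * w * RtoC (ln (INR M))) * rgamma (RtoC (INR M) * w))%C.
Proof.
  intro HM. assert (P : 1 <= INR M) by (apply (le_INR 1); lia).
  set (G := fun w => (rgamma (RtoC (INR M) * w) * Cexp (RtoC (INR M) * w * RtoC (ln (INR M))))%C).
  set (g := fun n w => (rgamma_seq (M * n + (M - 1)) (RtoC (INR M) * w) *
      Cexp (RtoC (INR M) * w * RtoC (ln (INR (M * n + (M - 1))) - ln (INR n))))%C).
  set (F := fun w => Cprod (fun j => rgamma (w + RtoC ((INR j - 1) / INR M))) M).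
  set (f := fun n w => Cprod (fun j => rgamma_seq n (w + RtoC ((INR j - 1) / INR M))) M).
  assert (Lg : forall w, Clim (fun n => g n w) (G w)).
  { intro w. apply Clim_mult.
    - apply (Clim_subseq (fun m => rgamma_seq m (RtoC (INR M) * w))); [|apply rgamma_Clim].
      apply eventually_subseq. intro n. lia.
    - apply Clim_Cexp, Clim_mult; [apply Clim_const|]. apply Clim_RtoC, ln_ratio_lim; auto. }
  assert (Lf : forall w, Clim (fun n => f n w) (F w)).
  { intro w. apply (Clim_Cprod (fun j n => rgamma_seq n (w + RtoC ((INR j - 1) / INR M)))).
    intro k. apply rgamma_Clim. }
  (* Comparison with the reference point 1 eliminates the rank-dependent constant before the limit
     is taken. *)
  assert (E : forall n w, (f n w * g n 1 = f n 1 * g n w)%C).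
  { intros n w. destruct (rgamma_seq_mult M n HM) as [c Hc].
    unfold f, g. rewrite !Hc. ring. }
  assert (E' : forall w, (F w * G 1 = F 1 * G w)%C).
  { intro w. apply (Clim_unique (fun n => f n w * g n 1)%C).
    - now apply Clim_mult.
    - eapply Clim_ext; [intro n; symmetry; apply E|]. now apply Clim_mult. }
  (* At the point 1 all arguments of [rgamma] have positive real part, so nothing vanishes there. *)
  assert (G1 : G 1 <> 0).
  { unfold G. apply Cmult_neq_0; [|apply Cexp_nonzero].
    apply rgamma_nonzero_Re_pos. simpl. lra. }
  assert (F1 : F 1 <> 0).
  { unfold F. apply Cprod_nonzero. intros k Hk. apply rgamma_nonzero_Re_pos. simpl.
    assert (1 <= INR k) by (apply (le_INR 1); lia).
    assert (0 <= (INR k - 1) / INR M); [|lra].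
    apply Rmult_le_pos; [lra|]. left; apply Rinv_0_lt_compat; lra. }
  exists (F 1 * / G 1)%C. split.
  - apply Cmult_neq_0; auto. now apply Cinv_nonzero.
  - intro w. change (F w = (F 1 * / G 1 * Cexp (RtoC (INR M) * w * RtoC (ln (INR M)))
      * rgamma (RtoC (INR M) * w))%C).
    replace (F 1 * / G 1 * Cexp (RtoC (INR M) * w * RtoC (ln (INR M)))
      * rgamma (RtoC (INR M) * w))%C with (F 1 * G w * / G 1)%C by (unfold G at 1; ring).
    rewrite <- E'. field. auto.
Qed.

(** * Uniform limits of polynomials *)

Definition peval (l : list C) (s : C) : C :=
  List.fold_right (fun a r => a + s * r)%C (RtoC 0) l.

(** This takes the place of holomorphy. It is verified by closure under algebraic operations and
    uniform limits, and Cauchy's formula carries over from polynomials. *)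
Definition approx (K : C -> Prop) (f : C -> C) : Prop :=
  forall eps, 0 < eps -> exists l, forall s, K s -> Cmod (f s - peval l s) <= eps.

Definition bounded_set (K : C -> Prop) : Prop := exists r, forall s, K s -> Cmod s <= r.

Lemma peval_plus (l1 l2 : list C) :
  exists l, forall s, peval l s = (peval l1 s + peval l2 s)%C.
Proof.
  revert l2. induction l1 as [|a l1 IH]; intro l2.
  - exists l2. intro s. simpl. ring.
  - destruct l2 as [|b l2].
    + exists (a :: l1). intro s. simpl. ring.
    + destruct (IH l2) as [l Hl]. exists ((a + b)%C :: l). intro s. simpl. rewrite Hl. ring.
Qed.

Lemma peval_scal (c : C) (l : list C) : exists l', forall s, peval l' s = (c * peval l s)%C.
Proof.
  exists (map (fun a => c * a)%C l). intro s. induction l as [|a l IH]; simpl; [ring|].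
  rewrite IH. ring.
Qed.

Lemma peval_mult (l1 l2 : list C) :
  exists l, forall s, peval l s = (peval l1 s * peval l2 s)%C.
Proof.
  induction l1 as [|a l1 [l Hl]].
  - exists nil. intro s. simpl. ring.
  - destruct (peval_scal a l2) as [l' Hl']. destruct (peval_plus l' (RtoC 0 :: l)) as [l'' H].
    exists l''. intro s. rewrite H, Hl'. simpl. rewrite Hl. ring.
Qed.

Lemma peval_bounded (l : list C) (r : R) :
  exists B, 0 <= B /\ forall s, Cmod s <= r -> Cmod (peval l s) <= B.
Proof.
  induction l as [|a l [B [HB IH]]].
  - exists 0. split; [lra|]. intros s _. simpl. rewrite Cmod_0. lra.
  - exists (Cmod a + Rmax r 0 * B). pose proof (Rmax_r r 0). split.
    + pose proof (Cmod_ge_0 a). assert (0 <= Rmax r 0 * B) by now apply Rmult_le_pos. lra.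
    + intros s Hs. simpl. eapply Rle_trans; [apply Cmod_triangle|]. rewrite Cmod_mult.
      apply Rplus_le_compat_l, Rmult_le_compat; auto; try apply Cmod_ge_0.
      eapply Rle_trans; [exact Hs|apply Rmax_l].
Qed.

(** Horner's synthetic division by [s - p]. The quotient serves both for Cauchy's formula and for a
    Lipschitz bound at [p]. *)
Lemma peval_factor (l : list C) (p : C) :
  exists q, forall s, peval l s = (peval l p + (s - p) * peval q s)%C.
Proof.
  induction l as [|a l [q Hq]].
  - exists nil. intro s. simpl. ring.
  - exists (peval l p :: q). intro s. simpl. rewrite (Hq s). ring.
Qed.

Lemma archimedean_div (D eps : R) : 0 < eps -> exists n, (1 <= n)%nat /\ D / INR n <= eps.
Proof.
  intro He. destruct (INR_unbounded (D / eps)) as [n Hn]. exists (S n). split; [lia|].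
  assert (0 < INR (S n)) by (apply lt_0_INR; lia).
  apply Rmult_le_reg_r with (INR (S n)); auto.
  replace (D / INR (S n) * INR (S n)) with (D / eps * eps) by (field; lra).
  rewrite Rmult_comm. apply Rmult_le_compat_l; [lra|]. rewrite S_INR. lra.
Qed.

Lemma approx_bounded (K : C -> Prop) (f : C -> C) : bounded_set K -> approx K f ->
  exists B, 0 <= B /\ forall s, K s -> Cmod (f s) <= B.
Proof.
  intros [r Hr] Hf. destruct (Hf 1 Rlt_0_1) as [l Hl]. destruct (peval_bounded l r) as [B [HB H]].
  exists (1 + B). split; [lra|]. intros s Hs. replace (f s) with ((f s - peval l s) + peval l s)%C by ring.
  eapply Rle_trans; [apply Cmod_triangle|]. specialize (Hl s Hs). specialize (H s (Hr s Hs)). lra.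
Qed.

Lemma approx_subset (K K' : C -> Prop) (f : C -> C) :
  (forall s, K' s -> K s) -> approx K f -> approx K' f.
Proof. intros H Hf eps He. destruct (Hf eps He) as [l Hl]. exists l. auto. Qed.

Lemma approx_ext (K : C -> Prop) (f g : C -> C) :
  (forall s, K s -> f s = g s) -> approx K f -> approx K g.
Proof.
  intros H Hf eps He. destruct (Hf eps He) as [l Hl]. exists l. intros s Hs.
  rewrite <- H by auto. auto.
Qed.

Lemma approx_lim (K : C -> Prop) (f : C -> C) :
  (forall eps, 0 < eps -> exists g, approx K g /\ forall s, K s -> Cmod (f s - g s) <= eps) ->
  approx K f.
Proof.
  intros H eps He. destruct (H (eps / 2)) as [g [Hg Hfg]]; [lra|].
  destruct (Hg (eps / 2)) as [l Hl]; [lra|]. exists l. intros s Hs.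
  replace (f s - peval l s)%C with ((f s - g s) + (g s - peval l s))%C by ring.
  eapply Rle_trans; [apply Cmod_triangle|]. specialize (Hl s Hs). specialize (Hfg s Hs). lra.
Qed.

Lemma approx_peval (K : C -> Prop) (l : list C) : approx K (peval l).
Proof.
  intros eps He. exists l. intros s _. replace (_ - _)%C with (RtoC 0) by ring.
  rewrite Cmod_0. lra.
Qed.

Lemma approx_const (K : C -> Prop) (a : C) : approx K (fun _ => a).
Proof. apply approx_ext with (peval (a :: nil)); [|apply approx_peval]. intros; simpl; ring. Qed.

Lemma approx_id (K : C -> Prop) : approx K (fun s => s).
Proof.
  apply approx_ext with (peval (RtoC 0 :: RtoC 1 :: nil)); [|apply approx_peval]. intros; simpl; ring.
Qed.

Lemma approx_plus (K : C -> Prop) (f g : C -> C) :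
  approx K f -> approx K g -> approx K (fun s => f s + g s)%C.
Proof.
  intros Hf Hg eps He. destruct (Hf (eps / 2)) as [l1 H1]; [lra|].
  destruct (Hg (eps / 2)) as [l2 H2]; [lra|]. destruct (peval_plus l1 l2) as [l Hl].
  exists l. intros s Hs. rewrite Hl.
  replace (_ - _)%C with ((f s - peval l1 s) + (g s - peval l2 s))%C by ring.
  eapply Rle_trans; [apply Cmod_triangle|]. specialize (H1 s Hs). specialize (H2 s Hs). lra.
Qed.

Lemma approx_mult (K : C -> Prop) (f g : C -> C) : bounded_set K ->
  approx K f -> approx K g -> approx K (fun s => f s * g s)%C.
Proof.
  intros HK Hf Hg eps He.
  destruct (approx_bounded K f HK Hf) as [B [HB HBf]].
  destruct (Hg (eps / (2 * (B + 1)))) as [l2 H2]; [apply Rdiv_lt_0_compat; lra|].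
  destruct HK as [r Hr]. destruct (peval_bounded l2 r) as [B2 [HB2 HBg]].
  destruct (Hf (eps / (2 * (B2 + 1)))) as [l1 H1]; [apply Rdiv_lt_0_compat; lra|].
  destruct (peval_mult l1 l2) as [l Hl]. exists l. intros s Hs. rewrite Hl.
  replace (_ - _)%C with (f s * (g s - peval l2 s) + (f s - peval l1 s) * peval l2 s)%C by ring.
  eapply Rle_trans; [apply Cmod_triangle|]. rewrite !Cmod_mult.
  specialize (H1 s Hs). specialize (H2 s Hs). specialize (HBf s Hs). specialize (HBg s (Hr s Hs)).
  assert (Cmod (f s) * Cmod (g s - peval l2 s) <= (B + 1) * (eps / (2 * (B + 1)))).
  { apply Rmult_le_compat; try apply Cmod_ge_0; lra. }
  assert (Cmod (f s - peval l1 s) * Cmod (peval l2 s) <= (eps / (2 * (B2 + 1))) * (B2 + 1)).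
  { apply Rmult_le_compat; try apply Cmod_ge_0; lra. }
  replace eps with ((B + 1) * (eps / (2 * (B + 1))) + (eps / (2 * (B2 + 1))) * (B2 + 1))
    by (field; lra). lra.
Qed.

Lemma approx_opp (K : C -> Prop) (f : C -> C) : approx K f -> approx K (fun s => - f s)%C.
Proof.
  intros Hf eps He. destruct (Hf eps He) as [l Hl]. destruct (peval_scal (- (1))%C l) as [l' Hl'].
  exists l'. intros s Hs. rewrite Hl'. replace (_ - _)%C with (- (f s - peval l s))%C by ring.
  rewrite Cmod_opp. auto.
Qed.

Lemma approx_pow (K : C -> Prop) (f : C -> C) (n : nat) : bounded_set K ->
  approx K f -> approx K (fun s => f s ^ n)%C.
Proof.
  intros HK Hf. induction n as [|n IH]; simpl; [apply approx_const | now apply approx_mult].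
Qed.

Lemma Cpow_sub_le (a b : C) (m : R) (n : nat) : Cmod a <= m -> Cmod b <= m ->
  Cmod (a ^ (S n) - b ^ (S n)) <= INR (S n) * m ^ n * Cmod (a - b).
Proof.
  intros Ha Hb. assert (Hm : 0 <= m) by (pose proof (Cmod_ge_0 a); lra).
  induction n as [|n IH].
  - simpl. rewrite !Cmult_1_r. lra.
  - replace (a ^ S (S n) - b ^ S (S n))%C with (a * (a ^ S n - b ^ S n) + (a - b) * b ^ S n)%C
      by (rewrite !(Cpow_S _ (S n)); ring).
    eapply Rle_trans; [apply Cmod_triangle|]. rewrite !Cmod_mult, Cmod_pow.
    rewrite (S_INR (S n)).
    pose proof (Cmod_ge_0 a). pose proof (Cmod_ge_0 b). pose proof (Cmod_ge_0 (a - b)).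
    pose proof (Cmod_ge_0 (a ^ S n - b ^ S n)).
    assert (Cmod a * Cmod (a ^ S n - b ^ S n) <= m * (INR (S n) * m ^ n * Cmod (a - b)))
      by (apply Rmult_le_compat; auto).
    assert (Cmod b ^ S n <= m ^ S n) by (apply pow_incr; lra).
    assert (Cmod (a - b) * Cmod b ^ S n <= Cmod (a - b) * m ^ S n)
      by (apply Rmult_le_compat_l; auto).
    replace ((INR (S n) + 1) * m ^ S n * Cmod (a - b)) with
      (m * (INR (S n) * m ^ n * Cmod (a - b)) + Cmod (a - b) * m ^ S n) by (simpl; ring). lra.
Qed.

(** Compares the powers of order [n + 1] of [exp(w/(n+1))] and [1 + w/(n+1)]. The bases differ by a
    quadratic remainder and have modulus at most [exp(B/(n+1))], so the [n + 1] telescoped terms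
    still sum to [O(1/(n+1))]. *)
Lemma Cexp_pow_approx (w : C) (B : R) (n : nat) : Cmod w <= B ->
  Cmod (Cexp w - (1 + w * RtoC (/ INR (S n))) ^ (S n)) <= (4 * B ^ 2 * exp B) / INR (S n).
Proof.
  intro Hw. pose proof (Cmod_ge_0 w) as Pw.
  assert (Pn : 0 < INR (S n)) by (apply lt_0_INR; lia).
  set (h := / INR (S n)). assert (Ph : 0 < h) by now apply Rinv_0_lt_compat.
  set (v := (w * RtoC h)%C).
  assert (Hv : Cmod v <= B * h).
  { unfold v. rewrite Cmod_mult, Cmod_R, Rabs_right by lra. apply Rmult_le_compat_r; lra. }
  replace (Cexp w) with (Cexp v ^ S n)%C.
  2: { rewrite Cexp_pow. f_equal. unfold v, h. rewrite RtoC_inv by lra. field.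
       apply RtoC_nonzero; lra. }
  eapply Rle_trans; [apply (Cpow_sub_le _ _ (exp (B * h)))|].
  - rewrite Cmod_Cexp. apply exp_le_compat. pose proof (Re_le_Cmod v). lra.
  - eapply Rle_trans; [apply Cmod_triangle|]. rewrite Cmod_1.
    destruct (Req_dec (B * h) 0) as [E|E].
    + rewrite E, exp_0. lra.
    + pose proof (exp_ineq1 _ E). lra.
  - assert (Hd : Cmod (Cexp v - (1 + v)) <= 4 * (B * h) ^ 2 * exp (B * h)).
    { replace (Cexp v - (1 + v))%C with (Cexp v - 1 - v)%C by ring.
      eapply Rle_trans; [apply Cexp_sub_1_sub|].
      pose proof (Cmod_ge_0 v).
      assert (Cmod v ^ 2 <= (B * h) ^ 2) by (apply pow_incr; lra).
      pose proof (pow2_ge_0 (Cmod v)).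
      apply Rmult_le_compat; try lra; [left; apply exp_pos|]. now apply exp_le_compat. }
    pose proof (exp_pos (B * h)).
    assert (0 <= INR (S n) * exp (B * h) ^ n).
    { apply Rmult_le_pos; [lra|]. apply pow_le; lra. }
    eapply Rle_trans; [apply Rmult_le_compat_l; [assumption|exact Hd]|].
    right.
    assert (E : exp (B * h) ^ n * exp (B * h) = exp B).
    { rewrite <- (Rpower_pow n) by auto. unfold Rpower. rewrite ln_exp, <- exp_plus. f_equal.
      unfold h. rewrite S_INR in *. field. lra. }
    rewrite <- E. unfold h. field. lra.
Qed.

Lemma approx_Cexp (K : C -> Prop) (g : C -> C) : bounded_set K ->
  approx K g -> approx K (fun s => Cexp (g s)).
Proof.
  intros HK Hg. destruct (approx_bounded K g HK Hg) as [B [HB HBg]].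
  apply approx_lim. intros eps He.
  destruct (archimedean_div (4 * B ^ 2 * exp B) eps He) as [[|n] [Hn Hle]]; [lia|].
  exists (fun s => (1 + g s * RtoC (/ INR (S n))) ^ (S n))%C. split.
  - apply approx_pow; auto. apply approx_plus; [apply approx_const|].
    apply approx_mult; auto. apply approx_const.
  - intros s Hs. eapply Rle_trans; [apply Cexp_pow_approx; auto|exact Hle].
Qed.

(** A bounded set in the half-plane [d <= Re] lies in a disc about [1/a], of radius less than [1/a],
    once [a] is small. There [1/g] is the sum of the geometric series [a (1 - a g)^k]. *)
Lemma approx_inv (K : C -> Prop) (g : C -> C) (d : R) : bounded_set K -> 0 < d ->
  approx K g -> (forall s, K s -> d <= Re (g s)) -> approx K (fun s => / g s)%C.
Proof.
  intros HK Hd Hg Hre. destruct (approx_bounded K g HK Hg) as [B0 [HB0 HBg0]].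
  set (B := B0 + d). assert (HB : d <= B) by (unfold B; lra).
  assert (HBg : forall s, K s -> Cmod (g s) <= B).
  { intros s Hs. specialize (HBg0 s Hs). unfold B. lra. }
  (* Chosen so that [a B^2 = d]; then [|1 - a g|^2 <= 1 - 2 a d + a^2 B^2 = 1 - a d], the square of
     [rho]. *)
  set (a := d / B ^ 2).
  assert (PB : 0 < B ^ 2) by (apply pow_lt; lra).
  assert (Pa : 0 < a) by (apply Rdiv_lt_0_compat; auto).
  set (t := fun s => (1 - g s * RtoC a)%C).
  set (rho := sqrt (1 - a * d)).
  assert (Had : 0 < a * d <= 1).
  { split; [apply Rmult_lt_0_compat; lra|]. unfold a.
    apply Rmult_le_reg_r with (B ^ 2); auto.
    replace (d / B ^ 2 * d * B ^ 2) with (d ^ 2) by (field; lra).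
    rewrite Rmult_1_l. apply pow_incr. lra. }
  assert (Hrho : 0 <= rho < 1).
  { split; [apply sqrt_pos|]. rewrite <- sqrt_1. apply sqrt_lt_1; lra. }
  assert (Ht : forall s, K s -> Cmod (t s) <= rho).
  { intros s Hs. unfold rho. rewrite <- (sqrt_pow2 (Cmod (t s))) by apply Cmod_ge_0.
    apply sqrt_le_1_alt. rewrite Cmod2_alt.
    specialize (HBg s Hs). specialize (Hre s Hs).
    assert (E : Cmod (g s) ^ 2 <= B ^ 2) by (apply pow_incr; split; auto; apply Cmod_ge_0).
    rewrite Cmod2_alt in E.
    replace (Re (t s)) with (1 - a * Re (g s)) by (unfold t; destruct (g s); simpl; ring).
    replace (Im (t s)) with (- (a * Im (g s))) by (unfold t; destruct (g s); simpl; ring).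
    assert (aB : a * B ^ 2 = d) by (unfold a; field; lra).
    assert (a * (Re (g s) ^ 2 + Im (g s) ^ 2) <= d) by (rewrite <- aB; apply Rmult_le_compat_l; lra).
    assert (a * d <= a * Re (g s)) by (apply Rmult_le_compat_l; lra).
    assert (a * (a * (Re (g s) ^ 2 + Im (g s) ^ 2)) <= a * d) by (apply Rmult_le_compat_l; lra).
    lra. }
  assert (At : approx K t).
  { unfold t. apply approx_plus; [apply approx_const|]. apply approx_opp.
    apply approx_mult; auto. apply approx_const. }
  (* Partial sums of the geometric series, which satisfy [h n * g = 1 - t^n]. *)
  set (h := fix h n s := match n with O => RtoC 0 | S k => (h k s + t s ^ k * RtoC a)%C end).
  assert (Ah : forall n, approx K (h n)).
  { induction n as [|n IH]; [apply approx_const|].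
    change (approx K (fun s => h n s + t s ^ n * RtoC a)%C).
    apply approx_plus; auto. apply approx_mult; [auto| |apply approx_const]. now apply approx_pow. }
  assert (Eh : forall n s, (h n s * g s = 1 - t s ^ n)%C).
  { intros n s. induction n as [|n IH]; [simpl; ring|].
    change ((h n s + t s ^ n * RtoC a) * g s = 1 - t s ^ S n)%C.
    rewrite Cmult_plus_distr_r, IH, Cpow_S. unfold t at 2 4. unfold t. ring. }
  apply approx_lim. intros eps He.
  destruct (pow_lt_1_zero rho ltac:(rewrite Rabs_right; lra) (eps * d) ltac:(nra)) as [n Hn].
  exists (h n). split; auto. intros s Hs.
  assert (Ng : g s <> 0) by (apply Re_pos_nonzero; specialize (Hre s Hs); lra).
  replace (/ g s - h n s)%C with ((1 - h n s * g s) * / g s)%C by (field; auto).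
  rewrite Eh. replace (1 - (1 - t s ^ n))%C with (t s ^ n)%C by ring.
  rewrite Cmod_mult, Cmod_pow, Cmod_inv by auto.
  specialize (Hn n (Nat.le_refl n)). rewrite Rabs_right in Hn by (apply Rle_ge, pow_le; lra).
  assert (Cmod (t s) ^ n <= rho ^ n) by (apply pow_incr; split; [apply Cmod_ge_0|auto]).
  assert (d <= Cmod (g s)) by (specialize (Hre s Hs); pose proof (Re_le_Cmod (g s)); lra).
  replace eps with (eps * d * / d) by (field; lra).
  apply Rmult_le_compat; [apply pow_le, Cmod_ge_0| | lra |].
  - left; apply Rinv_0_lt_compat; lra.
  - apply Rinv_le_contravar; lra.
Qed.

Lemma approx_inv_neg (K : C -> Prop) (g : C -> C) (d : R) : bounded_set K -> 0 < d ->
  approx K g -> (forall s, K s -> Re (g s) <= - d) -> approx K (fun s => / g s)%C.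
Proof.
  intros HK Hd Hg Hre. apply approx_ext with (fun s => - / - g s)%C.
  - intros s Hs. field. intro E. specialize (Hre s Hs).
    rewrite E in Hre. simpl in Hre. lra.
  - apply approx_opp, approx_inv with d; auto; [now apply approx_opp|].
    intros s Hs. specialize (Hre s Hs). destruct (g s); simpl in *. lra.
Qed.

Lemma approx_Cprod (K : C -> Prop) (f : nat -> C -> C) (n : nat) : bounded_set K ->
  (forall k, (1 <= k <= n)%nat -> approx K (f k)) -> approx K (fun s => Cprod (fun k => f k s) n).
Proof.
  intros HK. induction n as [|n IH]; intro Hf; simpl; [apply approx_const|].
  apply approx_mult; [auto | apply IH; intros; apply Hf; lia | apply Hf; lia].
Qed.

(** * Gamma and its reciprocal as uniform limits of polynomials *)

Lemma approx_rgamma_seq (K : C -> Prop) (g : C -> C) (n : nat) : bounded_set K ->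
  approx K g -> approx K (fun s => rgamma_seq n (g s)).
Proof.
  intros HK Hg. unfold rgamma_seq, Cdiv. apply approx_mult; [auto| |apply approx_const].
  apply approx_mult; auto.
  - apply approx_mult; auto. apply approx_Cprod; auto. intros k _.
    apply approx_plus; auto. apply approx_const.
  - apply approx_Cexp; auto. apply approx_opp, approx_mult; auto. apply approx_const.
Qed.

Lemma approx_rgamma (K : C -> Prop) (g : C -> C) : bounded_set K ->
  approx K g -> approx K (fun s => rgamma (g s)).
Proof.
  intros HK Hg. destruct (approx_bounded K g HK Hg) as [B [HB HBg]].
  destruct (rgamma_rate B HB) as [D HD]. apply approx_lim. intros eps He.
  destruct (archimedean_div D eps He) as [n [Hn Hle]].
  exists (fun s => rgamma_seq n (g s)). split; [now apply approx_rgamma_seq|].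
  intros s Hs. eapply Rle_trans; [apply (HD (g s) (HBg s Hs)); auto|exact Hle].
Qed.

(** The reciprocal of a Gauss product is split into reciprocals of its factors [g s + k]: each of
    these has real part at least [d], as [approx_inv] demands, whereas their product need not. *)
Lemma approx_inv_rgamma (K : C -> Prop) (g : C -> C) (d : R) : bounded_set K -> 0 < d ->
  approx K g -> (forall s, K s -> d <= Re (g s)) -> approx K (fun s => / rgamma (g s))%C.
Proof.
  intros HK Hd Hg Hre. destruct (approx_bounded K g HK Hg) as [B [HB HBg]].
  destruct (rgamma_inv_rate d B Hd) as [D HD]. apply approx_lim. intros eps He.
  destruct (archimedean_div D eps He) as [n [Hn Hle]].
  exists (fun s => / rgamma_seq n (g s))%C. split.
  - unfold rgamma_seq, Cdiv.
    apply approx_ext with (fun s => / g s * Cprod (fun k => / (g s + RtoC (INR k))) n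
       * Cexp (g s * RtoC (ln (INR n))) * RtoC (INR (fact n)))%C.
    + intros s Hs. rewrite Cprod_inv, !Cinv_mult, Cexp_opp, !Cinv_invol. ring.
    + apply approx_mult; [auto| |apply approx_const].
      apply approx_mult; auto; [apply approx_mult; auto|].
      * now apply approx_inv with d.
      * apply approx_Cprod; auto. intros k _. apply approx_inv with d; auto.
        -- apply approx_plus; auto. apply approx_const.
        -- intros s Hs. specialize (Hre s Hs). pose proof (pos_INR k).
           destruct (g s); simpl in *. lra.
      * apply approx_Cexp; auto. apply approx_mult; auto. apply approx_const.
  - intros s Hs. eapply Rle_trans; [apply (HD (g s)); auto|exact Hle].
Qed.

(** Serves to show that a quotient with nonzero numerator really has a pole. The three-term estimate
    uses that a polynomial is Lipschitz at [p]. *)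
Lemma approx_continuous (f : C -> C) (p : C) (r : R) : 0 < r ->
  approx (fun s => Cmod (s - p) <= r) f ->
  forall eps, 0 < eps -> exists del, 0 < del /\ forall s, Cmod (s - p) < del ->
    Cmod (f s - f p) < eps.
Proof.
  intros Hr Hf eps He. destruct (Hf (eps / 4)) as [l Hl]; [lra|].
  destruct (peval_factor l p) as [q Hq]. destruct (peval_bounded q (r + Cmod p)) as [B [HB HBq]].
  exists (Rmin r (eps / (4 * (B + 1)))). split.
  - apply Rmin_pos; auto. apply Rdiv_lt_0_compat; lra.
  - intros s Hs. assert (H1 := Rlt_le_trans _ _ _ Hs (Rmin_l _ _)).
    assert (H2 := Rlt_le_trans _ _ _ Hs (Rmin_r _ _)).
    replace (f s - f p)%C with ((f s - peval l s) + - (f p - peval l p) + (peval l s - peval l p))%C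
      by ring.
    eapply Rle_lt_trans; [apply Cmod_triangle|].
    eapply Rle_lt_trans; [apply Rplus_le_compat_r, Cmod_triangle|]. rewrite Cmod_opp.
    assert (A1 := Hl s (Rlt_le _ _ H1)).
    assert (A2 : Cmod (f p - peval l p) <= eps / 4).
    { apply Hl. replace (p - p)%C with (RtoC 0) by ring. rewrite Cmod_0. lra. }
    assert (A3 : Cmod (peval l s - peval l p) <= eps / 4).
    { rewrite (Hq s). replace (_ - _)%C with ((s - p) * peval q s)%C by ring. rewrite Cmod_mult.
      replace (eps / 4) with ((eps / (4 * (B + 1))) * (B + 1)) by (field; lra).
      apply Rmult_le_compat; try apply Cmod_ge_0; [lra|].
      assert (Cmod (peval q s) <= B); [|lra]. apply HBq.
      replace s with ((s - p) + p)%C by ring. eapply Rle_trans; [apply Cmod_triangle|]. lra. }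
    lra.
Qed.

(** * Cauchy's formula on rectangles *)

Notation is_CInt := (is_RInt (V := C_R_NormedModule)).
Notation ex_CInt := (ex_RInt (V := C_R_NormedModule)).
Notation CInt := (RInt (V := C_R_CompleteNormedModule)).

Lemma norm_C_R (z : C) : norm (V := C_R_NormedModule) z = Cmod z.
Proof.
  destruct z as [a b]. change (sqrt (Rabs a ^ 2 + Rabs b ^ 2) = Cmod (a, b)).
  rewrite !pow2_abs. reflexivity.
Qed.

Lemma is_CInt_Re_Im (f : R -> C) (a b : R) (l : C) :
  is_RInt (fun t => Re (f t)) a b (Re l) -> is_RInt (fun t => Im (f t)) a b (Im l) ->
  is_CInt f a b l.
Proof. intros H1 H2. destruct l as [u v]. exact (is_RInt_fct_extend_pair f a b u v H1 H2). Qed.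

Lemma is_CInt_Re (f : R -> C) (a b : R) (l : C) :
  is_CInt f a b l -> is_RInt (fun t => Re (f t)) a b (Re l).
Proof. intro H. exact (is_RInt_fct_extend_fst f a b l H). Qed.

Lemma is_CInt_Im (f : R -> C) (a b : R) (l : C) :
  is_CInt f a b l -> is_RInt (fun t => Im (f t)) a b (Im l).
Proof. intro H. exact (is_RInt_fct_extend_snd f a b l H). Qed.

Lemma is_CInt_plus (f g : R -> C) (a b : R) (u v : C) :
  is_CInt f a b u -> is_CInt g a b v -> is_CInt (fun t => f t + g t)%C a b (u + v)%C.
Proof. intros Hu Hv. exact (is_RInt_plus (V := C_R_NormedModule) f g a b u v Hu Hv). Qed.

Lemma is_CInt_mult_l (c : C) (f : R -> C) (a b : R) (u : C) :
  is_CInt f a b u -> is_CInt (fun t => c * f t)%C a b (c * u)%C.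
Proof.
  intro H. pose proof (is_CInt_Re _ _ _ _ H) as H1. pose proof (is_CInt_Im _ _ _ _ H) as H2.
  destruct c as [p q]. apply is_CInt_Re_Im.
  - apply (is_RInt_minus (fun t => p * Re (f t)) (fun t => q * Im (f t)) a b (p * Re u) (q * Im u));
    now apply (is_RInt_scal (V := R_NormedModule)).
  - apply (is_RInt_plus (V := R_NormedModule) (fun t => p * Im (f t)) (fun t => q * Re (f t))
      a b (p * Im u) (q * Re u));
    now apply (is_RInt_scal (V := R_NormedModule)).
Qed.

Lemma is_CInt_ext (f g : R -> C) (a b : R) (u : C) : a <= b ->
  (forall t, a < t < b -> f t = g t) -> is_CInt f a b u -> is_CInt g a b u.
Proof.
  intros Hab H. apply is_RInt_ext. intros t. rewrite Rmin_left, Rmax_right by auto. apply H.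
Qed.

Lemma is_CInt_congr (f g : R -> C) (a b : R) (u : C) :
  (forall t, f t = g t) -> is_CInt f a b u -> is_CInt g a b u.
Proof. intros H. apply is_RInt_ext. intros t _. apply H. Qed.

Lemma is_CInt_bound (f : R -> C) (a b B : R) (u : C) : a <= b ->
  (forall t, a <= t <= b -> Cmod (f t) <= B) -> is_CInt f a b u -> Cmod u <= (b - a) * B.
Proof.
  intros Hab H Hu. rewrite <- norm_C_R.
  apply (norm_RInt_le_const (V := C_R_NormedModule) f a b u B Hab); auto.
  intros t Ht. rewrite norm_C_R. auto.
Qed.

Lemma filterlim_Clim (u : nat -> C) (l : C) :
  filterlim u eventually (locally (T := C_R_NormedModule) l) -> Clim u l.
Proof.
  intro H. destruct l as [u1 u2]. apply Clim_Re_Im.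
  - apply (filterlim_comp _ _ _ u (fun z : C => fst z) _ _ _ H).
    apply (continuous_fst (U := R_UniformSpace) (V := R_UniformSpace) u1 u2).
  - apply (filterlim_comp _ _ _ u (fun z : C => snd z) _ _ _ H).
    apply (continuous_snd (U := R_UniformSpace) (V := R_UniformSpace) u1 u2).
Qed.

Lemma CInt_uniform_limit (f : nat -> R -> C) (g : R -> C) (I : nat -> C) (a b : R) (e : nat -> R) :
  a <= b -> (forall n, is_CInt (f n) a b (I n)) ->
  (forall n t, a < t < b -> Cmod (f n t - g t) <= e n) -> is_lim_seq e 0 ->
  exists J, Clim I J /\ is_CInt g a b J.
Proof.
  intros Hab Hf Hfg He.
  (* [filterlim_RInt] asks for uniform convergence on the whole line, so all functions are set to 0
     outside the open interval. *)
  set (cut := fun (h : R -> C) t => if Rlt_dec a t then if Rlt_dec t b then h t else RtoC 0 else RtoC 0).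
  assert (Hcut : forall h t, a < t < b -> cut h t = h t).
  { intros h t [H1 H2]. unfold cut. destruct (Rlt_dec a t); [|lra]. destruct (Rlt_dec t b); [auto|lra]. }
  destruct (filterlim_RInt (V := C_R_CompleteNormedModule) (fun n => cut (f n)) a b eventually
     eventually_filter (cut g) I) as [J [HJ1 HJ2]].
  - intro n. apply is_CInt_ext with (f n); auto. intros t Ht. now rewrite Hcut.
  - apply filterlim_locally. intros eps.
    destruct (proj2 (is_lim_seq_spec _ _) He eps) as [N HN]. exists N. intros n Hn t.
    specialize (HN n Hn). simpl in HN. rewrite Rminus_0_r in HN.
    pose proof (Rle_abs (e n)).
    apply (C_NormedModule_mixin_compat1 (cut g t) (cut (f n) t)).
    change (Cmod (cut (f n) t - cut g t) < eps).
    unfold cut. destruct (Rlt_dec a t); [destruct (Rlt_dec t b)|].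
    + specialize (Hfg n t (conj r r0)). lra.
    + replace (RtoC 0 - RtoC 0)%C with (RtoC 0) by ring. rewrite Cmod_0. apply cond_pos.
    + replace (RtoC 0 - RtoC 0)%C with (RtoC 0) by ring. rewrite Cmod_0. apply cond_pos.
  - exists J. split; [now apply filterlim_Clim|].
    apply is_CInt_ext with (cut g); auto.
Qed.

(** * Primitives of polynomials along segments *)

Definition is_Cderive (f : R -> C) (x : R) (l : C) : Prop :=
  is_derive (fun t => Re (f t)) x (Re l) /\ is_derive (fun t => Im (f t)) x (Im l).

Lemma is_Cderive_mult (f g : R -> C) (x : R) (f' g' : C) :
  is_Cderive f x f' -> is_Cderive g x g' ->
  is_Cderive (fun t => f t * g t)%C x (f' * g x + f x * g')%C.
Proof.
  intros [F1 F2] [G1 G2].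
  assert (M : forall a b : R -> R, forall a' b', is_derive a x a' -> is_derive b x b' ->
     is_derive (fun t => a t * b t) x (a' * b x + a x * b')).
  { intros a b a' b' Ha Hb. apply (is_derive_mult a b x a' b' Ha Hb). intros; apply Rmult_comm. }
  split; simpl.
  - eapply is_derive_ext; [intro t; reflexivity|].
    evar_last. { apply @is_derive_minus; apply M; eassumption. }
    unfold Re, Im, minus, plus, opp; simpl. ring.
  - evar_last. { apply @is_derive_plus; apply M; eassumption. }
    unfold Re, Im, minus, plus, opp; simpl. ring.
Qed.

Lemma is_Cderive_ext (f g : R -> C) (x : R) (l : C) :
  (forall t, f t = g t) -> is_Cderive f x l -> is_Cderive g x l.
Proof.
  intros H [H1 H2].
  split; (eapply is_derive_ext; [intro t; cbv beta; rewrite <- H; reflexivity | assumption]).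
Qed.

Lemma is_Cderive_affine (p v : C) (x : R) : is_Cderive (fun t => p + RtoC t * v)%C x v.
Proof.
  destruct p as [p1 p2], v as [v1 v2].
  split; simpl; auto_derive; auto; ring.
Qed.

Lemma is_Cderive_pow (p v : C) (x : R) (n : nat) :
  is_Cderive (fun t => (p + RtoC t * v) ^ (S n))%C x
    (RtoC (INR (S n)) * (p + RtoC x * v) ^ n * v)%C.
Proof.
  induction n as [|n IH].
  - apply is_Cderive_ext with (fun t => p + RtoC t * v)%C.
    { intro t. simpl. ring. }
    replace (RtoC (INR 1) * (p + RtoC x * v) ^ 0 * v)%C with v by (simpl; ring).
    apply is_Cderive_affine.
  - pose proof (is_Cderive_mult _ _ x _ _ (is_Cderive_affine p v x) IH) as H.
    replace (RtoC (INR (S (S n))) * (p + RtoC x * v) ^ S n * v)%C with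
      (v * (p + RtoC x * v) ^ S n + (p + RtoC x * v) * (RtoC (INR (S n)) * (p + RtoC x * v) ^ n * v))%C;
      [exact H|].
    rewrite (S_INR (S n)), RtoC_plus, (Cpow_S _ n). ring.
Qed.

(** The second derivative is there to certify the continuity of [f'], which the fundamental theorem
    of calculus requires. *)
Lemma is_CInt_derive (f f' : R -> C) (f'' : R -> C) (a b : R) :
  (forall t, is_Cderive f t (f' t)) -> (forall t, is_Cderive f' t (f'' t)) ->
  is_CInt f' a b (f b - f a)%C.
Proof.
  intros H H'. apply is_CInt_Re_Im.
  - apply (is_RInt_derive (fun t => Re (f t)) (fun t => Re (f' t)) a b).
    + intros t _. apply H.
    + intros t _. apply (ex_derive_continuous (V := R_NormedModule)). exists (Re (f'' t)). apply H'.
  - apply (is_RInt_derive (fun t => Im (f t)) (fun t => Im (f' t)) a b).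
    + intros t _. apply H.
    + intros t _. apply (ex_derive_continuous (V := R_NormedModule)). exists (Im (f'' t)). apply H'.
Qed.

(** The direction [v] is kept general so that horizontal sides ([v = 1]) and vertical ones
    ([v = Ci]) are treated together. *)
Lemma is_CInt_pow (p v : C) (n : nat) (a b : R) :
  is_CInt (fun t => (p + RtoC t * v) ^ n * v)%C a b
    (/ RtoC (INR (S n)) * ((p + RtoC b * v) ^ S n - (p + RtoC a * v) ^ S n))%C.
Proof.
  assert (N : RtoC (INR (S n)) <> 0) by (apply RtoC_nonzero, not_0_INR; lia).
  apply is_CInt_congr with (fun t => / RtoC (INR (S n)) * (RtoC (INR (S n)) * (p + RtoC t * v) ^ n * v))%C.
  { intro t. field. exact N. }
  apply is_CInt_mult_l.
  (* The derivative of the integrand, with the constant case [n = 0] apart. *)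
  set (g := fun t => match n with O => RtoC 0
     | S m => (RtoC (INR (S n)) * (RtoC (INR (S m)) * (p + RtoC t * v) ^ m * v) * v)%C end).
  apply (is_CInt_derive (fun t => (p + RtoC t * v) ^ S n)%C _ g).
  - intro t. apply is_Cderive_pow.
  - intro t. unfold g. destruct n as [|m].
    + split; simpl; auto_derive; auto.
    + pose proof (is_Cderive_pow p v t m) as H.
      assert (Hc : forall c, is_Cderive (fun _ => c) t 0).
      { intro c. split; simpl; auto_derive; auto. }
      pose proof (is_Cderive_mult _ _ t _ _
        (is_Cderive_mult _ _ t _ _ (Hc (RtoC (INR (S (S m))))) H) (Hc v)) as H2.
      cbv beta in H2.
      match type of H2 with is_Cderive _ _ ?l => replace l with
        (RtoC (INR (S (S m))) * (RtoC (INR (S m)) * (p + RtoC t * v) ^ m * v) * v)%C in H2 by ring end.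
      exact H2.
Qed.

(** [Q] is chosen before the segment. The same values therefore occur at the corners shared by two
    sides of a rectangle, and they cancel. *)
Lemma peval_primitive (l : list C) : exists Q : C -> C, forall p v a b,
  is_CInt (fun t => peval l (p + RtoC t * v) * v)%C a b
    (Q (p + RtoC b * v) - Q (p + RtoC a * v))%C.
Proof.
  (* The tail of a coefficient list carries an extra factor [s]; the power [n] is added to make the
     induction go through. *)
  assert (P : forall n, exists Q : C -> C, forall p v a b,
    is_CInt (fun t => (p + RtoC t * v) ^ n * peval l (p + RtoC t * v) * v)%C a b
    (Q (p + RtoC b * v) - Q (p + RtoC a * v))%C).
  { induction l as [|c l IH]; intro n.
    - exists (fun _ => RtoC 0). intros p v a b.
      apply is_CInt_congr with (fun t => 0 * ((p + RtoC t * v) ^ n * v))%C.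
      { intro t. simpl. ring. }
      replace (RtoC 0 - RtoC 0)%C with
        (0 * (/ RtoC (INR (S n)) * ((p + RtoC b * v) ^ S n - (p + RtoC a * v) ^ S n)))%C by ring.
      apply is_CInt_mult_l, is_CInt_pow.
    - destruct (IH (S n)) as [Q HQ].
      exists (fun s => c * (/ RtoC (INR (S n)) * s ^ S n) + Q s)%C. intros p v a b.
      apply is_CInt_congr with (fun t => c * ((p + RtoC t * v) ^ n * v)
         + (p + RtoC t * v) ^ S n * peval l (p + RtoC t * v) * v)%C.
      { intro t. simpl. ring. }
      match goal with |- is_CInt _ _ _ ?u => replace u with
        (c * (/ RtoC (INR (S n)) * ((p + RtoC b * v) ^ S n - (p + RtoC a * v) ^ S n))
         + (Q (p + RtoC b * v) - Q (p + RtoC a * v)))%C by ring end.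
      apply is_CInt_plus; [|apply HQ]. apply is_CInt_mult_l, is_CInt_pow. }
  destruct (P 0%nat) as [Q HQ]. exists Q. intros p v a b.
  apply is_CInt_congr with (fun t => (p + RtoC t * v) ^ 0 * peval l (p + RtoC t * v) * v)%C; auto.
  intro t. simpl. ring.
Qed.

Definition on_rect (x0 x1 lo up : R) (s : C) : Prop :=
  x0 <= Re s <= x1 /\ - lo <= Im s <= up.

Definition on_boundary (x0 x1 lo up : R) (s : C) : Prop :=
  on_rect x0 x1 lo up s /\ (Re s = x0 \/ Re s = x1 \/ Im s = - lo \/ Im s = up).

Record rect_sides (f : C -> C) (x0 x1 lo up : R) (b r t l : C) : Prop := RectSides {
  rs_b : is_CInt (fun x => f (x, - lo)) x0 x1 b;
  rs_r : is_CInt (fun y => f (x1, y) * Ci)%C (- lo) up r;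
  rs_t : is_CInt (fun x => f (x, up)) x0 x1 t;
  rs_l : is_CInt (fun y => f (x0, y) * Ci)%C (- lo) up l }.

(** A relation rather than a function, so that integrability of the four sides travels with the
    value. Every side is parametrised in increasing direction, whence the minus signs for the top
    and the left. *)
Definition is_rect_int (f : C -> C) (x0 x1 lo up : R) (I : C) : Prop :=
  exists b r t l, rect_sides f x0 x1 lo up b r t l /\ I = (b + r - t - l)%C.

Section Rect.
Variables (x0 x1 lo up : R).
Hypothesis (Hx : x0 < x1) (Hlo : 0 < lo) (Hup : 0 < up).
Notation bd := (on_boundary x0 x1 lo up).
Notation rint f I := (is_rect_int f x0 x1 lo up I).

Lemma is_rect_int_plus (f g : C -> C) (u v : C) :
  rint f u -> rint g v -> rint (fun s => f s + g s)%C (u + v)%C.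
Proof.
  intros (b & r & t & l & [B R T L] & ->) (b' & r' & t' & l' & [B' R' T' L'] & ->).
  exists (b + b')%C, (r + r')%C, (t + t')%C, (l + l')%C. split; [|ring].
  split; [exact (is_CInt_plus _ _ _ _ _ _ B B')| |exact (is_CInt_plus _ _ _ _ _ _ T T')|].
  - apply is_CInt_congr with (fun y => f (x1, y) * Ci + g (x1, y) * Ci)%C.
    { intros; cbv beta; ring. } now apply is_CInt_plus.
  - apply is_CInt_congr with (fun y => f (x0, y) * Ci + g (x0, y) * Ci)%C.
    { intros; cbv beta; ring. } now apply is_CInt_plus.
Qed.

Lemma is_rect_int_mult_l (c : C) (f : C -> C) (u : C) :
  rint f u -> rint (fun s => c * f s)%C (c * u)%C.
Proof.
  intros (b & r & t & l & [B R T L] & ->).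
  exists (c * b)%C, (c * r)%C, (c * t)%C, (c * l)%C. split; [|ring].
  split; [exact (is_CInt_mult_l _ _ _ _ _ B)| |exact (is_CInt_mult_l _ _ _ _ _ T)|].
  - apply is_CInt_congr with (fun y => c * (f (x1, y) * Ci))%C.
    { intros; cbv beta; ring. } now apply is_CInt_mult_l.
  - apply is_CInt_congr with (fun y => c * (f (x0, y) * Ci))%C.
    { intros; cbv beta; ring. } now apply is_CInt_mult_l.
Qed.

Lemma on_boundary_bottom t : x0 <= t <= x1 -> bd (t, - lo).
Proof. unfold on_boundary, on_rect; simpl; lra. Qed.
Lemma on_boundary_top t : x0 <= t <= x1 -> bd (t, up).
Proof. unfold on_boundary, on_rect; simpl; lra. Qed.
Lemma on_boundary_left t : - lo <= t <= up -> bd (x0, t).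
Proof. unfold on_boundary, on_rect; simpl; lra. Qed.
Lemma on_boundary_right t : - lo <= t <= up -> bd (x1, t).
Proof. unfold on_boundary, on_rect; simpl; lra. Qed.

Lemma is_rect_int_ext (f g : C -> C) (u : C) :
  (forall s, bd s -> f s = g s) -> rint f u -> rint g u.
Proof.
  intros H (b & r & t & l & [B R T L] & ->). exists b, r, t, l. split; auto.
  split; (eapply is_CInt_ext; [lra| |eassumption]); intros z Hz; cbv beta; rewrite H; auto.
  - apply on_boundary_bottom; lra.
  - apply on_boundary_right; lra.
  - apply on_boundary_top; lra.
  - apply on_boundary_left; lra.
Qed.

Lemma is_rect_int_limit (f : nat -> C -> C) (g : C -> C) (I : nat -> C) (e : nat -> R) :
  (forall n, rint (f n) (I n)) -> (forall n s, bd s -> Cmod (f n s - g s) <= e n) ->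
  is_lim_seq e 0 -> exists J, Clim I J /\ rint g J.
Proof.
  intros Hf Hfg He.
  destruct (functional_choice (fun n (q : C * C * C * C) =>
     rect_sides (f n) x0 x1 lo up (fst (fst (fst q))) (snd (fst (fst q))) (snd (fst q)) (snd q) /\
     I n = (fst (fst (fst q)) + snd (fst (fst q)) - snd (fst q) - snd q)%C)) as [q Hq].
  { intro n. destruct (Hf n) as (b & r & t & l & H). now exists (b, r, t, l). }
  assert (Ci1 : forall a b, Cmod (a * Ci - b * Ci) = Cmod (a - b)).
  { intros a b. replace (a * Ci - b * Ci)%C with ((a - b) * Ci)%C by ring.
    rewrite Cmod_mult, Cmod_Ci. ring. }
  destruct (CInt_uniform_limit (fun n x => f n (x, - lo)) (fun x => g (x, - lo))
    (fun n => fst (fst (fst (q n)))) x0 x1 e) as [b [Lb Ib]]; auto; try lra.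
  { intro n. apply (Hq n). } { intros n t Ht. apply Hfg, on_boundary_bottom; lra. }
  destruct (CInt_uniform_limit (fun n y => f n (x1, y) * Ci)%C (fun y => g (x1, y) * Ci)%C
    (fun n => snd (fst (fst (q n)))) (- lo) up e) as [r [Lr Ir]]; auto; try lra.
  { intro n. apply (Hq n). } { intros n t Ht. rewrite Ci1. apply Hfg, on_boundary_right; lra. }
  destruct (CInt_uniform_limit (fun n x => f n (x, up)) (fun x => g (x, up))
    (fun n => snd (fst (q n))) x0 x1 e) as [t [Lt It]]; auto; try lra.
  { intro n. apply (Hq n). } { intros n t Ht. apply Hfg, on_boundary_top; lra. }
  destruct (CInt_uniform_limit (fun n y => f n (x0, y) * Ci)%C (fun y => g (x0, y) * Ci)%C
    (fun n => snd (q n)) (- lo) up e) as [l [Ll Il]]; auto; try lra.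
  { intro n. apply (Hq n). } { intros n t' Ht. rewrite Ci1. apply Hfg, on_boundary_left; lra. }
  exists (b + r - t - l)%C. split; [|exists b, r, t, l; now split].
  apply Clim_ext with (fun n => fst (fst (fst (q n))) + snd (fst (fst (q n)))
     + - (1) * snd (fst (q n)) + - (1) * snd (q n))%C.
  { intro n. rewrite (proj2 (Hq n)). ring. }
  replace (b + r - t - l)%C with (b + r + - (1) * t + - (1) * l)%C by ring.
  repeat apply Clim_plus; auto; apply Clim_mult; auto; apply Clim_const.
Qed.

Lemma is_rect_int_peval (l : list C) : rint (peval l) 0.
Proof.
  destruct (peval_primitive l) as [Q HQ].
  assert (H : forall y a b, is_CInt (fun x => peval l (x, y)) a b (Q (b, y) - Q (a, y))%C).
  { intros y a b. pose proof (HQ (0, y) 1 a b) as H.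
    assert (E : forall t : R, ((0, y) + RtoC t * 1)%C = (t, y)).
    { intro t. apply injective_projections; simpl; ring. }
    rewrite !E in H. eapply is_CInt_congr; [|exact H]. intro t. cbv beta. rewrite E. ring. }
  assert (V : forall x a b, is_CInt (fun y => peval l (x, y) * Ci)%C a b (Q (x, b) - Q (x, a))%C).
  { intros x a b. pose proof (HQ (x, 0) Ci a b) as V.
    assert (E : forall t : R, ((x, 0) + RtoC t * Ci)%C = (x, t)).
    { intro t. apply injective_projections; simpl; ring. }
    rewrite !E in V. eapply is_CInt_congr; [|exact V]. intro t. cbv beta. now rewrite E. }
  do 4 eexists. split; [split; [apply H|apply V|apply H|apply V]|]. ring.
Qed.

Lemma atan_add_inv (u v : R) : 0 < u * v -> 0 < u -> atan (u / v) + atan (v / u) = PI / 2.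
Proof.
  intros Huv Hu. assert (Hv : 0 < v) by nra.
  replace (v / u) with (/ (u / v)) by (field; lra).
  rewrite atan_inv by (apply Rdiv_lt_0_compat; auto). ring.
Qed.

(** No branch of the logarithm exists around [p], so each side gets its own primitive: the logarithm
    of the modulus, common to all, and an arctangent suited to that side. The logarithms cancel at
    the corners and the angles add up to [2 PI]. *)
Lemma is_rect_int_inv (p : R) : x0 < p < x1 ->
  rint (fun s => / (s - RtoC p))%C (2 * RtoC PI * Ci)%C.
Proof.
  intro Hp.
  set (L := fun x y => / 2 * ln ((x - p) ^ 2 + y ^ 2)).
  assert (Pos : forall x y, y <> 0 -> 0 < (x - p) ^ 2 + y ^ 2).
  { intros x y Hy. pose proof (pow2_ge_0 (x - p)). pose proof (pow2_gt_0 y Hy). lra. }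
  assert (Pos' : forall x y, x <> p -> 0 < (x - p) ^ 2 + y ^ 2).
  { intros x y Hy. assert (x - p <> 0) by lra.
    pose proof (pow2_ge_0 y). pose proof (pow2_gt_0 (x - p) H). lra. }
  assert (H : forall c, c <> 0 -> is_CInt (fun x => / ((x, c) - RtoC p))%C x0 x1
     ((L x1 c - L x0 c), (- atan ((x1 - p) / c) - - atan ((x0 - p) / c)))).
  { intros c Hc. apply is_CInt_Re_Im.
    - apply (is_RInt_derive (fun x => L x c)).
      + intros x _. specialize (Pos x c Hc). unfold L. auto_derive; [exact Pos|].
        simpl. field. simpl in Pos. lra.
      + intros x _. specialize (Pos x c Hc). simpl in Pos.
        apply (ex_derive_continuous (V := R_NormedModule)). simpl. auto_derive. lra.
    - apply (is_RInt_derive (fun x => - atan ((x - p) / c))).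
      + intros x _. specialize (Pos x c Hc). auto_derive; auto.
        simpl. field. simpl in Pos. repeat split; lra.
      + intros x _. specialize (Pos x c Hc). simpl in Pos.
        apply (ex_derive_continuous (V := R_NormedModule)). simpl. auto_derive. lra. }
  assert (V : forall x, x <> p -> is_CInt (fun y => / ((x, y) - RtoC p) * Ci)%C (- lo) up
     ((L x up - L x (- lo)), (atan (up / (x - p)) - atan (- lo / (x - p))))).
  { intros x Hxp. apply is_CInt_Re_Im.
    - apply (is_RInt_derive (fun y => L x y)).
      + intros y _. specialize (Pos' x y Hxp). unfold L. auto_derive; [exact Pos'|].
        simpl. field. simpl in Pos'. lra.
      + intros y _. specialize (Pos' x y Hxp). simpl in Pos'.
        apply (ex_derive_continuous (V := R_NormedModule)). simpl. auto_derive. lra.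
    - apply (is_RInt_derive (fun y => atan (y / (x - p)))).
      + intros y _. specialize (Pos' x y Hxp). auto_derive; [lra|].
        simpl. field. simpl in Pos'. repeat split; lra.
      + intros y _. specialize (Pos' x y Hxp). simpl in Pos'.
        apply (ex_derive_continuous (V := R_NormedModule)). simpl. auto_derive. lra. }
  do 4 eexists. split; [split; [apply H; lra|apply V; lra|apply H; lra|apply V; lra]|].
  apply injective_projections.
  - simpl. unfold L. ring.
  - simpl.
    set (X1 := x1 - p). set (X0 := p - x0).
    replace (x0 - p) with (- X0) by (unfold X0; ring).
    replace (X1 / - lo) with (- (X1 / lo)) by (field; lra).
    replace (- X0 / - lo) with (X0 / lo) by (field; lra).
    replace (- lo / X1) with (- (lo / X1)) by (field; unfold X1; lra).
    replace (- X0 / up) with (- (X0 / up)) by (field; lra).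
    replace (up / - X0) with (- (up / X0)) by (field; unfold X0; lra).
    replace (- lo / - X0) with (lo / X0) by (field; unfold X0; lra).
    rewrite !atan_opp.
    assert (P1 : 0 < X1) by (unfold X1; lra). assert (P0 : 0 < X0) by (unfold X0; lra).
    (* At each of the four corners the two adjacent angles are complementary and contribute
       [PI / 2]. *)
    pose proof (atan_add_inv X1 lo ltac:(nra) P1). pose proof (atan_add_inv X1 up ltac:(nra) P1).
    pose proof (atan_add_inv X0 lo ltac:(nra) P0). pose proof (atan_add_inv X0 up ltac:(nra) P0).
    lra.
Qed.

Lemma on_boundary_dist (p : R) : x0 < p < x1 -> exists d, 0 < d /\ forall s, bd s -> d <= Cmod (s - RtoC p).
Proof.
  intro Hp. exists (Rmin (Rmin (p - x0) (x1 - p)) (Rmin lo up)).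
  pose proof (Rmin_l (Rmin (p - x0) (x1 - p)) (Rmin lo up)).
  pose proof (Rmin_r (Rmin (p - x0) (x1 - p)) (Rmin lo up)).
  pose proof (Rmin_l (p - x0) (x1 - p)). pose proof (Rmin_r (p - x0) (x1 - p)).
  pose proof (Rmin_l lo up). pose proof (Rmin_r lo up).
  split; [repeat apply Rmin_pos; lra|]. intros s [_ Hs].
  assert (A : Rabs (Re s - p) <= Cmod (s - RtoC p)) by apply (re_le_Cmod (s - RtoC p)).
  assert (B : Rabs (Im s) <= Cmod (s - RtoC p)).
  { replace (Im s) with (Im (s - RtoC p)) by (simpl; unfold Im; ring). apply im_le_Cmod. }
  pose proof (Rle_abs (Re s - p)). pose proof (Rle_abs (- (Re s - p))) as Q.
  pose proof (Rle_abs (Im s)). pose proof (Rle_abs (- Im s)) as Q'.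
  rewrite Rabs_Ropp in Q, Q'. lra.
Qed.

(* For polynomials [phi s = phi p + (s - p) q s] and [q] has a primitive; the
   general case follows by uniform approximation. *)
Lemma cauchy_formula (phi : C -> C) (p : R) : x0 < p < x1 -> approx (on_rect x0 x1 lo up) phi ->
  rint (fun s => phi s / (s - RtoC p))%C (2 * RtoC PI * Ci * phi (RtoC p))%C.
Proof.
  intros Hp Hphi. destruct (on_boundary_dist p Hp) as [d [Hd Hbd]].
  assert (N : forall s, bd s -> (s - RtoC p)%C <> 0).
  { intros s Hs. apply Cmod_gt_0. specialize (Hbd s Hs). lra. }
  assert (Poly : forall l, rint (fun s => peval l s / (s - RtoC p))%C
     (2 * RtoC PI * Ci * peval l (RtoC p))%C).
  { intro l. destruct (peval_factor l (RtoC p)) as [q Hq].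
    apply is_rect_int_ext with (fun s => peval l (RtoC p) * / (s - RtoC p) + peval q s)%C.
    - intros s Hs. rewrite (Hq s). field. now apply N.
    - replace (2 * RtoC PI * Ci * peval l (RtoC p))%C with
        (peval l (RtoC p) * (2 * RtoC PI * Ci) + 0)%C by ring.
      apply is_rect_int_plus; [|apply is_rect_int_peval].
      now apply is_rect_int_mult_l, is_rect_int_inv. }
  assert (Pos : forall n, 0 < / INR (S n)) by (intro n; apply Rinv_0_lt_compat, lt_0_INR; lia).
  destruct (functional_choice (fun n l => forall s, on_rect x0 x1 lo up s ->
     Cmod (phi s - peval l s) <= / INR (S n))) as [l Hl].
  { intro n. apply Hphi, Pos. }
  assert (L0 : is_lim_seq (fun n => / INR (S n)) 0).
  { apply (is_lim_seq_incr_1 (fun n => / INR n)). apply is_lim_seq_inv_INR. }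
  destruct (is_rect_int_limit (fun n s => peval (l n) s / (s - RtoC p))%C
     (fun s => phi s / (s - RtoC p))%C (fun n => 2 * RtoC PI * Ci * peval (l n) (RtoC p))%C
     (fun n => / INR (S n) * / d)) as [J [HJ1 HJ2]].
  - intro n. apply Poly.
  - intros n s Hs. replace (_ - _)%C with (- (phi s - peval (l n) s) * / (s - RtoC p))%C
      by (field; now apply N).
    rewrite Cmod_mult, Cmod_opp, Cmod_inv by now apply N.
    apply Rmult_le_compat; [apply Cmod_ge_0| |apply Hl, Hs|].
    + left. apply Rinv_0_lt_compat. specialize (Hbd s Hs). lra.
    + apply Rinv_le_contravar; auto.
  - replace (Finite 0) with (Finite (0 * / d)) by (f_equal; ring).
    apply is_lim_seq_mult'; auto. apply is_lim_seq_const.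
  - replace (2 * RtoC PI * Ci * phi (RtoC p))%C with J; auto.
    eapply Clim_unique; [exact HJ1|]. apply Clim_mult; [apply Clim_const|].
    apply Clim_le with (fun n => / INR (S n)); auto. intro n.
    rewrite Cmod_minus_sym. apply Hl. unfold on_rect. simpl. lra.
Qed.

End Rect.

(** * Residues on a loop *)

(** Cauchy's criterion: the integral of [f] between [t] and [t'] is at most [G t' - G t], and [G]
    converges along [Fa]. The filter is general because the lemma is used both at minus infinity,
    for the loops, and at 0 from the right, for the kernels. *)
Lemma ex_RInt_gen_dominated {V : CompleteNormedModule R_AbsRing} (f : R -> V) (g G : R -> R)
    (Fa : (R -> Prop) -> Prop) (D : R -> Prop) (b lim : R) :
  ProperFilter Fa -> Fa D -> (forall t, D t -> ex_RInt f t b) ->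
  (forall t t', D t -> D t' -> t <= t' ->
     (forall s, t <= s <= t' -> norm (f s) <= g s) /\ is_RInt g t t' (G t' - G t)) ->
  filterlim G Fa (locally lim) ->
  exists l, is_RInt_gen f Fa (at_point b) l /\ filterlim (fun t => RInt f t b) Fa (locally l).
Proof.
  intros FFa HD Hex Hdom HG.
  assert (Hn : forall t t', D t -> D t' -> t <= t' ->
     norm (minus (RInt f t b) (RInt f t' b)) <= Rabs (G t' - G t)).
  { intros t t' Ht Ht' Htt. destruct (Hdom t t' Ht Ht' Htt) as [H1 H2].
    assert (E : ex_RInt f t t').
    { apply ex_RInt_Chasles with b; auto. now apply ex_RInt_swap, Hex. }
    rewrite <- (RInt_Chasles f t t' b) by auto.
    assert (Em : forall u v : V, minus (plus u v) v = u).
    { intros u v. transitivity (plus u (plus v (opp v))); [symmetry; apply plus_assoc|].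
      transitivity (plus u zero); [|apply plus_zero_r].
      apply (f_equal (plus u)). exact (plus_opp_r v). }
    rewrite Em.
    eapply Rle_trans; [|apply Rle_abs].
    apply (norm_RInt_le f g t t' (RInt f t t') (G t' - G t) Htt H1); auto.
    now apply (RInt_correct f). }
  destruct (proj1 (filterlim_locally_cauchy (F := Fa) (fun t => RInt f t b))) as [l Hl].
  - intro eps.
    destruct (proj2 (filterlim_locally_cauchy (F := Fa) G) (ex_intro _ lim HG) eps) as [Q [HQ1 HQ2]].
    exists (fun t => D t /\ Q t). split; [now apply filter_and|].
    intros u v [Du Qu] [Dv Qv]. apply (norm_compat1 (V := V) (RInt f u b) (RInt f v b) eps).
    specialize (HQ2 u v Qu Qv). unfold ball in HQ2; simpl in HQ2.
    unfold AbsRing_ball, abs, minus, plus, opp in HQ2; simpl in HQ2.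
    destruct (Rle_dec u v) as [H|H].
    + rewrite <- norm_opp, opp_minus.
      eapply Rle_lt_trans; [apply Hn; auto|]. exact HQ2.
    + eapply Rle_lt_trans; [apply Hn; auto; lra|]. rewrite Rabs_minus_sym. exact HQ2.
  - exists l. split; auto. intros Q HQ.
    apply Filter_prod with (fun t => D t /\ Q (RInt f t b)) (fun b' => b' = b).
    + apply filter_and; auto. now apply Hl.
    + reflexivity.
    + intros t b' [Dt Qt] ->. exists (RInt f t b). split; auto. simpl.
      now apply RInt_correct, Hex.
Qed.

Lemma is_rect_int_Chasles (f : C -> C) (a b c lo up : R) (I J : C) :
  is_rect_int f a b lo up I -> is_rect_int f b c lo up J -> is_rect_int f a c lo up (I + J)%C.
Proof.
  intros (bo & r & t & l & [B R T L] & ->) (bo' & r' & t' & l' & [B' R' T' L'] & ->).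
  assert (E : r = l').
  { rewrite <- (is_RInt_unique (V := C_R_CompleteNormedModule) _ _ _ _ R).
    exact (is_RInt_unique (V := C_R_CompleteNormedModule) _ _ _ _ L'). }
  exists (bo + bo')%C, r', (t + t')%C, l. split; [|rewrite E; ring].
  split; [|exact R'| |exact L].
  - exact (is_RInt_Chasles (V := C_R_NormedModule) _ a b c bo bo' B B').
  - exact (is_RInt_Chasles (V := C_R_NormedModule) _ a b c t t' T T').
Qed.

(** The limit is stated along sequences because the rectangles end at abscissas chosen between the
    poles. *)
Lemma horizontal_limit (h : R -> C) (c B T0 : R) : T0 <= c ->
  (forall t, t <= c -> ex_CInt h t c) -> (forall t, t <= T0 -> Cmod (h t) <= B * exp t) ->
  exists l, RInt_gen (V := C_R_CompleteNormedModule) h (Rbar_locally m_infty) (at_point c) = l /\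
    forall x : nat -> R, filterlim x eventually (Rbar_locally m_infty) ->
      Clim (fun n => CInt h (x n) c) l.
Proof.
  intros HT Hex Hb.
  destruct (ex_RInt_gen_dominated (V := C_R_CompleteNormedModule) h (fun t => B * exp t)
     (fun t => B * exp t) (Rbar_locally m_infty) (fun t => t < T0) c 0) as [l [H1 H2]].
  - apply Rbar_locally_filter.
  - exists T0. auto.
  - intros t Ht. apply Hex. lra.
  - intros t t' Ht Ht' Htt. split.
    + intros s Hs. change (norm (V := C_R_NormedModule) (h s) <= B * exp s).
      rewrite norm_C_R. apply Hb. lra.
    + apply (is_RInt_derive (fun t => B * exp t) (fun t => B * exp t)).
      * intros z _. auto_derive; auto. ring.
      * intros z _. apply (ex_derive_continuous (V := R_NormedModule)). auto_derive. auto.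
  - replace 0 with (B * 0) by ring.
    apply (filterlim_comp _ _ _ exp (fun t => B * t) _ (locally 0)).
    + apply is_lim_exp_m.
    + apply (continuous_scal_r B (fun t => t) 0). apply continuous_id.
  - exists l. split.
    + apply (is_RInt_gen_unique (V := C_R_CompleteNormedModule)); auto.
    + intros x Hx. apply filterlim_Clim.
      exact (filterlim_comp _ _ _ x (fun t => CInt h t c) _ _ _ Hx H2).
Qed.

Lemma two_PI_Ci_nonzero : (2 * RtoC PI * Ci)%C <> 0.
Proof.
  apply Cmult_neq_0; [apply Cmult_neq_0|].
  - apply RtoC_nonzero; lra.
  - apply RtoC_nonzero, PI_neq0.
  - intro E. injection E. lra.
Qed.

(** The region inside the loop is cut at the abscissas [x n], and each piece contains one pole
    [P n], to which Cauchy's formula applies. Far to the left the last vertical side contributes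
    [O(exp (x n))]. Convergence of the residue series is part of the conclusion, since its partial
    sums are integrals that converge. *)
Lemma loop_integral_residues (L : loop) (F : C -> C) (phi : nat -> C -> C) (P x r : nat -> R)
    (c : C) (B T0 : R) :
  c <> 0 -> x 0%nat = loop_re L -> (forall n, x (S n) < P n < x n) ->
  filterlim x eventually (Rbar_locally m_infty) ->
  (forall n, approx (on_rect (x (S n)) (x n) (loop_low L) (loop_up L)) (phi n)) ->
  (forall n s, on_boundary (x (S n)) (x n) (loop_low L) (loop_up L) s ->
     F s = (phi n s / (s - RtoC (P n)))%C) ->
  (forall n, phi n (RtoC (P n)) = (c * RtoC (r n))%C) ->
  T0 <= loop_re L ->
  (forall t, t <= T0 -> Cmod (F (t, - loop_low L)) <= B * exp t) ->
  (forall t, t <= T0 -> Cmod (F (t, pos (loop_up L))) <= B * exp t) ->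
  (forall n y, - loop_low L <= y <= loop_up L -> Cmod (F (x (S n), y)) <= B * exp (x (S n))) ->
  ex_series r /\ (/ (2 * RtoC PI * Ci) * loop_integral L F)%C = (c * RtoC (Series r))%C.
Proof.
  intros Hc Hx0 HP Hx Hphi HF Hr HT Hlow Hup Hver.
  destruct L as [re [lo Hlo] [up Hup']]. simpl in *.
  assert (Rect : forall n, is_rect_int F (x (S n)) re lo up
     (2 * RtoC PI * Ci * (c * RtoC (sum_n r n)))%C).
  { assert (One : forall n, is_rect_int F (x (S n)) (x n) lo up (2 * RtoC PI * Ci * (c * RtoC (r n)))%C).
    { intro n. rewrite <- Hr. specialize (HP n).
      apply is_rect_int_ext with (fun s => phi n s / (s - RtoC (P n)))%C; try lra.
      - intros s Hs. symmetry. now apply HF.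
      - apply cauchy_formula; auto; lra. }
    induction n as [|n IH].
    - rewrite sum_O, <- Hx0. apply One.
    - rewrite sum_Sn. unfold plus; simpl.
      replace (2 * RtoC PI * Ci * (c * RtoC (sum_n r n + r (S n))))%C with
        (2 * RtoC PI * Ci * (c * RtoC (r (S n))) + 2 * RtoC PI * Ci * (c * RtoC (sum_n r n)))%C
        by (rewrite RtoC_plus; ring).
      eapply is_rect_int_Chasles; [apply One|exact IH]. }
  assert (Hmin : forall t, exists n, x (S n) < t).
  { intro t. destruct (Hx (fun y => y < t)) as [N HN]; [exists t; auto|]. exists N. apply HN. lia. }
  assert (Hex : forall (h : R -> C), (forall n, ex_CInt h (x (S n)) re) ->
     forall t, t <= re -> ex_CInt h t re).
  { intros h H t Ht. destruct (Hmin t) as [n Hn].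
    apply (ex_RInt_Chasles_2 (V := C_R_CompleteNormedModule) h (x (S n))); [lra|apply H]. }
  destruct (horizontal_limit (fun t => F (t, - lo)) re B T0) as [l1 [E1 L1]]; auto.
  { apply Hex. intro n. destruct (Rect n) as (b & r' & t & l & [Hb Hr' Ht Hl] & _). now exists b. }
  destruct (horizontal_limit (fun t => F (t, up)) re B T0) as [l2 [E2 L2]]; auto.
  { apply Hex. intro n. destruct (Rect n) as (b & r' & t & l & [Hb Hr' Ht Hl] & _). now exists t. }
  assert (HxS : filterlim (fun n => x (S n)) eventually (Rbar_locally m_infty)).
  { apply filterlim_comp with eventually; [|exact Hx].
    apply eventually_subseq. intro n. lia. }
  set (V := CInt (fun t => F (re, t) * Ci)%C (- lo) up).
  assert (EV : loop_integral (Loop re (mkposreal lo Hlo) (mkposreal up Hup')) F = (l1 + V - l2)%C).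
  { unfold loop_integral; simpl. unfold V. now rewrite E1, E2. }
  rewrite EV.
  (* The boundary integral of the first [n + 1] rectangles tends to the loop integral: the
     horizontal sides converge, the right side is constant and the left side tends to 0. *)
  assert (Lim : Clim (fun n => 2 * RtoC PI * Ci * (c * RtoC (sum_n r n)))%C (l1 + V - l2)%C).
  { set (left := fun n => CInt (fun y => F (x (S n), y) * Ci)%C (- lo)%R up).
    apply Clim_ext with (fun n => CInt (fun t => F (t, (- lo)%R)) (x (S n)) re + V
       + - (1) * CInt (fun t => F (t, up)) (x (S n)) re + - (1) * left n)%C.
    { intro n. destruct (Rect n) as (b & r' & t & l & [Hb Hr' Ht Hl] & ->). unfold V, left.
      rewrite (is_RInt_unique (V := C_R_CompleteNormedModule) _ _ _ _ Hb).
      rewrite (is_RInt_unique (V := C_R_CompleteNormedModule) _ _ _ _ Hr').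
      rewrite (is_RInt_unique (V := C_R_CompleteNormedModule) _ _ _ _ Ht).
      rewrite (is_RInt_unique (V := C_R_CompleteNormedModule) _ _ _ _ Hl). ring. }
    replace (l1 + V - l2)%C with (l1 + V + - (1) * l2 + - (1) * 0)%C by ring.
    apply Clim_plus; [apply Clim_plus; [apply Clim_plus|]|].
    - now apply L1.
    - apply Clim_const.
    - apply Clim_mult; [apply Clim_const|]. now apply L2.
    - apply Clim_mult; [apply Clim_const|].
      apply Clim_le with (fun n => (up - - lo) * (B * exp (x (S n)))).
      + intro n. destruct (Rect n) as (b & r' & t & l & [Hb Hr' Ht Hl] & _). unfold left.
        rewrite (is_RInt_unique (V := C_R_CompleteNormedModule) _ _ _ _ Hl).
        replace (l - 0)%C with l by ring.
        apply (is_CInt_bound (fun y => F (x (S n), y) * Ci)%C (- lo)%R up); auto; [lra|].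
        intros y Hy. rewrite Cmod_mult, Cmod_Ci, Rmult_1_r. now apply Hver.
      + replace (Finite 0) with (Finite ((up - - lo) * (B * 0))) by (f_equal; ring).
        apply is_lim_seq_mult'; [apply is_lim_seq_const|].
        apply is_lim_seq_mult'; [apply is_lim_seq_const|].
        exact (filterlim_comp _ _ _ _ exp _ _ _ HxS is_lim_exp_m). }
  assert (N := two_PI_Ci_nonzero).
  assert (Lim2 : Clim (fun n => RtoC (sum_n r n)) (/ c * (/ (2 * RtoC PI * Ci) * (l1 + V - l2)))%C).
  { apply Clim_ext with (fun n => / c * (/ (2 * RtoC PI * Ci) *
       (2 * RtoC PI * Ci * (c * RtoC (sum_n r n)))))%C.
    { intro n. transitivity (/ c * c * ((/ (2 * RtoC PI * Ci) * (2 * RtoC PI * Ci)) * RtoC (sum_n r n)))%C;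
        [ring|]. rewrite !Cinv_l by auto. ring. }
    apply Clim_mult; [apply Clim_const|]. apply Clim_mult; [apply Clim_const|exact Lim]. }
  set (v := (/ (2 * RtoC PI * Ci) * (l1 + V - l2))%C) in *.
  assert (S1 : is_series r (Re (/ c * v))).
  { apply (Clim_Re _ _ Lim2). }
  (* The partial sums are real, so their complex limit is the sum of a real series. *)
  assert (I1 : Im (/ c * v) = 0).
  { apply Clim_Im in Lim2. apply is_lim_seq_unique in Lim2. simpl in Lim2.
    rewrite Lim_seq_const in Lim2. now injection Lim2. }
  split; [now exists (Re (/ c * v))|].
  rewrite (is_series_unique _ _ S1).
  replace (RtoC (Re (/ c * v))) with (/ c * v)%C.
  - field. auto.
  - apply injective_projections; simpl; auto.
Qed.

(** * Loop integrals of Gamma quotients *)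

Definition C_box (a b Y : R) (s : C) : Prop := a <= Re s <= b /\ Rabs (Im s) <= Y.

Lemma bounded_C_box (a b Y : R) : bounded_set (C_box a b Y).
Proof.
  exists (Rabs a + Rabs b + Y). intros s [H1 H2]. eapply Rle_trans; [apply Cmod_le_Re_Im|].
  assert (Rabs (Re s) <= Rabs a + Rabs b); [|lra].
  pose proof (Rle_abs b). pose proof (Rle_abs (- a)). rewrite Rabs_Ropp in H0.
  pose proof (Rabs_pos a). pose proof (Rabs_pos b). apply Rabs_le. lra.
Qed.

Lemma bounded_on_rect (x0 x1 lo up : R) : bounded_set (on_rect x0 x1 lo up).
Proof.
  destruct (bounded_C_box x0 x1 (Rabs lo + Rabs up)) as [r Hr]. exists r. intros s [H1 H2].
  apply Hr. split; auto. pose proof (Rle_abs lo). pose proof (Rle_abs up).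
  pose proof (Rabs_pos lo). pose proof (Rabs_pos up). apply Rabs_le. lra.
Qed.

(** * Growth of Gamma and of its reciprocal in a horizontal strip *)

Lemma poch_ge_1 (w : C) (n : nat) : Re w + INR n <= 0 -> 1 <= Cmod (poch w n).
Proof.
  induction n as [|n IH]; intro H; [simpl; rewrite Cmod_1; lra|].
  rewrite S_INR in H. simpl. rewrite Cmod_mult.
  assert (1 <= Cmod (poch w n)) by (apply IH; lra).
  assert (1 <= Cmod (w + RtoC (INR n))); [|nra].
  pose proof (re_le_Cmod (w + RtoC (INR n))) as A.
  replace (Re (w + RtoC (INR n))) with (Re w + INR n) in A by (destruct w; reflexivity).
  rewrite Rabs_left1 in A by lra. lra.
Qed.

Lemma Re_add_INR (w : C) (n : nat) : Re (w + RtoC (INR n)) = Re w + INR n.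
Proof. now destruct w. Qed.

Lemma Im_add_RtoC (w : C) (x : R) : Im (w + RtoC x) = Im w.
Proof. destruct w; simpl; unfold Im; simpl; ring. Qed.

(* Going left by integer steps only decreases [Gamma], as [Gamma(w-1) = Gamma(w)/(w-1)]. *)
Lemma inv_rgamma_left_bound (Y d : R) : 0 < d -> exists B, 0 <= B /\ forall w,
  Re w <= 0 -> Rabs (Im w) <= Y -> (forall k : nat, d <= Cmod (w + RtoC (INR k))) ->
  Cmod (/ rgamma w) <= B.
Proof.
  intro Hd.
  destruct (approx_bounded (C_box 1 2 Y) (fun s => / rgamma s)%C) as [B [HB HBb]].
  { apply bounded_C_box. }
  { apply approx_inv_rgamma with 1; [apply bounded_C_box|lra|apply approx_id|].
    intros s [H _]. lra. }
  exists (/ d * / d * B). split.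
  { assert (0 < / d) by now apply Rinv_0_lt_compat. nra. }
  intros w Hre Him Hk.
  (* With this [m] the point [w + m + 2] lies in the strip [1 <= Re <= 2]. Of the factors passed on
     the way only [w + m] and [w + m + 1] can be small, which explains [/ d * / d]. *)
  destruct (nfloor_ex (- Re w)) as [m [Hm1 Hm2]]; [lra|].
  rewrite (rgamma_poch w (m + 2)), poch_add, !Cinv_mult, !Cmod_mult.
  rewrite plus_INR. change (INR 2) with 2. simpl poch.
  assert (N : forall k : nat, (w + RtoC (INR k))%C <> 0).
  { intro k. apply Cmod_gt_0. specialize (Hk k). lra. }
  assert (I : forall k : nat, 0 <= Cmod (/ (w + RtoC (INR k))) <= / d).
  { intro k. rewrite Cmod_inv by auto. split.
    - left. apply Rinv_0_lt_compat. specialize (Hk k). lra.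
    - apply Rinv_le_contravar; auto. }
  assert (A1 : 0 <= Cmod (/ poch w m) <= 1).
  { split; [apply Cmod_ge_0|].
    assert (1 <= Cmod (poch w m)) by (apply poch_ge_1; lra).
    rewrite Cmod_inv by (apply Cmod_gt_0; lra). rewrite <- Rinv_1. apply Rinv_le_contravar; lra. }
  assert (A2 : Cmod (/ rgamma (w + RtoC (INR m + 2))) <= B).
  { apply HBb. split.
    - replace (Re _) with (Re w + (INR m + 2)) by (destruct w; reflexivity). lra.
    - now rewrite Im_add_RtoC. }
  replace (1 * (w + RtoC (INR m) + RtoC 0))%C with (w + RtoC (INR m))%C by ring.
  replace (w + RtoC (INR m) + RtoC 1)%C with (w + RtoC (INR (S m)))%C
    by (rewrite S_INR, RtoC_plus; ring).
  rewrite Cinv_mult, Cmod_mult.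
  pose proof (I m) as I1. pose proof (I (S m)) as I2.
  pose proof (Cmod_ge_0 (/ rgamma (w + RtoC (INR m + 2)))).
  rewrite <- (Rmult_1_l (/ d * / d)).
  repeat apply Rmult_le_compat; try lra; try apply Rmult_le_pos; try apply Rmult_le_pos; lra.
Qed.

(** Since [rgamma (u + 1) = rgamma u / u], every unit step to the right of [V >= exp k] gains at
    least a factor [exp (- k)]. On the bounded part left of [V + 1] the constant [exp m] makes up
    for the exponential. *)
Lemma rgamma_decay (k Y v0 : R) : exists B, 0 <= B /\ forall v,
  v0 <= Re v -> Rabs (Im v) <= Y -> Cmod (rgamma v) <= B * exp (- (k * Re v)).
Proof.
  set (V := Rmax v0 (exp k)). assert (HV1 := Rmax_l v0 (exp k)). assert (HV2 := Rmax_r v0 (exp k)).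
  fold V in HV1, HV2.
  destruct (approx_bounded (C_box v0 (V + 1) Y) rgamma) as [B [HB HBb]].
  { apply bounded_C_box. } { apply approx_rgamma; [apply bounded_C_box|apply approx_id]. }
  set (m := Rabs k * (Rabs v0 + Rabs (V + 1))).
  exists (B * exp m). split; [pose proof (exp_pos m); nra|].
  assert (Base : forall v, v0 <= Re v <= V + 1 -> Rabs (Im v) <= Y ->
     Cmod (rgamma v) <= B * exp m * exp (- (k * Re v))).
  { intros v Hv Hi. rewrite Rmult_assoc, <- exp_plus.
    rewrite <- (Rmult_1_r (Cmod _)). apply Rmult_le_compat; try lra; [apply Cmod_ge_0|now apply HBb|].
    rewrite <- exp_0. apply exp_le_compat.
    assert (k * Re v <= m); [|lra]. eapply Rle_trans; [apply Rle_abs|].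
    rewrite Rabs_mult. apply Rmult_le_compat_l; [apply Rabs_pos|].
    pose proof (Rle_abs (V + 1)). pose proof (Rle_abs (- v0)) as Q. rewrite Rabs_Ropp in Q.
    pose proof (Rabs_pos v0). pose proof (Rabs_pos (V + 1)). apply Rabs_le. lra. }
  assert (Step : forall n v, V <= Re v <= V + 1 -> Rabs (Im v) <= Y ->
     Cmod (rgamma (v + RtoC (INR n))) <= B * exp m * exp (- (k * (Re v + INR n)))).
  { induction n as [|n IH]; intros v Hv Hi.
    - simpl. rewrite Cplus_0_r, Rplus_0_r. apply Base; lra.
    - specialize (IH v Hv Hi). set (u := (v + RtoC (INR n))%C) in *.
      pose proof (pos_INR n) as Pn. pose proof (exp_pos k) as Pk.
      assert (Hu : exp k <= Cmod u).
      { eapply Rle_trans; [|apply Re_le_Cmod]. unfold u. rewrite Re_add_INR. lra. }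
      replace (v + RtoC (INR (S n)))%C with (u + 1)%C by (unfold u; rewrite S_INR, RtoC_plus; ring).
      rewrite (rgamma_shift u), Cmod_mult in IH.
      replace (- (k * (Re v + INR (S n)))) with (- (k * (Re v + INR n)) + - k)
        by (rewrite S_INR; ring).
      rewrite exp_plus, (exp_Ropp k).
      pose proof (Cmod_ge_0 (rgamma (u + 1))).
      apply Rmult_le_reg_l with (exp k); auto.
      replace (exp k * (B * exp m * (exp (- (k * (Re v + INR n))) * / exp k))) with
        (B * exp m * exp (- (k * (Re v + INR n)))) by (field; lra).
      eapply Rle_trans; [|exact IH]. apply Rmult_le_compat_r; auto. }
  intros v Hv Hi. destruct (Rle_dec (Re v) (V + 1)) as [H|H]; [apply Base; auto; lra|].
  destruct (nfloor_ex (Re v - V)) as [n [Hn1 Hn2]]; [lra|].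
  specialize (Step n (v - RtoC (INR n))%C).
  replace (v - RtoC (INR n) + RtoC (INR n))%C with v in Step by ring.
  replace (Re (v - RtoC (INR n))) with (Re v - INR n) in Step by (destruct v; reflexivity).
  replace (Re v - INR n + INR n) with (Re v) in Step by ring.
  apply Step; [lra|]. unfold Cminus. rewrite <- RtoC_opp, Im_add_RtoC. auto.
Qed.

(** The origin of the factor [(-1)^n / n!] in the residues. *)
Lemma poch_neg (n : nat) : poch (RtoC (- INR n)) n = RtoC ((-1) ^ n * INR (fact n)).
Proof.
  induction n as [|n IH]; [simpl; f_equal; ring|].
  change (S n) with (1 + n)%nat at 2. rewrite poch_add.
  replace (RtoC (- INR (S n)) + RtoC (INR 1))%C with (RtoC (- INR n)).
  - rewrite IH. simpl poch. change (fact (S n)) with (S n * fact n)%nat.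
    rewrite mult_INR. simpl pow. rewrite !RtoC_mult, RtoC_opp. simpl INR. ring.
  - rewrite <- RtoC_plus. f_equal. rewrite S_INR. simpl. ring.
Qed.

Section GammaLoop.
Variables (p b beta a kappa : R) (c : C) (L : loop).
Hypothesis (Hp : 0 < p) (Hb : 0 < b) (Hc : c <> 0) (HL : - beta < loop_re L).

(* By the multiplication formula both Meijer integrands have this form. *)
Definition gamma_integrand (s : C) : C :=
  (c * (/ rgamma (RtoC p * (s + RtoC beta))
        * (Cexp (RtoC kappa * s) * rgamma (RtoC a - RtoC b * s))))%C.
Definition gamma_pole (n : nat) : R := - beta - INR n / p.
(** Midpoints between consecutive poles, preceded by the right side of the loop. At a midpoint
    [p (s + beta)] has real part [-(m + 1/2)], at distance at least [1/2] from every integer. *)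
Definition gamma_sep (n : nat) : R :=
  match n with O => loop_re L | S m => - beta - (INR m + / 2) / p end.
Definition gamma_residue (n : nat) : R :=
  / p * ((-1) ^ n * / INR (fact n)) * (exp (kappa * gamma_pole n) * / RGamma (a - b * gamma_pole n)).
(** The integrand times [s - gamma_pole n]. Shifting the argument of Gamma by [n + 1] displays the
    singular factor, so that the value at the pole is obtained without a limit. *)
Definition gamma_regular (n : nat) (s : C) : C :=
  (c * (RtoC (/ p) * (/ poch (RtoC p * (s + RtoC beta)) n
     * / rgamma (RtoC p * (s + RtoC beta) + RtoC (INR (S n))))
        * (Cexp (RtoC kappa * s) * rgamma (RtoC a - RtoC b * s))))%C.

(** Holds at the pole as well, where both sides are 0, because [Cinv_mult] is valid for vanishing
    factors. *)
Lemma gamma_integrand_eq (n : nat) (s : C) : gamma_integrand s = (gamma_regular n s / (s - RtoC (gamma_pole n)))%C.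
Proof.
  unfold gamma_integrand, gamma_regular. set (w := (RtoC p * (s + RtoC beta))%C).
  rewrite (rgamma_poch w (S n)). cbn [poch].
  replace (w + RtoC (INR n))%C with (RtoC p * (s - RtoC (gamma_pole n)))%C.
  2: { unfold w, gamma_pole. rewrite RtoC_minus, RtoC_opp, RtoC_div by lra. field. apply RtoC_nonzero; lra. }
  rewrite !Cinv_mult, RtoC_inv by lra. unfold Cdiv. ring.
Qed.

Lemma gamma_regular_pole (n : nat) : gamma_regular n (RtoC (gamma_pole n)) = (c * RtoC (gamma_residue n))%C.
Proof.
  unfold gamma_regular. f_equal.
  replace (RtoC p * (RtoC (gamma_pole n) + RtoC beta))%C with (RtoC (- INR n)).
  2: { unfold gamma_pole. rewrite <- RtoC_plus, <- RtoC_mult. f_equal. field. lra. }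
  rewrite <- RtoC_plus. replace (- INR n + INR (S n)) with 1 by (rewrite S_INR; ring).
  rewrite rgamma_1, poch_neg, <- !RtoC_mult, Cexp_RtoC, <- RtoC_minus, rgamma_RtoC.
  assert (N : (-1) ^ n * INR (fact n) <> 0).
  { apply Rmult_integral_contrapositive. split; [apply pow_nonzero; lra|apply INR_fact_neq_0]. }
  rewrite <- !RtoC_inv by (auto; lra). rewrite <- !RtoC_mult. f_equal. unfold gamma_residue.
  assert (E : / ((-1) ^ n * INR (fact n)) = (-1) ^ n * / INR (fact n)).
  { rewrite Rinv_mult. f_equal. rewrite <- pow_inv. f_equal. field. }
  rewrite E, Rinv_1. ring.
Qed.

(** On the rectangle of index [n] the real part of [p (s + beta)] is at least [-(n + 1/2)] and, for
    [0 < n], at most [-(n - 1/2)]. Hence the shifted argument of Gamma has real part at least [1/2],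
    and each factor of [poch] has real part at most [-1/2]: both reciprocals are covered. *)
Lemma gamma_regular_approx (n : nat) :
  approx (on_rect (gamma_sep (S n)) (gamma_sep n) (loop_low L) (loop_up L)) (gamma_regular n).
Proof.
  set (K := on_rect _ _ _ _). assert (HK : bounded_set K) by apply bounded_on_rect.
  assert (Aw : approx K (fun s => RtoC p * (s + RtoC beta))%C).
  { apply approx_mult; auto; [apply approx_const|].
    apply approx_plus; [apply approx_id|apply approx_const]. }
  assert (Rw : forall s, Re (RtoC p * (s + RtoC beta)) = p * (Re s + beta)).
  { intros [u v]. simpl. ring. }
  unfold gamma_regular. apply approx_mult; [auto|apply approx_const|]. apply approx_mult; auto.
  - apply approx_mult; [auto|apply approx_const|]. apply approx_mult; auto.
    + apply approx_ext with (fun s => Cprod (fun j => / (RtoC p * (s + RtoC beta) + RtoC (INR j - 1))) n)%C.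
      { intros s _. now rewrite poch_Cprod, Cprod_inv. }
      apply approx_Cprod; auto. intros j Hj. apply approx_inv_neg with (/ 2); auto; [lra| |].
      * apply approx_plus; auto. apply approx_const.
      * intros s [[_ Hs] _].
        replace (Re _) with (p * (Re s + beta) + (INR j - 1)) by (destruct s; simpl; ring).
        destruct n as [|m]; [lia|]. simpl in Hs.
        assert (Re s + beta <= - (INR m + / 2) / p) by (unfold Rdiv in *; lra).
        assert (p * (Re s + beta) <= p * (- (INR m + / 2) / p)) by (apply Rmult_le_compat_l; lra).
        replace (p * (- (INR m + / 2) / p)) with (- (INR m + / 2)) in H0 by (field; lra).
        assert (INR j <= INR (S m)) by (apply le_INR; lia). rewrite S_INR in H1. lra.
    + apply approx_inv_rgamma with (/ 2); auto; [lra| |].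
      * apply approx_plus; auto. apply approx_const.
      * intros s [[Hs _] _]. rewrite Re_add_INR, Rw, S_INR. simpl in Hs.
        assert (- (INR n + / 2) / p <= Re s + beta) by (unfold Rdiv in *; lra).
        assert (p * (- (INR n + / 2) / p) <= p * (Re s + beta)) by (apply Rmult_le_compat_l; lra).
        replace (p * (- (INR n + / 2) / p)) with (- (INR n + / 2)) in H0 by (field; lra). lra.
  - apply approx_mult; auto.
    + apply approx_Cexp; auto. apply approx_mult; auto; [apply approx_const|apply approx_id].
    + apply approx_rgamma; auto. apply approx_plus; [apply approx_const|].
      apply approx_opp, approx_mult; auto; [apply approx_const|apply approx_id].
Qed.

Lemma gamma_integrand_bound (Y d : R) : 0 < d -> exists B, 0 <= B /\ forall s,
  Re s <= - beta -> Rabs (Im s) <= Y ->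
  (forall k : nat, d <= Cmod (RtoC p * (s + RtoC beta) + RtoC (INR k))) ->
  Cmod (gamma_integrand s) <= B * exp (Re s).
Proof.
  intro Hd. destruct (inv_rgamma_left_bound (p * Y) d Hd) as [B1 [HB1 H1]].
  (* This decay rate gives [kappa + k b = 1], so that the product of the exponentials is a constant
     times [exp (Re s)]. *)
  set (k := (1 - kappa) / b).
  destruct (rgamma_decay k (b * Y) (a + b * beta)) as [B2 [HB2 H2]].
  pose proof (exp_pos (- (k * a))) as Pa. pose proof (Cmod_ge_0 c) as Pc.
  exists (Cmod c * (B1 * (B2 * exp (- (k * a))))). split.
  { repeat apply Rmult_le_pos; lra. }
  intros s Hre Him Hk. unfold gamma_integrand. rewrite !Cmod_mult, Cmod_Cexp.
  assert (ReE : Re (RtoC kappa * s) = kappa * Re s) by (destruct s; simpl; ring).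
  assert (G1 : Cmod (/ rgamma (RtoC p * (s + RtoC beta))) <= B1).
  { apply H1; auto.
    - replace (Re _) with (p * (Re s + beta)) by (destruct s; simpl; ring). nra.
    - replace (Im _) with (p * Im s) by (destruct s; simpl; ring).
      rewrite Rabs_mult, (Rabs_right p) by lra. apply Rmult_le_compat_l; lra. }
  assert (G2 : Cmod (rgamma (RtoC a - RtoC b * s)) <= B2 * exp (- (k * (a - b * Re s)))).
  { replace (a - b * Re s) with (Re (RtoC a - RtoC b * s)) by (destruct s; simpl; ring).
    apply H2.
    - replace (Re (RtoC a - RtoC b * s)) with (a - b * Re s) by (destruct s; simpl; ring).
      assert (b * Re s <= b * - beta) by (apply Rmult_le_compat_l; lra). lra.
    - replace (Im _) with (- (b * Im s)) by (destruct s; simpl; ring).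
      rewrite Rabs_Ropp, Rabs_mult, (Rabs_right b) by lra. apply Rmult_le_compat_l; lra. }
  replace (Cmod c * (B1 * (B2 * exp (- (k * a)))) * exp (Re s)) with
    (Cmod c * (B1 * (exp (kappa * Re s) * (B2 * exp (- (k * (a - b * Re s))))))).
  - rewrite ReE. apply Rmult_le_compat_l; auto.
    pose proof (exp_pos (kappa * Re s)).
    apply Rmult_le_compat; auto; try apply Cmod_ge_0.
    + apply Rmult_le_pos; [lra|apply Cmod_ge_0].
    + apply Rmult_le_compat_l; auto; lra.
  - replace (exp (- (k * (a - b * Re s)))) with
      (exp (- (k * a)) * exp (Re s) * exp (- (kappa * Re s))).
    + rewrite (exp_Ropp (kappa * Re s)). field. apply Rgt_not_eq, exp_pos.
    + rewrite <- !exp_plus. f_equal. unfold k. field. lra.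
Qed.

Lemma gamma_sep_lim : filterlim gamma_sep eventually (Rbar_locally m_infty).
Proof.
  intros Q [M HM]. destruct (INR_unbounded (p * (Rabs (- beta - M)))) as [N HN].
  exists (S N). intros [|n] Hn; [lia|]. apply HM. simpl.
  assert (INR N <= INR n) by (apply le_INR; lia).
  assert (Rabs (- beta - M) < (INR n + / 2) / p).
  { apply Rmult_lt_reg_l with p; auto.
    replace (p * ((INR n + / 2) / p)) with (INR n + / 2) by (field; lra). lra. }
  pose proof (Rle_abs (- beta - M)). lra.
Qed.

Lemma gamma_loop_integral :
  ex_series gamma_residue /\
  (/ (2 * RtoC PI * Ci) * loop_integral L gamma_integrand)%C = (c * RtoC (Series gamma_residue))%C.
Proof.
  destruct L as [re [lo Hlo] [up Hup]] eqn:EL. simpl in HL.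
  set (Y := lo + up).
  (* Distance of [p (s + beta)] from the poles of Gamma: [1/2] on the vertical cuts, [p lo] and
     [p up] on the horizontal sides. *)
  set (d := Rmin (/ 2) (Rmin (p * lo) (p * up))).
  assert (Hd1 := Rmin_l (/ 2) (Rmin (p * lo) (p * up))).
  assert (Hd2 := Rmin_r (/ 2) (Rmin (p * lo) (p * up))).
  assert (Hd3 := Rmin_l (p * lo) (p * up)). assert (Hd4 := Rmin_r (p * lo) (p * up)).
  fold d in Hd1, Hd2.
  assert (P1 : 0 < p * lo) by nra. assert (P2 : 0 < p * up) by nra.
  assert (Hd : 0 < d) by (unfold d; repeat apply Rmin_pos; lra).
  destruct (gamma_integrand_bound Y d Hd) as [B [HB Hbound]].
  assert (Sep : forall n, gamma_sep (S n) < gamma_pole n < gamma_sep n).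
  { intro n. assert (Ip : 0 < / p) by now apply Rinv_0_lt_compat.
    unfold gamma_pole. split.
    - simpl. unfold Rdiv. nra.
    - destruct n as [|m].
      + simpl. rewrite EL. simpl. unfold Rdiv. lra.
      + simpl gamma_sep. rewrite S_INR. unfold Rdiv. nra. }
  rewrite <- EL.
  apply (loop_integral_residues L gamma_integrand gamma_regular gamma_pole gamma_sep gamma_residue c B (- beta)); auto.
  - apply gamma_sep_lim.
  - apply gamma_regular_approx.
  - intros n s _. apply gamma_integrand_eq.
  - apply gamma_regular_pole.
  - rewrite EL. simpl. lra.
  - rewrite EL. simpl. intros t Ht. apply (Hbound (t, - lo)); simpl; auto.
    + rewrite Rabs_Ropp, Rabs_right by lra. unfold Y. lra.
    + intro k. eapply Rle_trans; [|apply im_le_Cmod].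
      replace (Im _) with (- (p * lo)) by (simpl; ring). rewrite Rabs_Ropp, Rabs_right; lra.
  - rewrite EL. simpl. intros t Ht. apply (Hbound (t, up)); simpl; auto.
    + rewrite Rabs_right by lra. unfold Y. lra.
    + intro k. eapply Rle_trans; [|apply im_le_Cmod].
      replace (Im _) with (p * up) by (simpl; ring). rewrite Rabs_right; lra.
  - rewrite EL. intros n y Hy. cbn [loop_low loop_up pos] in Hy.
    assert (Ip : 0 < / p) by now apply Rinv_0_lt_compat.
    apply (Hbound (gamma_sep (S n), y)).
    + simpl. pose proof (pos_INR n). unfold Rdiv. nra.
    + simpl. apply Rabs_le. unfold Y. lra.
    + intro k. eapply Rle_trans; [|apply re_le_Cmod].
      replace (Re _) with (INR k - INR n - / 2) by (simpl; field; lra).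
      eapply Rle_trans; [exact Hd1|].
      destruct (le_lt_dec k n) as [Hk|Hk].
      * apply le_INR in Hk. rewrite Rabs_left1; lra.
      * apply le_INR in Hk. rewrite S_INR in Hk. rewrite Rabs_right; lra.
Qed.

End GammaLoop.

(** * The Meijer G-functions *)

(** The condition [0 < a + b * beta] keeps [rgamma (a - b s)] from vanishing at [- beta], so the
    regular part is nonzero there. This is what makes the admissibility of a loop bear on its right
    side. *)
Lemma gamma_integrand_is_pole (p b beta a kappa : R) (c : C) :
  0 < p -> 0 < b -> c <> 0 -> 0 < a + b * beta ->
  is_pole (gamma_integrand p b beta a kappa c) (RtoC (- beta)).
Proof.
  intros Hp Hb Hc Ha.
  set (f := gamma_integrand p b beta a kappa c). set (phi := gamma_regular p b beta a kappa c 0).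
  (* An auxiliary loop, used to get approximation on a rectangle around [- beta]; that rectangle
     contains the disc of radius [r = min(1, 1/(2p))]. *)
  set (L := Loop (- beta + 1) (mkposreal 1 Rlt_0_1) (mkposreal 1 Rlt_0_1)).
  assert (P0 : gamma_pole p beta 0 = - beta) by (unfold gamma_pole; simpl; field; lra).
  assert (Ap : approx (on_rect (gamma_sep p beta L 1) (gamma_sep p beta L 0) 1 1) phi).
  { apply (gamma_regular_approx p b beta a kappa c L Hp 0). }
  set (r := Rmin 1 (/ 2 / p)).
  assert (Hr1 := Rmin_l 1 (/ 2 / p)). assert (Hr2 := Rmin_r 1 (/ 2 / p)). fold r in Hr1, Hr2.
  assert (Hr : 0 < r).
  { unfold r. apply Rmin_pos; [lra|]. apply Rdiv_lt_0_compat; lra. }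
  assert (Nz : phi (RtoC (- beta)) <> 0).
  { unfold phi, gamma_regular. apply Cmult_neq_0; auto. apply Cmult_neq_0.
    - apply Cmult_neq_0; [apply RtoC_nonzero, Rinv_neq_0_compat; lra|].
      apply Cmult_neq_0; apply Cinv_nonzero.
      + simpl. apply RtoC_nonzero; lra.
      + apply rgamma_nonzero_Re_pos. simpl. lra.
    - apply Cmult_neq_0; [apply Cexp_nonzero|].
      apply rgamma_nonzero_Re_pos. simpl. lra. }
  assert (Pm := proj1 (Cmod_gt_0 _) Nz). set (m := Cmod (phi (RtoC (- beta)))) in *.
  destruct (approx_continuous phi (RtoC (- beta)) r Hr) with (eps := m / 2) as [d [Hd Hphi]]; [|lra|].
  { eapply approx_subset; [|exact Ap]. intros s Hs.
    pose proof (re_le_Cmod (s - RtoC (- beta))) as A. pose proof (im_le_Cmod (s - RtoC (- beta))) as B.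
    replace (Re _) with (Re s + beta) in A by (destruct s; simpl; ring).
    replace (Im _) with (Im s) in B by (destruct s; simpl; ring).
    pose proof (Rle_abs (Re s + beta)). pose proof (Rle_abs (- (Re s + beta))) as Q1.
    pose proof (Rle_abs (Im s)). pose proof (Rle_abs (- Im s)) as Q2.
    rewrite Rabs_Ropp in Q1, Q2. split; simpl; try lra. }
  intros Q [N HN].
  set (N' := Rmax N 1). assert (HN1 := Rmax_l N 1). assert (HN2 := Rmax_r N 1). fold N' in HN1, HN2.
  set (d' := Rmin d (m / (2 * N'))).
  assert (Hd1 := Rmin_l d (m / (2 * N'))). assert (Hd2 := Rmin_r d (m / (2 * N'))). fold d' in Hd1, Hd2.
  assert (Hd' : 0 < d') by (unfold d'; apply Rmin_pos; auto; apply Rdiv_lt_0_compat; lra).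
  (* Neighbourhoods in [C] are squares: two coordinates below [d' / 2] give modulus below [d']. *)
  exists (mkposreal (d' / 2) ltac:(lra)). intros s Hs Hne. apply HN.
  assert (Hs' : Cmod (s - RtoC (- beta)) < d').
  { destruct Hs as [H1 H2]. simpl in H1, H2.
    eapply Rle_lt_trans; [apply Cmod_le_Re_Im|].
    change (Rabs (fst s - - beta) < d' / 2) in H1. change (Rabs (snd s - 0) < d' / 2) in H2.
    replace (Re (s - RtoC (- beta))) with (fst s - - beta) by (destruct s; simpl; ring).
    replace (Im (s - RtoC (- beta))) with (snd s - 0) by (destruct s; simpl; ring). lra. }
  assert (Hn0 : (s - RtoC (- beta))%C <> 0).
  { intro E. apply Hne. change (@eq C s (RtoC (- beta))). replace s with ((s - RtoC (- beta)) + RtoC (- beta))%C by ring.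
    rewrite E. ring. }
  assert (Pn := proj1 (Cmod_gt_0 _) Hn0).
  unfold f. rewrite (gamma_integrand_eq p b beta a kappa c Hp 0), P0. fold phi.
  rewrite Cmod_div by auto.
  assert (m / 2 < Cmod (phi s)).
  { specialize (Hphi s ltac:(lra)). rewrite Cmod_minus_sym in Hphi.
    pose proof (Cmod_sub_ge (phi (RtoC (- beta))) (phi s)). fold m in H. lra. }
  eapply Rle_lt_trans; [exact HN1|].
  apply Rmult_lt_reg_r with (Cmod (s - RtoC (- beta))); auto.
  unfold Rdiv. rewrite Rmult_assoc, Rinv_l, Rmult_1_r by lra.
  eapply Rlt_trans; [|exact H].
  apply Rlt_le_trans with (N' * (m / (2 * N'))).
  - apply Rmult_lt_compat_l; lra.
  - right. field. lra.
Qed.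

Lemma Cpow_pos_neg (z : R) (s : C) : Cpow_pos z (- s) = Cexp (RtoC (- ln z) * s).
Proof. unfold Cpow_pos. f_equal. rewrite RtoC_opp. ring. Qed.

Section Meijer.
Variables (M : nat) (alpha : R) (A : C).
Hypothesis (HM : (1 <= M)%nat) (Ha : -1 < alpha) (HA : A <> 0).
Hypothesis (Hmult : forall w,
  Cprod (fun j => rgamma (w + RtoC ((INR j - 1) / INR M))) M
  = (A * Cexp (RtoC (INR M) * w * RtoC (ln (INR M))) * rgamma (RtoC (INR M) * w))%C).

Definition kernel_nu (j : nat) : R := alpha + (INR j - 1) / INR M.
(** What the multiplication formula leaves once the factor depending on [s] has gone into [kappa].
    [A] enters here directly and in [cM0] inverted, as the product of Gamma functions changes from
    denominator to numerator. *)
Definition c10 : C := (A * Cexp (RtoC (INR M * (1 + alpha) * ln (INR M))))%C.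
Definition cM0 : C := (/ A * Cexp (RtoC (- (INR M * alpha * ln (INR M)))))%C.

Lemma INR_M_ge_1 : 1 <= INR M.
Proof. apply (le_INR 1); auto. Qed.

Lemma c10_nonzero : c10 <> 0.
Proof. apply Cmult_neq_0; auto. apply Cexp_nonzero. Qed.

Lemma cM0_nonzero : cM0 <> 0.
Proof. apply Cmult_neq_0; [now apply Cinv_nonzero|apply Cexp_nonzero]. Qed.

(** The formula is applied at [w = 1 + alpha - s]. The factor [M^(-M s)] it produces joins [z^(-s)],
    which turns [z] into [M^M z]. *)
Lemma meijer_10_integrand_eq (z : R) :
  meijer_10_integrand M kernel_nu z =
  gamma_integrand 1 (INR M) 0 (INR M * (1 + alpha)) (- ln z - INR M * ln (INR M)) c10.
Proof.
  apply functional_extensionality. intro s. unfold meijer_10_integrand, gamma_integrand, Cdiv.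
  rewrite <- Cprod_inv. rewrite (Cprod_ext _ (fun j => rgamma ((1 + RtoC alpha - s)
      + RtoC ((INR j - 1) / INR M))) M).
  2: { intros j _. rewrite inv_CGamma. f_equal. unfold kernel_nu. rewrite RtoC_plus. ring. }
  rewrite Hmult, CGamma_eq_inv_rgamma, Cpow_pos_neg.
  replace (RtoC 1 * (s + RtoC 0))%C with s by ring.
  replace (RtoC (INR M * (1 + alpha)) - RtoC (INR M) * s)%C with
    (RtoC (INR M) * (1 + RtoC alpha - s))%C by (rewrite RtoC_mult, RtoC_plus; ring).
  replace (Cexp (RtoC (INR M) * (1 + RtoC alpha - s) * RtoC (ln (INR M))))%C with
    (Cexp (RtoC (INR M * (1 + alpha) * ln (INR M))) * Cexp (- (RtoC (INR M * ln (INR M)) * s)))%C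
    by (rewrite <- Cexp_plus; f_equal; rewrite !RtoC_mult, RtoC_plus; ring).
  replace (Cexp (RtoC (- ln z - INR M * ln (INR M)) * s))%C with
    (Cexp (RtoC (- ln z) * s) * Cexp (- (RtoC (INR M * ln (INR M)) * s)))%C
    by (rewrite <- Cexp_plus; f_equal; rewrite RtoC_minus; ring).
  unfold c10. ring.
Qed.

Lemma meijer_M0_integrand_eq (z : R) :
  meijer_M0_integrand M kernel_nu z =
  gamma_integrand (INR M) 1 alpha 1 (- ln z - INR M * ln (INR M)) cM0.
Proof.
  apply functional_extensionality. intro s. unfold meijer_M0_integrand, gamma_integrand, Cdiv.
  rewrite inv_CGamma.
  rewrite (Cprod_ext _ (fun j => / rgamma ((s + RtoC alpha) + RtoC ((INR j - 1) / INR M)))%C M).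
  2: { intros j _. rewrite CGamma_eq_inv_rgamma. do 2 f_equal. unfold kernel_nu. rewrite RtoC_plus. ring. }
  rewrite Cprod_inv, Hmult, Cpow_pos_neg, !Cinv_mult.
  replace (1 - RtoC 1 * s)%C with (1 - s)%C by ring.
  rewrite <- Cexp_opp.
  replace (Cexp (- (RtoC (INR M) * (s + RtoC alpha) * RtoC (ln (INR M)))))%C with
    (Cexp (RtoC (- (INR M * alpha * ln (INR M)))) * Cexp (- (RtoC (INR M * ln (INR M)) * s)))%C
    by (rewrite <- Cexp_plus; f_equal; rewrite RtoC_opp, !RtoC_mult; ring).
  replace (Cexp (RtoC (- ln z - INR M * ln (INR M)) * s))%C with
    (Cexp (RtoC (- ln z) * s) * Cexp (- (RtoC (INR M * ln (INR M)) * s)))%C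
    by (rewrite <- Cexp_plus; f_equal; rewrite RtoC_minus; ring).
  unfold cM0. ring.
Qed.

(** Applies admissibility, at [z = 1], to the rightmost pole of each integrand; [-1 < alpha] ensures
    that the reciprocal Gamma function does not cancel it. *)
Lemma admissible_loops_re (L1 L2 : loop) : admissible_loops M kernel_nu L1 L2 ->
  - 0 < loop_re L1 /\ - alpha < loop_re L2.
Proof.
  intro H. destruct (H 1 Rlt_0_1) as [H1 H2]. pose proof INR_M_ge_1. split.
  - apply (H1 (RtoC (- 0))). rewrite meijer_10_integrand_eq.
    apply gamma_integrand_is_pole; try lra; [apply c10_nonzero|]. nra.
  - apply (H2 (RtoC (- alpha))). rewrite meijer_M0_integrand_eq.
    apply gamma_integrand_is_pole; try lra. apply cM0_nonzero.
Qed.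

Lemma exp_mult_INR (x : R) (n : nat) : exp (x * INR n) = exp x ^ n.
Proof.
  rewrite <- (Rpower_pow n) by apply exp_pos. unfold Rpower. rewrite ln_exp. f_equal. ring.
Qed.

Lemma gamma_residue_10 (z : R) (n : nat) : 0 < z ->
  gamma_residue 1 (INR M) 0 (INR M * (1 + alpha)) (- ln z - INR M * ln (INR M)) n
  = (- (INR M ^ M * z)) ^ n / (INR (fact n) * RGamma (INR M * (1 + alpha) + INR n * INR M)).
Proof.
  intro Hz. pose proof INR_M_ge_1. unfold gamma_residue, gamma_pole.
  replace ((- ln z - INR M * ln (INR M)) * (- 0 - INR n / 1)) with
    ((ln z + INR M * ln (INR M)) * INR n) by field.
  replace (INR M * (1 + alpha) - INR M * (- 0 - INR n / 1)) with
    (INR M * (1 + alpha) + INR n * INR M) by field.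
  rewrite exp_mult_INR, exp_plus, exp_ln, (Rmult_comm (INR M) (ln _)), exp_mult_INR, exp_ln by lra.
  replace (- (INR M ^ M * z)) with ((-1) * (z * INR M ^ M)) by ring.
  rewrite !Rpow_mult_distr, Rinv_1. unfold Rdiv. rewrite Rinv_mult. ring.
Qed.

Lemma gamma_residue_M0 (z : R) (n : nat) : 0 < z ->
  gamma_residue (INR M) 1 alpha 1 (- ln z - INR M * ln (INR M)) n
  = (Rpower z alpha * exp (INR M * alpha * ln (INR M)) / INR M) *
    ((- (INR M * Rpower z (/ INR M))) ^ n
       / (INR (fact n) * RGamma (alpha + 1 + INR n * (1 / INR M)))).
Proof.
  intro Hz. pose proof INR_M_ge_1. unfold gamma_residue, gamma_pole.
  replace ((- ln z - INR M * ln (INR M)) * (- alpha - INR n / INR M)) with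
    (alpha * ln z + INR M * alpha * ln (INR M) + (/ INR M * ln z + ln (INR M)) * INR n)
    by (field; lra).
  replace (1 - 1 * (- alpha - INR n / INR M)) with (alpha + 1 + INR n * (1 / INR M)) by (field; lra).
  rewrite exp_plus, exp_mult_INR, !exp_plus, (exp_ln (INR M)) by lra.
  fold (Rpower z alpha). fold (Rpower z (/ INR M)).
  replace (- (INR M * Rpower z (/ INR M))) with ((-1) * (Rpower z (/ INR M) * INR M)) by ring.
  rewrite (Rpow_mult_distr (-1)). unfold Rdiv. rewrite !Rinv_mult. ring.
Qed.

(** The terms are residues inside some loop to the right of 0, so convergence is a by-product of the
    loop integral. *)
Lemma wright_series_10 (z : R) : 0 < z ->
  ex_series (fun n => (- (INR M ^ M * z)) ^ n
     / (INR (fact n) * RGamma (INR M * (1 + alpha) + INR n * INR M))).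
Proof.
  intro Hz. pose proof INR_M_ge_1.
  eapply ex_series_ext; [intro n; apply (gamma_residue_10 z n Hz)|].
  apply (gamma_loop_integral 1 (INR M) 0 _ _ c10
    (Loop 1 (mkposreal 1 Rlt_0_1) (mkposreal 1 Rlt_0_1))); simpl; try lra. apply c10_nonzero.
Qed.

Lemma wright_series_M0 (z : R) : 0 < z ->
  ex_series (fun n => (- (INR M * Rpower z (/ INR M))) ^ n
       / (INR (fact n) * RGamma (alpha + 1 + INR n * (1 / INR M)))).
Proof.
  intro Hz. pose proof INR_M_ge_1.
  set (k := Rpower z alpha * exp (INR M * alpha * ln (INR M)) / INR M).
  assert (Hk : 0 < k).
  { unfold k, Rpower. apply Rdiv_lt_0_compat; [|lra]. apply Rmult_lt_0_compat; apply exp_pos. }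
  apply ex_series_ext with (fun n => / k * gamma_residue (INR M) 1 alpha 1 (- ln z - INR M * ln (INR M)) n).
  { intro n. rewrite gamma_residue_M0 by auto. fold k. rewrite <- Rmult_assoc, Rinv_l by lra. apply Rmult_1_l. }
  apply (ex_series_scal (V := R_NormedModule) (/ k)).
  apply (gamma_loop_integral (INR M) 1 alpha _ _ cM0
    (Loop (1 - alpha) (mkposreal 1 Rlt_0_1) (mkposreal 1 Rlt_0_1))); simpl; try lra. apply cM0_nonzero.
Qed.

Lemma meijer_10_eq (L1 : loop) (z : R) : - 0 < loop_re L1 -> 0 < z ->
  meijer_10 L1 M kernel_nu z = (c10 * RtoC (wright_J (INR M * (1 + alpha)) (INR M) (INR M ^ M * z)))%C.
Proof.
  intros HL Hz. pose proof INR_M_ge_1. unfold meijer_10. rewrite meijer_10_integrand_eq.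
  rewrite (proj2 (gamma_loop_integral 1 (INR M) 0 (INR M * (1 + alpha)) _ c10 L1
     ltac:(lra) ltac:(lra) c10_nonzero HL)).
  do 2 f_equal. apply Series_ext. intro n. now apply gamma_residue_10.
Qed.

Lemma meijer_M0_eq (L2 : loop) (z : R) : - alpha < loop_re L2 -> 0 < z ->
  meijer_M0 L2 M kernel_nu z =
  (cM0 * RtoC ((Rpower z alpha * exp (INR M * alpha * ln (INR M)) / INR M) *
     wright_J (alpha + 1) (1 / INR M) (INR M * Rpower z (/ INR M))))%C.
Proof.
  intros HL Hz. pose proof INR_M_ge_1. unfold meijer_M0. rewrite meijer_M0_integrand_eq.
  rewrite (proj2 (gamma_loop_integral (INR M) 1 alpha 1 _ cM0 L2
     ltac:(lra) ltac:(lra) cM0_nonzero HL)).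
  do 2 f_equal. unfold wright_J. rewrite <- Series_scal_l.
  apply Series_ext. intro n. now apply gamma_residue_M0.
Qed.

(** Here the unspecified constant [A] meets its inverse, and the value becomes real. *)
Lemma meijer_product (L1 L2 : loop) (z1 z2 : R) : admissible_loops M kernel_nu L1 L2 ->
  0 < z1 -> 0 < z2 ->
  (meijer_10 L1 M kernel_nu z1 * meijer_M0 L2 M kernel_nu z2)%C =
  RtoC (exp (INR M * (1 + alpha) * ln (INR M)) / INR M *
    (wright_J (INR M * (1 + alpha)) (INR M) (INR M ^ M * z1) *
     (Rpower z2 alpha * wright_J (alpha + 1) (1 / INR M) (INR M * Rpower z2 (/ INR M))))).
Proof.
  intros HL H1 H2. pose proof INR_M_ge_1. destruct (admissible_loops_re L1 L2 HL) as [HL1 HL2].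
  rewrite meijer_10_eq, meijer_M0_eq by auto. unfold c10, cM0.
  rewrite !Cexp_RtoC.
  match goal with |- (A * ?a * ?b * (/ A * ?c * ?d))%C = _ =>
    replace (A * a * b * (/ A * c * d))%C with ((A * / A) * (a * b * (c * d)))%C by ring end.
  rewrite Cinv_r by auto. rewrite <- !RtoC_mult, Rmult_1_l. f_equal.
  rewrite exp_Ropp. field. split; [lra|apply Rgt_not_eq, exp_pos].
Qed.

End Meijer.

(** * The integrals defining the kernels *)

(** Convergence at every positive point forces an infinite radius of convergence: otherwise the
    series would converge at some point outside the disc. *)
Lemma wright_J_continuous (a b : R) :
  (forall x, 0 < x -> ex_series (fun n => (- x) ^ n / (INR (fact n) * RGamma (a + INR n * b)))) ->
  forall x, continuous (wright_J a b) x.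
Proof.
  intros H x. set (c := fun n => (-1) ^ n / (INR (fact n) * RGamma (a + INR n * b))).
  assert (E : forall t n, c n * t ^ n = (- t) ^ n / (INR (fact n) * RGamma (a + INR n * b))).
  { intros t n. unfold c. replace (- t) with ((-1) * t) by ring. rewrite Rpow_mult_distr.
    unfold Rdiv. ring. }
  apply continuous_ext with (PSeries c).
  { intro t. apply Series_ext. intro n. apply E. }
  apply continuity_pt_filterlim, PSeries_continuity. apply Rbar_not_le_lt. intro Hle.
  set (y := Rabs x + 1). assert (Py := Rabs_pos x).
  apply (CV_disk_outside c y).
  - apply Rbar_le_lt_trans with (Rabs x); auto. simpl. unfold y. rewrite (Rabs_right (_ + 1)); lra.
  - apply ex_series_lim_0. eapply ex_series_ext; [|apply (H y); unfold y; lra].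
    intro n. symmetry. apply E.
Qed.

Lemma continuous_bounded (J : R -> R) (X : R) : (forall x, continuous J x) ->
  exists B, 0 <= B /\ forall t, Rabs t <= X -> Rabs (J t) <= B.
Proof.
  intro HJ. destruct (Rle_dec 0 X) as [HX|HX].
  - destruct (continuity_ab_maj (fun t => Rabs (J t)) (- X) X) as [m [Hm _]].
    + lra.
    + intros c _. apply continuity_pt_filterlim.
      apply (continuous_Rabs_comp J c), HJ.
    + exists (Rabs (J m)). split; [apply Rabs_pos|]. intros t Ht. apply Hm.
      pose proof (Rle_abs t). pose proof (Rle_abs (- t)). rewrite Rabs_Ropp in H0. lra.
  - exists 0. split; [lra|]. intros t Ht. pose proof (Rabs_pos t). lra.
Qed.

(** * Integrands built from powers on the interval from 0 to 1 *)

Lemma Rpower_le_1 (u m : R) : 0 < u <= 1 -> 0 <= m -> Rpower u m <= 1.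
Proof.
  intros Hu Hm. unfold Rpower. rewrite <- exp_0. apply exp_le_compat.
  assert (ln u <= ln 1) by (apply ln_le; lra). rewrite ln_1 in H. nra.
Qed.

Lemma Rpower_pos (u m : R) : 0 < Rpower u m.
Proof. apply exp_pos. Qed.

Lemma Rpower_at_right_0 (m : R) : 0 < m ->
  filterlim (fun u => Rpower u m) (at_right 0) (at_right 0).
Proof.
  intros Hm Q [eps HQ]. exists (mkposreal (Rpower eps (/ m)) (Rpower_pos _ _)).
  intros u Hu Hu0. apply HQ; [|apply Rpower_pos].
  unfold ball in *; simpl in *. unfold AbsRing_ball, abs, minus, plus, opp in *; simpl in *.
  rewrite Ropp_0, Rplus_0_r in *. pose proof (Rpower_pos u m).
  rewrite Rabs_right in * by lra.
  replace (pos eps) with (Rpower (Rpower eps (/ m)) m).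
  - unfold Rpower at 1 3. apply exp_increasing. apply Rmult_lt_compat_l; auto. now apply ln_increasing.
  - rewrite Rpower_mult, Rinv_l, Rpower_1 by (try lra; apply cond_pos). reflexivity.
Qed.

Lemma is_derive_Rpower (m u : R) : 0 < u ->
  is_derive (fun v => Rpower v m) u (m * Rpower u (m - 1)).
Proof. intro Hu. apply is_derive_Reals. now apply derivable_pt_lim_power. Qed.

Lemma continuous_Rpower (m u : R) : 0 < u -> continuous (fun v => Rpower v m) u.
Proof.
  intro Hu. apply (ex_derive_continuous (V := R_NormedModule)).
  eexists. now apply is_derive_Rpower.
Qed.

Lemma at_right_0_lt_1 : at_right 0 (fun t => 0 < t < 1).
Proof.
  exists (mkposreal 1 Rlt_0_1). intros t Ht H0.
  unfold ball in Ht; simpl in Ht. unfold AbsRing_ball, abs, minus, plus, opp in Ht; simpl in Ht.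
  rewrite Ropp_0, Rplus_0_r, Rabs_right in Ht by lra. lra.
Qed.

Section PowerIntegrand.
Variables (J1 J2 : R -> R) (X Y : R).
Hypothesis (HJ1 : forall x, continuous J1 x) (HJ2 : forall x, continuous J2 x).

(** The common shape of the integrands of both kernels, preserved by the substitution [u = v^m]. *)
Definition power_integrand (m1 m2 e u : R) : R :=
  J1 (X * Rpower u m1) * J2 (Y * Rpower u m2) * Rpower u e.

Lemma continuous_power_integrand (m1 m2 e u : R) : 0 < u ->
  continuous (power_integrand m1 m2 e) u.
Proof.
  intro Hu.
  assert (A : forall (J : R -> R) X m, (forall x, continuous J x) ->
    continuous (fun u => J (X * Rpower u m)) u).
  { intros J X' m HJ. apply (continuous_comp (fun u => X' * Rpower u m) J); [|apply HJ].
    apply (continuous_scal_r X' (fun u => Rpower u m)). now apply continuous_Rpower. }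
  apply (continuous_mult (fun u => J1 (X * Rpower u m1) * J2 (Y * Rpower u m2))
    (fun u => Rpower u e)); [|now apply continuous_Rpower].
  apply (continuous_mult (fun u => J1 (X * Rpower u m1)) (fun u => J2 (Y * Rpower u m2))); auto.
Qed.

(** Both functions stay bounded on the interval, so [u^e] with [-1 < e] dominates. The second
    conclusion, on truncated integrals, is the form in which the substitution is carried out. *)
Lemma power_integrand_RInt_gen (m1 m2 e : R) : 0 < m1 -> 0 < m2 -> -1 < e ->
  exists l, is_RInt_gen (power_integrand m1 m2 e) (at_right 0) (at_point 1) l /\
    filterlim (fun t => RInt (power_integrand m1 m2 e) t 1) (at_right 0) (locally l).
Proof.
  intros Hm1 Hm2 He.
  destruct (continuous_bounded J1 (Rabs X) HJ1) as [B1 [PB1 HB1]].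
  destruct (continuous_bounded J2 (Rabs Y) HJ2) as [B2 [PB2 HB2]].
  set (B := B1 * B2).
  apply (ex_RInt_gen_dominated (power_integrand m1 m2 e) (fun u => B * Rpower u e)
    (fun u => B / (e + 1) * Rpower u (e + 1)) (at_right 0) (fun t => 0 < t < 1) 1 0).
  - apply at_right_proper_filter.
  - apply at_right_0_lt_1.
  - intros t Ht. apply (ex_RInt_continuous (V := R_CompleteNormedModule)).
    intros z Hz. apply continuous_power_integrand. rewrite Rmin_left in Hz; lra.
  - intros t t' Ht Ht' Htt. split.
    + intros s Hs. change (Rabs (power_integrand m1 m2 e s) <= B * Rpower s e).
      unfold power_integrand. rewrite !Rabs_mult, (Rabs_right (Rpower s e))
        by (apply Rle_ge, Rlt_le, Rpower_pos).
      apply Rmult_le_compat_r; [apply Rlt_le, Rpower_pos|].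
      assert (Q : forall X m, 0 < m -> Rabs (X * Rpower s m) <= Rabs X).
      { intros X' m Hm. rewrite Rabs_mult, (Rabs_right (Rpower s m))
          by (apply Rle_ge, Rlt_le, Rpower_pos).
        rewrite <- (Rmult_1_r (Rabs X')) at 2. apply Rmult_le_compat_l; [apply Rabs_pos|].
        apply Rpower_le_1; lra. }
      apply Rmult_le_compat; try apply Rabs_pos; auto.
    + apply (is_RInt_derive (fun u => B / (e + 1) * Rpower u (e + 1)) (fun u => B * Rpower u e));
      rewrite Rmin_left, Rmax_right by lra; intros z Hz.
      * replace (B * Rpower z e) with (B / (e + 1) * ((e + 1) * Rpower z (e + 1 - 1))).
        -- apply (is_derive_scal (fun u => Rpower u (e + 1)) z (B / (e + 1))).
           apply is_derive_Rpower. lra.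
        -- replace (e + 1 - 1) with e by ring. field. lra.
      * apply (continuous_scal_r B (fun u => Rpower u e)). apply continuous_Rpower. lra.
  - replace 0 with (B / (e + 1) * 0) at 2 by ring.
    apply (filterlim_comp _ _ _ (fun u => Rpower u (e + 1)) (fun v => B / (e + 1) * v) _ (locally 0)).
    + apply (filterlim_filter_le_2 (F := at_right 0) (G := at_right 0) (H := locally 0)).
      * apply filter_le_within.
      * apply Rpower_at_right_0. lra.
    + apply (continuous_scal_r (B / (e + 1)) (fun t => t) 0). apply continuous_id.
Qed.

(** The substitution [u = v^m] is made on the interval from [t] to 1, whose right end it fixes; then
    [t] tends to 0, and [t^m] with it. *)
Lemma power_integrand_subst (m m1 m2 e l l' : R) : 0 < m ->
  filterlim (fun t => RInt (power_integrand m1 m2 e) t 1) (at_right 0) (locally l) ->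
  filterlim (fun t => RInt (power_integrand (m * m1) (m * m2) (m * (e + 1) - 1)) t 1)
    (at_right 0) (locally l') ->
  l = m * l'.
Proof.
  intros Hm Hl Hl'.
  assert (H1 := filterlim_comp _ _ _ _ _ _ _ _ (Rpower_at_right_0 m Hm) Hl).
  assert (H2 := filterlim_comp _ _ _ _ (fun v => m * v) _ _ _ Hl'
    (continuous_scal_r m (fun t => t) l' (continuous_id l'))).
  cbv beta in H1, H2.
  assert (FF : ProperFilter (at_right 0)) by apply at_right_proper_filter.
  refine (filterlim_locally_unique (F := at_right 0) _ l (m * l') H1 _).
  eapply filterlim_ext_loc; [|exact H2].
  eapply filter_imp; [|exact at_right_0_lt_1]. intros t Ht. cbv beta.
  set (f := power_integrand m1 m2 e).
  set (g := power_integrand (m * m1) (m * m2) (m * (e + 1) - 1)).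
  assert (C1 : is_RInt (fun v => scal (m * Rpower v (m - 1)) (f (Rpower v m))) t 1
     (RInt f (Rpower t m) (Rpower 1 m))).
  { apply (is_RInt_comp f (fun v => Rpower v m)); rewrite Rmin_left, Rmax_right by lra; intros v Hv.
    - apply continuous_power_integrand, Rpower_pos.
    - split; [apply is_derive_Rpower; lra|].
      apply (continuous_scal_r m (fun v => Rpower v (m - 1))). apply continuous_Rpower. lra. }
  replace (Rpower 1 m) with 1 in C1 by (unfold Rpower; now rewrite ln_1, Rmult_0_r, exp_0).
  assert (C2 : is_RInt (fun v => scal m (g v)) t 1 (scal m (RInt g t 1))).
  { apply (is_RInt_scal (V := R_NormedModule)).
    apply (RInt_correct (V := R_CompleteNormedModule)), (ex_RInt_continuous (V := R_CompleteNormedModule)).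
    intros z Hz. apply continuous_power_integrand. rewrite Rmin_left in Hz; lra. }
  rewrite <- (is_RInt_unique _ _ _ _ C1). symmetry.
  transitivity (RInt (fun v => scal m (g v)) t 1); [|exact (is_RInt_unique _ _ _ _ C2)].
  apply RInt_ext. rewrite Rmin_left, Rmax_right by lra. intros v Hv.
  unfold scal; simpl; unfold mult; simpl. unfold f, g, power_integrand.
  rewrite !Rpower_mult.
  replace (m * (e + 1) - 1) with (m * e + (m - 1)) by ring. rewrite Rpower_plus. ring.
Qed.

End PowerIntegrand.

Lemma is_RInt_gen_ext_0_1 {V : NormedModule R_AbsRing} (f g : R -> V) (l : V) :
  (forall u, 0 < u < 1 -> f u = g u) ->
  is_RInt_gen f (at_right 0) (at_point 1) l -> is_RInt_gen g (at_right 0) (at_point 1) l.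
Proof.
  intro H. apply is_RInt_gen_ext; try typeclasses eauto.
  apply Filter_prod with (fun t => 0 < t < 1) (fun b => b = 1).
  - apply at_right_0_lt_1.
  - reflexivity.
  - intros t b Ht ->. simpl. rewrite Rmin_left, Rmax_right by lra. intros u Hu. apply H. lra.
Qed.

Lemma is_RInt_gen_RtoC (f : R -> R) (Fa Fb : (R -> Prop) -> Prop) (l : R) :
  Filter Fa -> Filter Fb -> is_RInt_gen f Fa Fb l ->
  is_RInt_gen (V := C_R_NormedModule) (fun u => RtoC (f u)) Fa Fb (RtoC l).
Proof.
  intros FFa FFb H Q [eps HQ].
  assert (HP : locally l (fun y => Q (RtoC y))).
  { exists eps. intros y Hy. apply HQ. split; [exact Hy|]. apply (ball_center (M := R_UniformSpace)). }
  specialize (H _ HP). unfold filtermapi in *.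
  eapply filter_imp; [|exact H]. intros [a b] [y [Hy HQy]]. exists (RtoC y). split; auto.
  apply is_CInt_Re_Im; simpl; auto.
  evar_last; [apply (is_RInt_const (V := R_NormedModule) a b 0)|].
  unfold scal; simpl; unfold mult; simpl; ring.
Qed.

Lemma pow_INR_exp (M : nat) : (1 <= M)%nat -> INR M ^ M = exp (INR M * ln (INR M)).
Proof.
  intro HM. rewrite <- Rpower_pow by (apply lt_0_INR; lia). reflexivity.
Qed.

Lemma wright_J_INR_continuous (M : nat) (alpha : R) : (1 <= M)%nat -> -1 < alpha ->
  forall t, continuous (wright_J (INR M * (1 + alpha)) (INR M)) t.
Proof.
  intros HM Ha. assert (PM : 1 <= INR M) by (apply (le_INR 1); auto).
  assert (PMM : 0 < INR M ^ M) by (apply pow_lt; lra).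
  destruct (rgamma_mult M HM) as [A [HA _]].
  apply wright_J_continuous. intros t Ht.
    eapply ex_series_ext; [|apply (wright_series_10 M alpha A HM HA (t / INR M ^ M))].
    - intro n. cbv beta. replace (INR M ^ M * (t / INR M ^ M)) with t by (field; lra). reflexivity.
    - apply Rdiv_lt_0_compat; auto.
Qed.

Lemma wright_J_inv_INR_continuous (M : nat) (alpha : R) : (1 <= M)%nat -> -1 < alpha ->
  forall t, continuous (wright_J (alpha + 1) (1 / INR M)) t.
Proof.
  intros HM Ha. assert (PM : 1 <= INR M) by (apply (le_INR 1); auto).
  assert (PMM : 0 < INR M ^ M) by (apply pow_lt; lra).
  destruct (rgamma_mult M HM) as [A [HA _]].
  apply wright_J_continuous. intros t Ht.
    eapply ex_series_ext; [|apply (wright_series_M0 M alpha A HM HA (Rpower (t / INR M) (INR M)))].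
    - intro n. cbv beta. rewrite Rpower_mult, Rinv_r, Rpower_1 by (try (apply Rdiv_lt_0_compat); lra).
      replace (INR M * (t / INR M)) with t by (field; lra). reflexivity.
    - apply Rpower_pos.
Qed.

(** The starting point of both parts of the theorem; in (b) it is used with [x] and [y] exchanged
    and another [alpha]. *)
Lemma K_meijer_eq (M : nat) (alpha x y : R) (L1 L2 : loop) :
  (1 <= M)%nat -> -1 < alpha -> 0 < x -> 0 < y ->
  admissible_loops M (kernel_nu M alpha) L1 L2 ->
  exists l,
    is_RInt_gen (power_integrand (wright_J (INR M * (1 + alpha)) (INR M))
        (wright_J (alpha + 1) (1 / INR M)) (INR M ^ M * x) (INR M * Rpower y (/ INR M))
        1 (/ INR M) alpha) (at_right 0) (at_point 1) l /\
    filterlim (fun t => RInt (power_integrand (wright_J (INR M * (1 + alpha)) (INR M))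
        (wright_J (alpha + 1) (1 / INR M)) (INR M ^ M * x) (INR M * Rpower y (/ INR M))
        1 (/ INR M) alpha) t 1) (at_right 0) (locally l) /\
    K_meijer L1 L2 M (kernel_nu M alpha) x y =
      RtoC (exp (INR M * (1 + alpha) * ln (INR M)) / INR M * Rpower y alpha * l).
Proof.
  intros HM Ha Hx Hy HL. assert (PM : 1 <= INR M) by (apply (le_INR 1); auto).
  assert (PMM : 0 < INR M ^ M) by (apply pow_lt; lra).
  assert (PiM : 0 < / INR M) by (apply Rinv_0_lt_compat; lra).
  destruct (rgamma_mult M HM) as [A [HA Hmult]].
  pose proof (wright_J_INR_continuous M alpha HM Ha) as C1.
  pose proof (wright_J_inv_INR_continuous M alpha HM Ha) as C2.
  destruct (power_integrand_RInt_gen _ _ (INR M ^ M * x) (INR M * Rpower y (/ INR M)) C1 C2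
     1 (/ INR M) alpha) as [l [H1 H2]]; auto; try lra.
  exists l. split; [exact H1|]. split; [exact H2|].
  unfold K_meijer. apply (is_RInt_gen_unique (V := C_R_CompleteNormedModule)).
  set (k := exp (INR M * (1 + alpha) * ln (INR M)) / INR M * Rpower y alpha).
  apply (is_RInt_gen_ext_0_1 (V := C_R_NormedModule) (fun u => RtoC (k *
    power_integrand (wright_J (INR M * (1 + alpha)) (INR M))
        (wright_J (alpha + 1) (1 / INR M)) (INR M ^ M * x) (INR M * Rpower y (/ INR M))
        1 (/ INR M) alpha u))).
  - intros u Hu.
    rewrite (meijer_product M alpha A HM Ha HA Hmult L1 L2 (u * x) (u * y) HL) by nra.
    apply (f_equal RtoC). unfold k, power_integrand.
    rewrite Rpower_1 by lra.
    rewrite <- (Rpower_mult_distr u y) by lra. rewrite <- (Rpower_mult_distr u y) by lra.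
    replace (INR M ^ M * (u * x)) with (INR M ^ M * x * u) by ring.
    replace (INR M * (Rpower u (/ INR M) * Rpower y (/ INR M))) with
      (INR M * Rpower y (/ INR M) * Rpower u (/ INR M)) by ring. ring.
  - apply is_RInt_gen_RtoC; try typeclasses eauto.
    now apply (is_RInt_gen_scal (V := R_NormedModule)).
Qed.

(** The parameters are variables tied by equations, since those coming from the Meijer side agree
    with those of the Wright kernel only after algebra. *)
Lemma K_wright_eq (alpha theta x y a1 b1 a2 b2 X Y m l : R) :
  a1 = (alpha + 1) / theta -> b1 = / theta -> a2 = alpha + 1 -> b2 = theta ->
  X = x -> Y = Rpower y theta -> m = theta -> 0 < y ->
  is_RInt_gen (power_integrand (wright_J a1 b1) (wright_J a2 b2) X Y 1 m alpha)
    (at_right 0) (at_point 1) l ->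
  K_wright alpha theta x y = theta * Rpower x alpha * l.
Proof.
  intros -> -> -> -> -> -> -> Hy H. unfold K_wright. f_equal.
  apply (is_RInt_gen_unique (V := R_CompleteNormedModule)).
  revert H. apply is_RInt_gen_ext_0_1. intros u Hu. unfold power_integrand.
  rewrite Rpower_1, Rpower_mult_distr by lra. reflexivity.
Qed.

Theorem theorem5p1 (M : nat) (alpha : R) (hM : (1 <= M)%nat)
    (halpha : -1 < alpha) (x y : R) (hx : 0 < x) (hy : 0 < y) :
  (let nu := fun j : nat => alpha + (INR j - 1) / INR M in
   forall L1 L2 : loop, admissible_loops M nu L1 L2 ->
     RtoC (INR M ^ M * K_wright alpha (1 / INR M) (INR M ^ M * x) (INR M ^ M * y))
     = (RtoC (Rpower (x / y) alpha) * K_meijer L1 L2 M nu x y)%C)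
  /\
  (let nu := fun j : nat => alpha / INR M - 1 + INR j / INR M in
   forall L1 L2 : loop, admissible_loops M nu L1 L2 ->
     RtoC (Rpower x (1 / INR M - 1)
           * K_wright alpha (INR M) (INR M * Rpower x (1 / INR M))
                                    (INR M * Rpower y (1 / INR M)))
     = K_meijer L1 L2 M nu y x).
Proof.
  assert (PM : 1 <= INR M) by (apply (le_INR 1); auto).
  assert (PMM : 0 < INR M ^ M) by (apply pow_lt; lra).
  assert (Pe : INR M = exp (ln (INR M))) by (rewrite exp_ln; lra).
  split; intros nu L1 L2 HL.
  - change nu with (kernel_nu M alpha) in *.
    destruct (K_meijer_eq M alpha x y L1 L2 hM halpha hx hy HL) as [l [H1 [_ ->]]].
    (* [H1] determines the parameters by unification; the goals after the first check them. *)
    rewrite (K_wright_eq alpha (1 / INR M) _ _ _ _ _ _ _ _ _ l) with (9 := H1).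
    + rewrite <- RtoC_mult. f_equal.
      rewrite pow_INR_exp by auto. unfold Rpower.
      rewrite ln_div, ln_mult, ln_exp by (auto using exp_pos).
      match goal with |- ?u * (?v * ?w * l) = ?p * (?q / INR M * ?r * l) =>
        replace (u * (v * w * l)) with (u * w * (l / INR M)) by (field; lra);
        replace (p * (q / INR M * r * l)) with (p * q * r * (l / INR M)) by (field; lra) end.
      f_equal. rewrite <- !exp_plus. f_equal. ring.
    + field. lra.
    + field. lra.
    + reflexivity.
    + reflexivity.
    + reflexivity.
    + rewrite <- Rpower_mult_distr by lra. f_equal; [|f_equal; field; lra].
      rewrite <- Rpower_pow, Rpower_mult by lra.
      replace (INR M * (1 / INR M)) with 1 by (field; lra). rewrite Rpower_1; lra.
    + field. lra.
    + nra.
  (* The shift for which [beta + (j - 1)/M = alpha/M - 1 + j/M]. *)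
  - set (beta := (alpha + 1) / INR M - 1).
    assert (Hbeta : -1 < beta).
    { unfold beta. assert (0 < (alpha + 1) / INR M) by (apply Rdiv_lt_0_compat; lra). lra. }
    assert (E : nu = kernel_nu M beta).
    { apply functional_extensionality. intro j. unfold nu, kernel_nu, beta. field. lra. }
    rewrite E in *.
    destruct (K_meijer_eq M beta y x L1 L2 hM Hbeta hy hx HL) as [l [H1 [H2 ->]]].
    (* The integral after [u = v^M]: the exponents [1], [1/M], [beta] become [M], [1], [alpha]. *)
    destruct (power_integrand_RInt_gen _ _ (INR M ^ M * y) (INR M * Rpower x (/ INR M))
      (wright_J_INR_continuous M beta hM Hbeta) (wright_J_inv_INR_continuous M beta hM Hbeta)
      (INR M * 1) (INR M * / INR M) (INR M * (beta + 1) - 1)) as [l' [H3 H4]].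
    { lra. } { rewrite Rinv_r; lra. } { nra. }
    rewrite (power_integrand_subst _ _ _ _ (wright_J_INR_continuous M beta hM Hbeta)
      (wright_J_inv_INR_continuous M beta hM Hbeta) (INR M) _ _ _ l l' ltac:(lra) H2 H4).
    replace (INR M * (beta + 1) - 1) with alpha in H3 by (unfold beta; field; lra).
    rewrite Rinv_r, Rmult_1_r in H3 by lra.
    (* The two Wright functions change places: the one linear in [v] comes first in [K_wright]. *)
    assert (H5 : is_RInt_gen (power_integrand (wright_J (beta + 1) (1 / INR M))
      (wright_J (INR M * (1 + beta)) (INR M)) (INR M * Rpower x (/ INR M)) (INR M ^ M * y)
      1 (INR M) alpha) (at_right 0) (at_point 1) l').
    { revert H3. apply is_RInt_gen_ext_0_1. intros u _. unfold power_integrand.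
      match goal with |- ?u = ?v => change (@eq R u v) end. ring. }
    rewrite (K_wright_eq alpha (INR M) _ _ _ _ _ _ _ _ _ l') with (9 := H5).
    + f_equal. unfold beta. unfold Rpower.
      rewrite ln_mult, ln_exp by (auto using exp_pos; lra).
      match goal with |- ?u * (?v * ?w * l') = ?p / ?v * ?q * (?v * l') =>
        replace (u * (v * w * l')) with (u * w * (v * l')) by ring;
        replace (p / v * q * (v * l')) with (p * q * exp (- ln v) * (v * l'))
          by (rewrite exp_Ropp, <- Pe; field; lra) end.
      f_equal. rewrite <- !exp_plus. f_equal.
      field. lra.
    + unfold beta. field. lra.
    + field. lra.
    + unfold beta. field. lra.
    + reflexivity.
    + do 2 f_equal. field. lra.
    + rewrite <- Rpower_mult_distr by (try apply Rpower_pos; lra).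
      rewrite Rpower_pow, Rpower_mult by lra.
      replace (1 / INR M * INR M) with 1 by (field; lra). rewrite Rpower_1; lra.
    + reflexivity.
    + apply Rmult_lt_0_compat; [lra|apply Rpower_pos].
Qed.
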